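(* Let $\rho>0$ and $\frac12<\nu<1$. Let $\alpha\in(0,1)\setminus\mathbb{Q}$ be Diophantine and let $A\in G_\rho^\nu(\mathbb{T},SL(2,\mathbb{R}))$. Let $p_n/q_n$ be the continued fraction convergents of $\alpha$, and let $A_n\in G_\rho^\nu(\mathbb{T},SL(2,\mathbb{R}))$ be such that $\|A_n-A\|_{\nu,\rho}\to0$. Then $$\lim_{n\to\infty}L(p_n/q_n,A_n)=L(\alpha,A).$$
   Context: $\mathbb{T}=\mathbb{R}/\mathbb{Z}$. For a (matrix-valued) function $f(\theta)=\sum_{k\in\mathbb{Z}}\widehat f(k)e^{2\pi ik\theta}$ on $\mathbb{T}$, $\|f\|_{\nu,\rho}=\sum_{k\in\mathbb{Z}}|\widehat f(k)|e^{|2\pi k|^\nu\rho}$; $G_\rho^\nu(\mathbb{T},* )$ is the set of $*$-valued functions with finite $\|\cdot\|_{\nu,\rho}$. $\alpha$ is Diophantine if there exist $v>0,\tau>1$ such that $\inf_{j\in\mathbb{Z}}|n\alpha-j|>v|n|^{-\tau}$ for all $n\in\mathbb{Z}\setminus\{0\}$. For $\beta\in\mathbb{R}$ (rational or irrational) and $A\in C^0(\mathbb{T},SL(2,\mathbb{R}))$, the Lyapunov exponent is $L(\beta,A)=\lim_{N\to\infty}\frac1N\int_{\mathbb{T}}\ln\|A(\theta+(N-1)\beta)\cdots A(\theta+\beta)A(\theta)\|\,d\theta$. *)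

(* Defs.v *)
From HB Require Import structures.
From mathcomp Require Import all_boot all_order all_algebra.
From mathcomp Require Import all_classical all_reals all_analysis.
From mathcomp Require Import complex.

Set Implicit Arguments.
Unset Strict Implicit.
Unset Printing Implicit Defensive.

Import Order.TTheory GRing.Theory Num.Theory.
Import numFieldNormedType.Exports.

Local Open Scope classical_set_scope.
Local Open Scope ring_scope.
Local Open Scope complex_scope.

(* Functions on the circle R/Z are 1-periodic functions on R, and the integral
   over the circle is the Lebesgue integral over `[0, 1]. *)

Definition periodic1 (R : realType) (T : Type) (f : R -> T) : Prop :=
  forall t, f (t + 1) = f t.

(* The parameter [abs] is the modulus of the scalar field: [Num.norm] for R,
   the real-valued [ComplexField.Normc.normc] for R[i]. *)
Definition euclid_norm (R : realType) (K : nzRingType) (abs : K -> R) (d : nat)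
    (v : 'cV[K]_d) : R :=
  Num.sqrt (\sum_(i < d) abs (v i 0) ^+ 2).

Definition op_norm (R : realType) (K : nzRingType) (abs : K -> R) (d : nat)
    (M : 'M[K]_d) : R :=
  sup [set euclid_norm abs (M *m v) | v in [set v | euclid_norm abs v <= 1]].

Definition cexp2pi (R : realType) (k : int) (t : R) : R[i] :=
  cos (2 * pi * k%:~R * t) +i* sin (2 * pi * k%:~R * t).

(* k-th Fourier coefficient: the integral of f(t) e^{-2 pi i k t} over the
   circle, with real and imaginary parts written out since f is real. *)
Definition fourier_coef (R : realType) (d : nat) (f : R -> 'M[R]_d) (k : int) :
    'M[R[i]]_d :=
  \matrix_(i, j)
    ((\int[lebesgue_measure]_(t in `[0, 1])
        (f t i j * cos (2 * pi * k%:~R * t))) +i*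
     (- \int[lebesgue_measure]_(t in `[0, 1])
        (f t i j * sin (2 * pi * k%:~R * t)))).

Definition gevrey_norm (R : realType) (nu rho : R) (d : nat)
    (f : R -> 'M[R]_d) : \bar R :=
  \esum_(k in [set: int])
    (op_norm (@ComplexField.Normc.normc R) (fourier_coef f k)
     * expR (`|2 * pi * k%:~R| `^ nu * rho))%:E.

(* Sum over -N <= k <= N. *)
Definition fourier_partial (R : realType) (d : nat) (f : R -> 'M[R]_d)
    (t : R) (N : nat) : 'M[R[i]]_d :=
  \sum_(0 <= m < N.*2.+1)
    (cexp2pi (m%:Z - N%:Z) t *: fourier_coef f (m%:Z - N%:Z)).

(* Finiteness of the norm makes the Fourier series absolutely and uniformly
   convergent; requiring f to be its sum at every point (not just almost
   everywhere) makes f continuous. *)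
Definition gevrey (R : realType) (nu rho : R) (d : nat)
    (f : R -> 'M[R]_d) : Prop :=
  [/\ periodic1 f,
      (gevrey_norm nu rho f < +oo)%E &
      forall t : R,
        (fun N => op_norm (@ComplexField.Normc.normc R)
           (fourier_partial f t N - map_mx (real_complex R) (f t))) @ \oo
          --> (0 : R)].

Definition gevrey_SL2 (R : realType) (nu rho : R) (A : R -> 'M[R]_2) : Prop :=
  gevrey nu rho A /\ forall t, \det (A t) = 1.

Definition diophantine (R : realType) (alpha : R) : Prop :=
  exists v tau : R, [/\ 0 < v, 1 < tau &
    forall n : int, n != 0 ->
      inf [set `|n%:~R * alpha - j%:~R| | j in [set: int]]
        > v * `|n%:~R| `^ (- tau)].

(* A(t + (N-1) beta) ... A(t + beta) A(t) *)
Fixpoint cocycle (R : realType) (beta : R) (A : R -> 'M[R]_2) (N : nat)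
    (t : R) : 'M[R]_2 :=
  if N is N'.+1 then A (t + N'%:R * beta) *m cocycle beta A N' t else 1%:M.

(* The limit exists for continuous A, by subadditivity. *)
Definition lyapunov (R : realType) (beta : R) (A : R -> 'M[R]_2) : R :=
  lim ((fun N : nat => N%:R^-1 *
    \int[lebesgue_measure]_(t in `[0, 1])
      ln (op_norm Num.norm (cocycle beta A N t))) @ \oo).

(* Complete quotients x_0 = x, x_(n+1) = 1 / (x_n - floor x_n). *)
Fixpoint cf_complete (R : realType) (x : R) (n : nat) : R :=
  if n is m.+1 then
    (cf_complete x m - (Num.floor (cf_complete x m))%:~R)^-1
  else x.

Definition cf_digit (R : realType) (x : R) (n : nat) : int :=
  Num.floor (cf_complete x n).

(* (p_n, p_(n-1)), with p_(-1) = 1 *)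
Fixpoint cf_num_pair (R : realType) (x : R) (n : nat) : int * int :=
  if n is m.+1 then
    let: (p, p') := cf_num_pair x m in (cf_digit x m.+1 * p + p', p)
  else (cf_digit x 0, 1).

(* (q_n, q_(n-1)), with q_(-1) = 0 *)
Fixpoint cf_den_pair (R : realType) (x : R) (n : nat) : int * int :=
  if n is m.+1 then
    let: (q, q') := cf_den_pair x m in (cf_digit x m.+1 * q + q', q)
  else (1, 0).

Definition cf_num (R : realType) (x : R) (n : nat) : int :=
  (cf_num_pair x n).1.

Definition cf_den (R : realType) (x : R) (n : nat) : int :=
  (cf_den_pair x n).1.

(* Main.v *)
(* Truncating the Fourier series turns ln |A_N|, for the N-step cocycle A_N, into
   half of ln |P| on the unit circle for a polynomial P, up to a constant.  Jensen's
   formula counts the zeros of P in an annulus whose width is the width on which the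
   truncated cocycle stays bounded, and averaging the functions ln |1 - w e(t)| along
   the orbit of a frequency whose first Q multiples are well separated shows that
   ln |A_N| is close to its mean off a small union of arcs, for N of order Q (ln Q)^2.
   The annulus has to be wider than 1/Q, and this is where nu > 1/2 is needed.

   Write L_N for the mean of ln |A_N| divided by N.  By the avalanche principle the
   large deviation estimates at scales N and 2N give L_N' = 2 L_2N - L_N up to a tiny
   error for all N' between N and a power of N, and for all large N' if the frequency
   is p/q with q at most a power of N.  The denominators q_j, j <= n, of the
   convergents of alpha are separating scales for p_n/q_n, and q_(j+1) is at most a
   power of q_j by the Diophantine condition.  Hence a lower bound for L_N at a fixed
   initial scale, where L_N depends continuously on the frequency and the cocycle,
   propagates along the q_j to L(p_n/q_n, A_n).  The upper bound is subadditivity. *)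
From HB Require Import structures.
Require Import Defs.
From mathcomp Require Import all_boot all_order all_algebra.
From mathcomp Require Import all_classical all_reals all_analysis.
From mathcomp Require Import complex ring lra zify.

Set Implicit Arguments.
Unset Strict Implicit.
Unset Printing Implicit Defensive.

Import Order.TTheory GRing.Theory Num.Theory.
Import numFieldNormedType.Exports.
Import ComplexField.Normc.

Local Open Scope classical_set_scope.
Local Open Scope ring_scope.
Local Open Scope complex_scope.
Local Notation cRe := complex.Re.
Local Notation cIm := complex.Im.

(** * Logarithmic singularities *)

(** The only arithmetic input to the deviation estimates is [separated b Q], so they are uniform
    over rational and irrational frequencies. With Q about 2^J, one average over 64 Q points merely
    halves the Fourier modes up to Q; it is repeated 8 J times so that the damping beats the number
    of zeros, which is a power of Q. The window then has length of order J Q, and moving ln |A_N|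
    along it costs a constant per step; this must be small against N, whence N of order J^2 Q. A
    zero closer than d = 8 J / Q to the circle is moved to distance d, at a cost of order d J after
    averaging. There are O(N / l) such zeros in a strip of width l of order N^(1 - 1/nu), so the
    total is N times a power of J times Q^(1/nu - 2). Passing to a larger scale loses a small
    multiple of 1 / J; as J roughly doubles at each link, a margin 8 / J in the induction pays for
    all losses. An orbit of p / q has at most q phases, so the arcs to be excluded do not multiply
    when N' tends to infinity. *)

Section ComplexBasics.
Variable R : realType.
Implicit Types (x y t : R) (z w : R[i]).

Lemma normc_norm z : (normc z)%:C = `|z|.
Proof. by case: z => a b; rewrite /Num.norm. Qed.

Lemma normc_ge0 z : 0 <= normc z.
Proof. by case: z => a b; rewrite /= sqrtr_ge0. Qed.

Lemma normcD z w : normc (z + w) <= normc z + normc w.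
Proof. by rewrite -lecR rmorphD /= !normc_norm ler_normD. Qed.

Lemma normcN z : normc (- z) = normc z.
Proof. by case: z => a b /=; rewrite !sqrrN. Qed.

Lemma normcB z w : normc (z - w) <= normc z + normc w.
Proof. by rewrite -(normcN w) normcD. Qed.

Lemma normc_distC z w : normc (z - w) = normc (w - z).
Proof. by rewrite -normcN opprB. Qed.

Lemma normcBl z w : normc z - normc w <= normc (z - w).
Proof. by rewrite lerBlDr; apply: le_trans (normcD _ _); rewrite subrK. Qed.

Lemma normc_sum (I : Type) (r : seq I) (P : pred I) (F : I -> R[i]) :
  normc (\sum_(i <- r | P i) F i) <= \sum_(i <- r | P i) normc (F i).
Proof.
elim/big_ind2: _ => [||i _]; last by [].
  by rewrite normc0.
by move=> a b c d ab cd; apply: le_trans (normcD _ _) _; exact: lerD.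
Qed.

Lemma normc_prod (I : Type) (r : seq I) (P : pred I) (F : I -> R[i]) :
  normc (\prod_(i <- r | P i) F i) = \prod_(i <- r | P i) normc (F i).
Proof. by apply: (big_morph _ (@normcM R)); rewrite normc1. Qed.

Lemma normcX z n : normc (z ^+ n) = normc z ^+ n.
Proof. by elim: n => [|n IH]; rewrite ?expr0 ?normc1// !exprS normcM IH. Qed.

Lemma normcR x : normc (x%:C) = `|x|.
Proof. by rewrite /= expr0n/= addr0 sqrtr_sqr. Qed.

Lemma normc_nat n : normc (n%:R : R[i]) = n%:R.
Proof. by rewrite -(rmorph_nat (real_complex R)) normcR ger0_norm. Qed.

Lemma Re_le_normc z : `|cRe z| <= normc z.
Proof.
case: z => a b /=; rewrite -sqrtr_sqr; apply: ler_wsqrtr.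
by rewrite lerDl sqr_ge0.
Qed.

Lemma Im_le_normc z : `|cIm z| <= normc z.
Proof.
case: z => a b /=; rewrite -sqrtr_sqr; apply: ler_wsqrtr.
by rewrite lerDr sqr_ge0.
Qed.

Lemma normc_conj z : normc z^* = normc z.
Proof. by case: z => a b /=; rewrite sqrrN. Qed.

Lemma sqr_normcE z : normc z ^+ 2 = cRe z ^+ 2 + cIm z ^+ 2.
Proof. by case: z => a b /=; rewrite sqr_sqrtr// addr_ge0 ?sqr_ge0. Qed.

Lemma normc_eq0 z : (normc z == 0) = (z == 0).
Proof. by apply/eqP/eqP => [/eq0_normc//|->]; exact: (@normc0 R). Qed.

Lemma normc_gt0 z : (0 < normc z) = (z != 0).
Proof. by rewrite lt0r normc_ge0 andbT normc_eq0. Qed.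

Definition circ t : R[i] := cos (2 * pi * t) +i* sin (2 * pi * t).

Lemma circD x y : circ (x + y) = circ x * circ y.
Proof.
rewrite /circ mulrDr cosD sinD.
by apply/eqP; rewrite eq_complex /=; apply/andP; split; apply/eqP; ring.
Qed.

Lemma circ0 : circ 0 = 1.
Proof. by rewrite /circ mulr0 cos0 sin0. Qed.

Lemma normc_circ x : normc (circ x) = 1.
Proof. by rewrite /= cos2Dsin2 sqrtr1. Qed.

Lemma circ_neq0 x : circ x != 0.
Proof. by rewrite -normc_gt0 normc_circ. Qed.

Lemma circ1 : circ 1 = 1.
Proof.
by rewrite /circ mulr1 mulrC mulr_natr; have := cosD2pi (0 : R); have := sinD2pi (0 : R);
   rewrite !add0r cos0 sin0 => -> ->.
Qed.

Lemma circMn n x : circ (n%:R * x) = circ x ^+ n.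
Proof.
by elim: n => [|n IH]; rewrite ?mul0r ?circ0// -natr1 mulrDl mul1r circD IH exprSr.
Qed.

Lemma circ_nat n : circ n%:R = 1.
Proof. by rewrite -[n%:R]mulr1 circMn circ1 expr1n. Qed.

Lemma circN x : circ (- x) = (circ x)^-1.
Proof.
by apply: (mulfI (circ_neq0 x)); rewrite -circD subrr circ0 divff ?circ_neq0.
Qed.

Lemma circ_int (j : int) : circ j%:~R = 1.
Proof.
case: j => n; first by rewrite -pmulrn circ_nat.
by rewrite NegzE mulrNz circN -pmulrn circ_nat invr1.
Qed.

Lemma circB x y : circ (x - y) = circ x / circ y.
Proof. by rewrite circD circN. Qed.

Lemma circDint x (j : int) : circ (x + j%:~R) = circ x.
Proof. by rewrite circD circ_int mulr1. Qed.

Lemma sqr_chord x : normc (1 - circ x) ^+ 2 = 2 - 2 * cos (2 * pi * x).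
Proof.
rewrite sqr_normcE /=; have := cos2Dsin2 (2 * pi * x).
set c := cos _; set s := sin _ => h.
have -> : (1 - c) ^+ 2 + (0 - s) ^+ 2 = 1 - 2 * c + (c ^+ 2 + s ^+ 2) by ring.
by rewrite h; ring.
Qed.

(** The sharp constant is 4; the constant 1 suffices. Small arguments use the mean value theorem for
    sin, the others [sqr_chord] and the monotonicity of cos. *)
Lemma chord_half x : `|x| <= 2^-1 -> `|x| <= normc (1 - circ x).
Proof.
wlog x0 : x / 0 <= x.
  move=> H; case: (leP 0 x) => [|/ltW x0]; first exact: H.
  have := H (- x); rewrite oppr_ge0 normrN => /(_ x0) H1 /H1 H2.
  apply: le_trans H2 _; rewrite circN -[X in X <= _]mul1r -(normc_circ x) -normcM.
  by rewrite mulrBr mulr1 mulfV ?circ_neq0// normc_distC.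
rewrite ger0_norm// => x2.
have pi0 := pi_gt0 R; have pi2 := pi_ge2 R.
(* Rational bounds for 1 / sqrt 2, enough for the polynomial arithmetic below. *)
have cos4 : 2^-1 <= cos (pi / 4 : R) <= 3 / 4.
  have := cos2Dsin2 (pi / 4 : R).
  have -> : sin (pi / 4 : R) = cos (pi / 4).
    by rewrite -cosBpihalf -cosN; congr cos; lra.
  have : 0 <= cos (pi / 4 : R) by apply: cos_ge0_pihalf; apply/andP; split; lra.
  by move=> h h2; apply/andP; split; rewrite leNgt; apply/negP => h3; nra.
have [x8|x8] := leP x (8^-1); last first.
  rewrite -(@ler_sqr _ x) ?nnegrE ?normc_ge0// sqr_chord.
  have : cos (2 * pi * x) < cos (pi / 4).
    by rewrite ltr_cos ?in_itv /=; [nra|apply/andP; split; nra|apply/andP; split; nra].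
  by case/andP: cos4 => *; nra.
apply: le_trans (Im_le_normc _) => /=; rewrite sub0r normrN.
have [->|xn0] := eqVneq x 0; first by rewrite normr_ge0.
have x1 : 0 < x by rewrite lt0r xn0.
have y0 : 0 < 2 * pi * x by rewrite !mulr_gt0.
have [c cI] := @MVT R sin cos 0 (2 * pi * x) y0 (fun (z : R) _ => is_derive_sin z)
  (@continuous_subspaceT _ _ _ _ (@continuous_sin R)).
rewrite sin0 !subr0 => ->.
have : cos (pi / 4) < cos c.
  move: cI; rewrite in_itv /= => /andP[c0 c1].
  by rewrite ltr_cos ?in_itv /=; [nra|apply/andP; split; nra|apply/andP; split; nra].
case/andP: cos4 => h1 h2 h3.
by apply: le_trans (ler_norm _); nra.
Qed.

Lemma chord_int x : exists j : int, `|x - j%:~R| <= normc (1 - circ x).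
Proof.
exists (Num.floor (x + 2^-1)).
set j := Num.floor _.
rewrite -(circDint x (- j)) mulrNz; apply: chord_half.
have := floor_le_tmp (x + 2^-1); have := floorD1_gt (x + 2^-1).
by rewrite -/j rmorphD /= ler_norml => *; apply/andP; split; lra.
Qed.

Lemma chord_dist x (s : R) :
  (forall j : int, s <= `|x - j%:~R|) -> s <= normc (1 - circ x).
Proof. by have [j jx] := chord_int x => /(_ j) h; exact: le_trans jx. Qed.

End ComplexBasics.

(** * Taylor expansion of the logarithmic singularity *)

Section LogExpansion.
Variable R : realType.
Implicit Types (x : R[i]) (t : R).

(* The error is estimated along the ray [t * x]: the derivative in [t] of the
   left-hand side is the tail of a geometric series. *)
Lemma ln_normc_expansion x (Q : nat) : normc x < 1 ->
  `|ln (normc (1 - x)) + \sum_(k < Q) cRe (x ^+ k.+1) / k.+1%:R|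
    <= normc x ^+ Q.+1 / (1 - normc x).
Proof.
move=> x1.
pose r2 := normc x ^+ 2; pose a := cRe x.
pose D t := 1 - 2 * t * a + t ^+ 2 * r2.
have DE t : D t = normc (1 - t%:C * x) ^+ 2.
  rewrite /D /r2 !sqr_normcE /a; case: (x) => u v /=; ring.
have D_ge t : 0 <= t <= 1 -> (1 - normc x) <= normc (1 - t%:C * x).
  move=> /andP[t0 t1]; apply: le_trans (normcBl _ _); rewrite normc1 normcM normcR.
  by rewrite ger0_norm// lerB// ler_piMl// normc_ge0.
have D_gt0 t : 0 <= t <= 1 -> 0 < D t.
  by move=> t01; rewrite DE exprn_gt0// (lt_le_trans _ (D_ge _ t01))// subr_gt0.
(* Half the logarithm of the real polynomial [D], so that only real derivatives occur. [G] vanishes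
   at 0, and its value at 1 is the quantity to bound. *)
pose G t := 2^-1 * ln (D t) + \sum_(k < Q) t ^+ k.+1 * (cRe (x ^+ k.+1) / k.+1%:R).
pose dG t := (- a + t * r2) / D t + \sum_(k < Q) t ^+ k * cRe (x ^+ k.+1).
have dGP t : 0 <= t <= 1 -> is_derive t 1 G (dG t).
  move=> t01; rewrite /G /dG; apply: is_deriveD.
    have D0 := D_gt0 _ t01.
    have dD : is_derive t 1 D (2 * (- a + t * r2)).
      rewrite /D; apply: is_derive_eq; rewrite /GRing.scale/=; ring.
    have := is_derive1_comp (is_derive1_ln D0) dD => dlnD.
    have -> : (- a + t * r2) / D t = 2^-1 * ((D t)^-1 * (2 * (- a + t * r2))).
      by rewrite [RHS]mulrCA mulKf ?pnatr_eq0// mulrC.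
    exact: (is_deriveZ 2^-1 dlnD).
  have -> : (fun t => \sum_(k < Q) t ^+ k.+1 * (cRe (x ^+ k.+1) / k.+1%:R)) =
     \sum_(k < Q) (fun t => t ^+ k.+1 * (cRe (x ^+ k.+1) / k.+1%:R)).
    by apply/funext => u; rewrite fct_sumE.
  apply: is_derive_sum => k.
  have -> : t ^+ k * cRe (x ^+ k.+1) = (cRe (x ^+ k.+1) / k.+1%:R) * (k.+1%:R * t ^+ k).
    by rewrite mulrA divfK ?pnatr_eq0// mulrC.
  have -> : (fun t => t ^+ k.+1 * (cRe (x ^+ k.+1) / k.+1%:R)) =
     (cRe (x ^+ k.+1) / k.+1%:R) \*: (fun t => t ^+ k.+1).
    by apply/funext => u; rewrite /GRing.scale /= mulrC.
  apply: is_deriveZ.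
  have := is_deriveX k.+1 (is_derive_id t (1:R)).
  have -> : (id : R -> R) ^+ k.+1 = (fun t => t ^+ k.+1).
    by apply/funext => u; elim: {k}k.+1 => [|n IH]; rewrite ?expr0// !exprS -IH.
  by rewrite -[(_ *: _)]/(_ * 1) mulr1.
have G0 : G 0 = 0.
  rewrite /G /D !mulr0 mul0r expr0n /= mul0r subr0 addr0 ln1 mulr0 add0r.
  by rewrite big1// => k _; rewrite expr0n /= mul0r.
have G1 : G 1 = ln (normc (1 - x)) + \sum_(k < Q) cRe (x ^+ k.+1) / k.+1%:R.
  rewrite /G DE (rmorph1 (real_complex R)) mul1r lnXn; last first.
    by have := D_ge 1; rewrite (rmorph1 (real_complex R)) mul1r ler01 lexx => /(_ isT); apply: lt_le_trans; rewrite subr_gt0.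
  rewrite -[ln _ *+ 2]mulr_natl mulKf ?pnatr_eq0//; congr (_ + _).
  by apply: eq_bigr => k _; rewrite expr1n mul1r.
(* Summing the geometric series leaves only its tail, of modulus at most |x|^(Q+1) / (1 - |x|). *)
have dGE t : 0 <= t <= 1 -> dG t = - cRe (t%:C ^+ Q * x ^+ Q.+1 / (1 - t%:C * x)).
  move=> t01; have n0 : 1 - t%:C * x != 0.
    by rewrite -normc_gt0 (lt_le_trans _ (D_ge _ t01)) ?subr_gt0.
  rewrite /dG; have -> : \sum_(k < Q) t ^+ k * cRe (x ^+ k.+1) =
      cRe (x * (1 - (t%:C * x) ^+ Q) / (1 - t%:C * x)).
    have -> : 1 - (t%:C * x) ^+ Q = (1 - t%:C * x) * \sum_(k < Q) (t%:C * x) ^+ k.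
      rewrite -opprB subrX1 -mulNr opprB; congr (_ * _).
    rewrite [x * (_ * _)]mulrCA mulrAC mulfV// mul1r mulr_sumr raddf_sum; apply: eq_bigr => k _.
    rewrite exprMn mulrCA -exprS -rmorphXn /=.
    by case: (x ^+ k.+1) => u v /=; rewrite mul0r subr0.
  have -> : (- a + t * r2) / D t = - cRe (x / (1 - t%:C * x)).
    rewrite /r2 sqr_normcE DE sqr_normcE /a.
    by case: (x) => u v /=; rewrite -mulNr; ring.
  rewrite addrC -raddfB -raddfN; congr cRe.
  by rewrite exprMn exprS; ring.
have [c c01 Gc] := @MVT_segment R G dG 0 1 ler01
  (fun t tI => dGP t (ltac:(by move: tI; rewrite in_itv /= => /andP[/ltW -> /ltW ->])))
  (ltac:(apply: derivable_within_continuous => t; rewrite in_itv /= => tI;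
    by apply: ex_derive; exact: dGP)).
rewrite -G1 -[G 1]subr0 -G0 Gc subr0 mulr1.
move: c01; rewrite in_itv /= => c01; rewrite dGE// normrN.
apply: le_trans (Re_le_normc _) _.
rewrite !normcM normcV !normcX normcR.
have [c0 c1] := andP c01; rewrite ger0_norm//.
have h1 : 0 < 1 - normc x by rewrite subr_gt0.
apply: ler_pM; rewrite ?mulr_ge0 ?exprn_ge0 ?invr_ge0 ?normc_ge0//.
  by rewrite ler_piMl ?exprn_ge0 ?normc_ge0// exprn_ile1.
by rewrite lef_pV2 ?posrE ?D_ge// (lt_le_trans h1) ?D_ge.
Qed.

End LogExpansion.

(** * Averages along an orbit *)

Section OrbitAverage.
Variable R : realType.
Implicit Types (f g : R -> R) (b t : R) (z w : R[i]).

Definition oavg b (K : nat) f t : R := K%:R^-1 * \sum_(r < K) f (t + r%:R * b).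

Lemma oavgD b K f g t :
  oavg b K (fun x => f x + g x) t = oavg b K f t + oavg b K g t.
Proof. by rewrite /oavg big_split mulrDr. Qed.

Lemma oavgZ b K (c : R) f t : oavg b K (fun x => c * f x) t = c * oavg b K f t.
Proof. by rewrite /oavg -mulr_sumr mulrCA. Qed.

Lemma oavg_cst b K (c : R) t : (0 < K)%N -> oavg b K (fun=> c) t = c.
Proof.
move=> K0; rewrite /oavg sumr_const card_ord -[c *+ K]mulr_natl mulKf//.
by rewrite pnatr_eq0 -lt0n.
Qed.

(* Only the values on the forward orbit of [t] matter, whence the shape of
   the hypothesis. *)
Lemma ler_oavg b K f g t :
  (forall r : nat, (r < K)%N -> f (t + r%:R * b) <= g (t + r%:R * b)) ->
  oavg b K f t <= oavg b K g t.
Proof.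
by move=> fg; rewrite ler_wpM2l ?invr_ge0// ler_sum// => i _; exact: fg.
Qed.

(** Averaging [p] times raises the multiplier of every Fourier mode to the power [p], while the
    points involved stay on an orbit piece of length p K. *)
Definition iavg b K p f := iter p (oavg b K) f.

Lemma iavgS b K p f : iavg b K p.+1 f = iavg b K p (oavg b K f).
Proof. by rewrite /iavg iterSr. Qed.

Lemma eq_oavg b K f g t : f =1 g -> oavg b K f t = oavg b K g t.
Proof. by move=> fg; rewrite /oavg (eq_bigr _ (fun i _ => fg _)). Qed.

Lemma eq_iavg b K p f g t : f =1 g -> iavg b K p f t = iavg b K p g t.
Proof. by move=> fg; rewrite (funext fg). Qed.

Lemma iavgD b K p f g t :
  iavg b K p (fun x => f x + g x) t = iavg b K p f t + iavg b K p g t.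
Proof.
elim: p t => [//|p IH] t; rewrite /iavg !iterS -/(iavg _ _ _ _) -oavgD.
exact: eq_oavg.
Qed.

Lemma iavgZ b K p (c : R) f t : iavg b K p (fun x => c * f x) t = c * iavg b K p f t.
Proof.
elim: p t => [//|p IH] t; rewrite /iavg !iterS -/(iavg _ _ _ _) -oavgZ.
exact: eq_oavg.
Qed.

Lemma iavg_cst b K p (c : R) t : (0 < K)%N -> iavg b K p (fun=> c) t = c.
Proof.
move=> K0; elim: p t => [//|p IH] t; rewrite /iavg iterS -/(iavg _ _ _ _).
by rewrite (eq_oavg _ _ _ IH) oavg_cst.
Qed.

Lemma iavg_sum b K p (I : Type) (s : seq I) (F : I -> R -> R) t : (0 < K)%N ->
  iavg b K p (fun x => \sum_(i <- s) F i x) t = \sum_(i <- s) iavg b K p (F i) t.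
Proof.
move=> K0; elim: s => [|i s IH].
  by rewrite big_nil -[RHS](iavg_cst b p 0 t K0); apply: eq_iavg => x; rewrite big_nil.
by rewrite big_cons -IH -iavgD; apply: eq_iavg => x; rewrite big_cons.
Qed.

Lemma ler_iavg b K p f g t :
  (forall r : nat, (r <= p * K)%N -> f (t + r%:R * b) <= g (t + r%:R * b)) ->
  iavg b K p f t <= iavg b K p g t.
Proof.
elim: p f g t => [|p IH] f g t fg; first by have := fg 0%N (leqnn _); rewrite mul0r addr0.
rewrite !iavgS; apply: IH => r rp; apply: ler_oavg => s sK.
rewrite -addrA -mulrDl -natrD; apply: fg; rewrite mulSn; lia.
Qed.

(** Turns an averaged estimate into a pointwise one: ln |A_N| changes by at most 2 ln C from one
    point of the orbit to the next, whatever N is. *)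
Lemma iavg_near b K p f (o : R) t : (0 < K)%N ->
  (forall x, `|f (x + b) - f x| <= o) ->
  `|iavg b K p f t - f t| <= (p * K)%:R * o.
Proof.
move=> K0 fo.
have o0 : 0 <= o by apply: le_trans (fo 0).
have fr r x : `|f (x + r%:R * b) - f x| <= r%:R * o.
  elim: r x => [|r IH] x; first by rewrite !mul0r addr0 subrr normr0.
  have -> : f (x + r.+1%:R * b) - f x =
      (f (x + r%:R * b + b) - f (x + r%:R * b)) + (f (x + r%:R * b) - f x).
    by rewrite -[r.+1%:R]natr1 mulrDl mul1r addrA; ring.
  apply: le_trans (ler_normD _ _) _; rewrite -[r.+1%:R]natr1 mulrDl mul1r addrC.
  exact: lerD.
have fr' r : (r <= p * K)%N -> `|f (t + r%:R * b) - f t| <= (p * K)%:R * o.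
  by move=> h; apply: le_trans (fr _ _) _; rewrite ler_wpM2r// ler_nat.
rewrite ler_distl; apply/andP; split.
  rewrite -[X in X <= _](iavg_cst b p _ t K0); apply: ler_iavg => r /fr'.
  by rewrite ler_distl => /andP[].
rewrite -[X in _ <= X](iavg_cst b p _ t K0); apply: ler_iavg => r /fr'.
by rewrite ler_distl => /andP[].
Qed.

(** Eigenvalue of [oavg b K] on the mode e(k t). *)
Definition osum b (K k : nat) : R[i] :=
  (K%:R^-1)%:C * \sum_(r < K) circ (k%:R * b) ^+ r.

Lemma iavg_mode b K p (k : nat) (c : R[i]) t :
  iavg b K p (fun x => cRe (c * circ (k%:R * x))) t =
  cRe (c * osum b K k ^+ p * circ (k%:R * t)).
Proof.
elim: p c t => [|p IH] c t; first by rewrite expr0 mulr1.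
rewrite iavgS -[RHS]/(cRe _).
have -> : oavg b K (fun x => cRe (c * circ (k%:R * x))) =
    (fun x => cRe (c * osum b K k * circ (k%:R * x))).
  apply/funext => x; rewrite /oavg /osum.
  have -> : c * ((K%:R^-1)%:C * \sum_(r < K) circ (k%:R * b) ^+ r) * circ (k%:R * x) =
     (K%:R^-1)%:C * \sum_(r < K) c * circ (k%:R * (x + r%:R * b)).
    rewrite mulrCA -mulrA; congr (_ * _); rewrite mulr_sumr mulr_suml.
    apply: eq_bigr => r _; rewrite mulrDr circD [k%:R * (r%:R * b)]mulrCA (circMn r).
    by ring.
  rewrite [RHS](_ : _ = K%:R^-1 * cRe (\sum_(r < K) c * circ (k%:R * (x + r%:R * b)))).
    by rewrite raddf_sum.
  by case: (\sum_(r < K) _) => u v /=; rewrite mul0r subr0.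
by rewrite IH exprS mulrA.
Qed.

(** The constant 16 is what the convergents provide: a denominator q with 4 Q <= q <= 8 Q yields the
    distance 1 / (2 q), at least 1 / (16 Q). *)
Definition separated b (Q : nat) : Prop := forall (k : nat) (j : int),
  (0 < k <= Q)%N -> (16 * Q%:R)^-1 <= `|k%:R * b - j%:~R|.

(** A geometric sum is at most 2 / |1 - z|, here 32 Q; averaging over 64 Q terms brings this down to
    1/2. *)
Lemma osum_le b Q k : separated b Q -> (0 < k <= Q)%N ->
  normc (osum b (64 * Q) k) <= 2^-1.
Proof.
move=> sep kQ; have Q0 : (0 < Q)%N by case/andP: kQ => *; lia.
have Q0' : (0 : R) < Q%:R by rewrite ltr0n.
have ch : (16 * Q%:R)^-1 <= normc (1 - circ (k%:R * b)).
  by apply: chord_dist => j; exact: sep.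
set z := circ _ in ch *.
have z1 : 0 < normc (1 - z) by apply: lt_le_trans ch; rewrite invr_gt0 mulr_gt0.
have h : normc (\sum_(r < 64 * Q) z ^+ r) * normc (1 - z) <= 2.
  rewrite -normcM mulrC -opprB mulNr -subrX1 opprB.
  by apply: le_trans (normcB _ _) _; rewrite normc1 normcX normc_circ expr1n.
have {}h : normc (\sum_(r < 64 * Q) z ^+ r) <= 32 * Q%:R.
  rewrite -(ler_pM2r z1); apply: le_trans h _.
  apply: le_trans (ler_wpM2l _ ch); last by rewrite mulr_ge0.
  rewrite invfM mulrACA divff ?mulr1 ?gt_eqF//; lra.
rewrite /osum normcM normcR ger0_norm ?invr_ge0//.
apply: le_trans (ler_wpM2l _ h) _; rewrite ?invr_ge0// natrM invfM -mulrA.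
rewrite [Q%:R^-1 * _]mulrCA mulVf ?gt_eqF//; lra.
Qed.

Definition lnfac w t : R := ln (normc (1 - w * circ t)).

(** In the expansion of the logarithm the modes up to [Q] are damped by 2^-p each, and the later
    ones are geometrically small because [w] stays away from the unit circle. *)
Lemma iavg_far b (Q p : nat) w (d : R) t : separated b Q -> (0 < Q)%N ->
  0 < d <= 1 -> normc w <= 1 - d ->
  `|iavg b (64 * Q) p (lnfac w) t| <= Q%:R * 2^-1 ^+ p + (1 - d) ^+ Q.+1 / d.
Proof.
move=> sep Q0 /andP[d0 d1] wd.
have K0 : (0 < 64 * Q)%N by lia.
have w1 : normc w < 1 by apply: le_lt_trans wd _; rewrite ltrBlDr ltrDl.
pose g x := \sum_(k < Q) cRe (- (k.+1%:R^-1)%:C * w ^+ k.+1 * circ (k.+1%:R * x)).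
have gE x : g x = - \sum_(k < Q) cRe ((w * circ x) ^+ k.+1) / k.+1%:R.
  rewrite -sumrN; apply: eq_bigr => k _.
  rewrite exprMn -circMn -!mulrA; case: (w ^+ k.+1 * _) => u v /=.
  by rewrite oppr0 mul0r subr0 mulNr mulrC.
have fg x : `|lnfac w x - g x| <= (1 - d) ^+ Q.+1 / d.
  rewrite gE opprK; apply: le_trans (ln_normc_expansion _ _) _.
    by rewrite normcM normc_circ mulr1.
  rewrite normcM normc_circ mulr1.
  apply: ler_pM; rewrite ?exprn_ge0 ?invr_ge0 ?normc_ge0//.
  - by rewrite subr_ge0 ltW.
  - by apply: lerXn2r; rewrite ?nnegrE ?normc_ge0// subr_ge0.
  - by rewrite lef_pV2 ?posrE ?subr_gt0// lerBrDr -lerBrDl.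
have gb : `|iavg b (64 * Q) p g t| <= Q%:R * 2^-1 ^+ p.
  rewrite /g (eq_iavg _ _ _ _ (g := fun x => \sum_(k <- index_enum 'I_Q)
     cRe (- (k.+1%:R^-1)%:C * w ^+ k.+1 * circ (k.+1%:R * x))))//.
  rewrite iavg_sum//.
  apply: le_trans (ler_norm_sum _ _ _) _.
  apply: (@le_trans _ _ (\sum_(k < Q) 2^-1 ^+ p)); last first.
    by rewrite sumr_const card_ord mulr_natl.
  apply: ler_sum => k _; rewrite iavg_mode.
  apply: le_trans (Re_le_normc _) _.
  rewrite !normcM normc_circ mulr1 !normcX normcN normcR -[X in _ <= X]mul1r.
  apply: ler_pM; rewrite ?mulr_ge0 ?exprn_ge0 ?normc_ge0//.
    rewrite -[X in _ <= X]mul1r; apply: ler_pM; rewrite ?exprn_ge0 ?normc_ge0//.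
      by rewrite ger0_norm ?invr_ge0// invf_le1 ?ler1n// ltr0n.
    by rewrite exprn_ile1 ?normc_ge0// ltW.
  apply: lerXn2r; rewrite ?nnegrE ?normc_ge0 ?invr_ge0//.
  by apply: osum_le => //; rewrite /= ltn_ord.
set e := _ / d in fg *.
have h1 : iavg b (64 * Q) p (lnfac w) t <= iavg b (64 * Q) p g t + e.
  rewrite -[X in _ + X](iavg_cst b p e t K0) -iavgD; apply: ler_iavg => r _.
  by have := fg (t + r%:R * b); rewrite ler_norml => /andP[*]; lra.
have h2 : iavg b (64 * Q) p g t - e <= iavg b (64 * Q) p (lnfac w) t.
  rewrite -[X in _ + X](iavg_cst b p (- e) t K0) -iavgD; apply: ler_iavg => r _.
  by have := fg (t + r%:R * b); rewrite ler_norml => /andP[*]; lra.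
move: gb; rewrite !ler_norml => /andP[*]; apply/andP; split; lra.
Qed.

End OrbitAverage.

(** * Orbit averages near a logarithmic singularity *)

Section NearZeros.
Variable R : realType.
Implicit Types (f g : R -> R) (b t : R) (z w : R[i]).

Lemma dist_circ x y : exists j : int, `|x - y - j%:~R| <= normc (circ x - circ y :> R[i]).
Proof.
have [j jP] := chord_int (x - y : R).
exists j; apply: le_trans jP _.
rewrite -[X in X <= _]mulr1 -(normc_circ y) -normcM mulrBl mul1r circB divfK ?circ_neq0//.
by rewrite normc_distC.
Qed.

Lemma close_circ w (x y s : R) : normc w <= 1 ->
  normc (1 - w * circ x) < s -> normc (1 - w * circ y) < s ->
  exists j : int, `|x - y - j%:~R| < 4 * s.
Proof.
move=> w1 xs ys.
have s0 : 0 < s by apply: le_lt_trans xs; rewrite normc_ge0.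
(* For s >= 1/2 the nearest integer already works; otherwise |w| > 1/2, so dividing by |w| at most
   doubles the distance. *)
have [s2|s2] := ltP s (2^-1); last first.
  exists (Num.floor (x - y + 2^-1)).
  have := floor_le (x - y + 2^-1); have := floorD1_gt (x - y + 2^-1).
  by rewrite rmorphD /= ltr_norml => *; apply/andP; split; lra.
have [j jP] := dist_circ x y; exists j; apply: le_lt_trans jP _.
have w2 : 2^-1 < normc w.
  have : 1 - normc w <= normc (1 - w * circ x).
    by apply: le_trans (normcBl _ _); rewrite normc1 normcM normc_circ mulr1.
  by move=> ?; lra.
have : normc w * normc (circ x - circ y) < 2 * s.
  rewrite -normcM.
  have -> : w * (circ x - circ y) = (1 - w * circ y) - (1 - w * circ x) by ring.
  by apply: le_lt_trans (normcB _ _) _; lra.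
by move=> h; have := normc_ge0 (circ x - circ y); nra.
Qed.

(** Pigeonhole: modulo 1 the counted points lie within 4 s of one of them, and a cell of length [sg]
    contains at most one. The count is a sum of real indicators so that it can be averaged. *)
Lemma card_close n (x : nat -> R) (sg s : R) w : 0 < sg -> 0 <= s -> normc w <= 1 ->
  (forall (r r' : nat) (j : int), (r' < r < n)%N -> sg <= `|x r - x r' - j%:~R|) ->
  \sum_(r < n) (((normc (1 - w * circ (x r)) < s)%R)%:R : R) <= 8 * s / sg + 1.
Proof.
move=> sg0 s00 w1 sep.
pose S := [set r : 'I_n | normc (1 - w * circ (x r)) < s]%SET.
have -> : \sum_(r < n) (((normc (1 - w * circ (x r)) < s)%R)%:R : R) = #|S|%:R.
  rewrite -sum1_card natr_sum [RHS]big_mkcond /=; apply: eq_bigr => r _.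
  by rewrite inE; case: (_ < _).
have [S0|[r0 r0S]] := set_0Vmem S.
  by rewrite S0 cards0 addr_ge0// mulr_ge0 ?invr_ge0 ?mulr_ge0// ltW.
have s0 : 0 < s by move: r0S; rewrite inE; apply: le_lt_trans; rewrite normc_ge0.
have /choice[j jP] : forall r : 'I_n, exists j : int,
    r \in S -> `|x r - x r0 - j%:~R| < 4 * s.
  move=> r; have [rS|] := boolP (r \in S); last by exists 0.
  move: (rS) r0S; rewrite !inE => h1 h2.
  by have [j jP] := close_circ w1 h1 h2; exists j.
pose y r := x (nat_of_ord r) - x r0 - (j r)%:~R.
pose idx r := Num.truncn ((y r + 4 * s) / sg).
have y0 r : r \in S -> 0 <= (y r + 4 * s) / sg < 8 * s / sg.
  move=> /jP; rewrite -/(y r) ltr_norml => /andP[h1 h2].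
  by rewrite ltr_pM2r ?invr_gt0// mulr_ge0 ?invr_ge0 ?(ltW sg0)//=; lra.
pose m := Num.truncn (8 * s / sg).
have s8 : 0 <= 8 * s / sg by rewrite mulr_ge0 ?invr_ge0 ?mulr_ge0// ltW.
have idxm r : r \in S -> (idx r < m.+1)%N.
  by move=> /y0 /andP[_ /ltW h]; rewrite ltnS; apply: le_truncn.
have inj : {in S &, injective (fun r => inord (idx r) : 'I_m.+1)}.
  move=> r r' rS r'S /(congr1 val); rewrite /= !inordK ?idxm// => e.
  have : `|y r - y r'| < sg.
    have /andP[h1 h2] := truncn_itv (proj1 (andP (y0 _ rS))).
    have /andP[h3 h4] := truncn_itv (proj1 (andP (y0 _ r'S))).
    rewrite -/(idx r') -e in h3 h4; rewrite -/(idx r) in h1 h2.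
    rewrite ler_pdivlMr// in h1; rewrite ltr_pdivrMr// in h2.
    rewrite ler_pdivlMr// in h3; rewrite ltr_pdivrMr// in h4.
    rewrite -natr1 in h2 h4.
    by rewrite ltr_norml; apply/andP; split; nra.
  have ye : y r - y r' = x r - x r' - (j r - j r')%:~R by rewrite /y rmorphB /=; ring.
  have ye' : y r' - y r = x r' - x r - (j r' - j r)%:~R by rewrite /y rmorphB /=; ring.
  move=> yy; apply/val_inj; case: (ltngtP r r') => //= rr'.
    have := sep r' r (j r' - j r).
    by rewrite rr' ltn_ord -ye' distrC leNgt yy => /(_ isT).
  have := sep r r' (j r - j r').
  by rewrite rr' ltn_ord -ye leNgt yy => /(_ isT).
have := @leq_card_in _ _ _ (mem S) inj; rewrite card_ord => cS.
apply: (@le_trans _ _ m.+1%:R); first by rewrite ler_nat.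
rewrite -natr1 lerD2r; by have /andP[] := truncn_itv s8.
Qed.

Lemma sum_blocks (F : nat -> R) (m n : nat) (c : R) :
  (forall a : nat, \sum_(j < n) F (a + j)%N <= c) ->
  \sum_(r < m * n) F r <= m%:R * c.
Proof.
move=> Fc; suff h a : \sum_(r < m * n) F (a + r)%N <= m%:R * c by have := h 0%N.
elim: m a => [|m IH] a; first by rewrite big_ord0 mul0r.
rewrite mulSn big_split_ord /= -natr1 mulrDl mul1r addrC; apply: lerD => //.
by apply: le_trans (IH (a + n)%N); apply: ler_sum => i _; rewrite addnA.
Qed.

(** Separation is available only among Q consecutive points, so the 64 Q points are cut into 64
    blocks, each with at most 128 s Q + 1 close points. *)
Lemma oavg_close b (Q : nat) w (s : R) t : separated b Q -> (0 < Q)%N -> 0 <= s ->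
  normc w <= 1 ->
  oavg b (64 * Q) (fun x => ((normc (1 - w * circ x) < s)%R)%:R) t
    <= 128 * s + Q%:R^-1.
Proof.
move=> sep Q0 s0 w1; have Q0' : (0 : R) < Q%:R by rewrite ltr0n.
rewrite /oavg ler_pdivrMl ?natrM ?mulr_gt0//.
apply: (@le_trans _ _ (64%:R * (128 * s * Q%:R + 1))); last first.
  have : Q%:R * Q%:R^-1 = 1 :> R by rewrite mulfV ?gt_eqF.
  by set v := Q%:R^-1 => vQ; nra.
apply: (sum_blocks (F := fun r => ((normc (1 - w * circ (t + r%:R * b)) < s)%R)%:R)) => a.
have -> : 128 * s * Q%:R + 1 = 8 * s / (16 * Q%:R)^-1 + 1 by rewrite invrK; ring.
apply: (card_close (x := fun r => t + (a + r)%:R * b)) => //.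
  by rewrite invr_gt0 mulr_gt0.
move=> r r' j rr'; have := sep (r - r')%N j.
rewrite natrB; last by lia.
rewrite (_ : (0 < r - r' <= Q)%N); last by lia.
move=> /(_ isT) h; apply: le_trans h _; rewrite le_eqVlt; apply/orP; left; apply/eqP.
by congr `|_|; rewrite !natrD; ring.
Qed.

(* Dyadic layers of the singularity: each layer [s < 2^(i+1) d] contributes
   the same amount to an orbit average. *)
Lemma ln_layers (d e s L : R) (J : nat) : 0 < d -> 0 < e -> e <= s ->
  ln (1 + d / e) <= L ->
  ln (1 + d / s) <= L * ((s < d)%R)%:R +
    \sum_(i < J) 2^-1 ^+ i * ((s < 2 ^+ i.+1 * d)%R)%:R + 2^-1 ^+ J.
Proof.
move=> d0 e0 es eL; have s0 : 0 < s by exact: lt_le_trans es.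
have [sd|sd] := ltP s d.
  rewrite mulr1 -addrA; apply: le_trans (_ : L <= _); last first.
    by rewrite lerDl addr_ge0 ?exprn_ge0 ?invr_ge0// sumr_ge0// => i _; rewrite mulr_ge0 ?exprn_ge0 ?invr_ge0.
  apply: le_trans eL; rewrite ler_ln ?posrE ?addr_gt0 ?divr_gt0//.
  by rewrite lerD2l ler_pM2l// lef_pV2.
rewrite mulr0 add0r; apply: (@le_trans _ _ (d / s)).
  by apply: le_ln1Dx; apply: lt_trans (divr_gt0 d0 s0); rewrite ltrN10.
elim: J => [|J IH].
  by rewrite big_ord0 add0r expr0 ler_pdivrMr// mul1r.
rewrite big_ord_recr /=; case: ltP => h.
  rewrite mulr1; apply: le_trans IH _; rewrite lerDl exprn_ge0 ?invr_ge0//.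
rewrite mulr0 addr0; apply: (@le_trans _ _ (2^-1 ^+ J.+1)).
  by rewrite ler_pdivrMr// exprVn ler_pdivlMl// exprn_gt0.
by rewrite lerDr sumr_ge0// => i _; rewrite mulr_ge0 ?exprn_ge0 ?invr_ge0.
Qed.

(** The core, where the logarithm is at most [L], contributes 129 d L. Each of the J dyadic layers
    contributes 256 d plus a geometric term; these terms and the remainder 2^-J add up to at most 3
    d. *)
Lemma oavg_near b (Q J : nat) w (d e L : R) t : separated b Q -> (0 < Q)%N ->
  normc w <= 1 -> Q%:R^-1 <= d -> (Q <= 2 ^ J)%N -> 0 < e -> 0 <= L ->
  ln (1 + d / e) <= L ->
  (forall r : nat, (r < 64 * Q)%N -> e <= normc (1 - w * circ (t + r%:R * b))) ->
  oavg b (64 * Q) (fun x => ln (1 + d / normc (1 - w * circ x))) t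
    <= d * (129 * L + 256 * J%:R + 3).
Proof.
move=> sep Q0 w1 Qd QJ e0 L0 eL er.
have Q0' : (0 : R) < Q%:R by rewrite ltr0n.
have d0 : 0 < d by apply: lt_le_trans Qd; rewrite invr_gt0.
have K0 : (0 < 64 * Q)%N by lia.
pose cl (s x : R) : R := ((normc (1 - w * circ x) < s)%R)%:R.
apply: (@le_trans _ _ (oavg b (64 * Q) (fun x => (L * cl d x +
    \sum_(i < J) 2^-1 ^+ i * cl (2 ^+ i.+1 * d) x) + 2^-1 ^+ J) t)).
  by apply: ler_oavg => r rK; apply: ln_layers eL => //; exact: er.
rewrite oavgD oavgD oavgZ oavg_cst//.
have -> : oavg b (64 * Q) (fun x => \sum_(i < J) 2^-1 ^+ i * cl (2 ^+ i.+1 * d) x) t =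
    \sum_(i < J) 2^-1 ^+ i * oavg b (64 * Q) (cl (2 ^+ i.+1 * d)) t.
  rewrite /oavg exchange_big /= mulr_sumr; apply: eq_bigr => i _.
  by rewrite -mulr_sumr mulrCA.
have h1 : L * oavg b (64 * Q) (cl d) t <= L * (129 * d).
  by rewrite ler_wpM2l//; apply: le_trans (oavg_close _ sep Q0 (ltW d0) w1) _; lra.
have h2 : \sum_(i < J) 2^-1 ^+ i * oavg b (64 * Q) (cl (2 ^+ i.+1 * d)) t
    <= \sum_(i < J) (256 * d + 2^-1 ^+ i * d).
  apply: ler_sum => i _.
  apply: le_trans (ler_wpM2l _ (oavg_close _ sep Q0 _ w1)) _; rewrite ?exprn_ge0 ?invr_ge0 ?mulr_ge0 ?exprn_ge0 ?(ltW d0)//.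
  rewrite mulrDr exprS; apply: lerD.
    rewrite le_eqVlt; apply/orP; left; apply/eqP.
    have : (2^-1 : R) ^+ i * 2 ^+ i = 1 by rewrite -exprMn mulVf ?expr1n// pnatr_eq0.
    set u := _ ^+ i; set v := _ ^+ i => uv.
    have -> : u * (128 * (2 * v * d)) = 256 * d * (u * v) by ring.
    by rewrite uv mulr1.
  by rewrite ler_wpM2l ?exprn_ge0 ?invr_ge0.
have h3 : \sum_(i < J) (2^-1 : R) ^+ i <= 2.
  have := subrX1 (2^-1 : R) J; have : 0 <= (2^-1 : R) ^+ J by rewrite exprn_ge0 ?invr_ge0.
  by set S := \sum_(i < J) _; set u := _ ^+ J => *; lra.
have h4 : (2^-1 : R) ^+ J <= d.
  apply: le_trans Qd; rewrite exprVn lef_pV2 ?posrE ?exprn_gt0//.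
  by rewrite -natrX ler_nat.
rewrite big_split /= sumr_const card_ord -mulr_suml in h2.
rewrite -[_ *+ J]mulr_natr in h2.
have : (\sum_(i < J) (2^-1 : R) ^+ i) * d <= 2 * d by rewrite ler_wpM2r// ltW.
by move=> h5; nra.
Qed.

(** The bound of [iavg_far], paid by every zero once it is at distance [d] from the circle. *)
Definition far_err (Q p : nat) (d : R) := Q%:R * 2^-1 ^+ p + (1 - d) ^+ Q.+1 / d.

Let shrink w (d : R) := (1 - d)%:C * w.

Lemma shrink_far w d : normc w <= 1 -> d <= 1 -> normc (shrink w d) <= 1 - d.
Proof.
move=> w1 d1; rewrite /shrink normcM normcR ger0_norm ?subr_ge0//.
by rewrite ler_piMr ?subr_ge0.
Qed.

Lemma shrink_dist w d x : normc w <= 1 -> 0 <= d ->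
  normc (w * circ x - shrink w d * circ x) <= d.
Proof.
move=> w1 d0; rewrite /shrink -mulrBl normcM normc_circ mulr1.
have -> : w - (1 - d)%:C * w = d%:C * w by rewrite rmorphB /=; ring.
by rewrite normcM normcR ger0_norm// ler_piMr.
Qed.

(** For the shrunk zero w' one has |1 - w e(x)| <= |1 - w' e(x)| (1 + d / |1 - w' e(x)|), and the
    correction is at most ln 2, so the upper bound holds along every orbit ([e := d], L = 1). One of
    the averages is spent on the correction; the others preserve the bound. *)
Lemma iavg_zero_le b (Q J p : nat) w (d : R) t : separated b Q -> (0 < Q)%N ->
  normc w < 1 -> Q%:R^-1 <= d -> d <= 1 -> (Q <= 2 ^ J)%N ->
  iavg b (64 * Q) p.+1 (lnfac w) t <= far_err Q p.+1 d + d * (132 + 256 * J%:R).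
Proof.
move=> sep Q0 w1 Qd d1 QJ; have K0 : (0 < 64 * Q)%N by lia.
have d0 : 0 < d by apply: lt_le_trans Qd; rewrite invr_gt0 ltr0n.
pose w' := shrink w d; have w'd : normc w' <= 1 - d by apply: shrink_far => //; exact: ltW.
have sd x : d <= normc (1 - w' * circ x).
  apply: le_trans (normcBl _ _); rewrite normc1 normcM normc_circ mulr1; lra.
apply: (@le_trans _ _ (iavg b (64 * Q) p.+1 (fun x => lnfac w' x +
    ln (1 + d / normc (1 - w' * circ x))) t)).
  apply: ler_iavg => r _; set x := t + _.
  have s0 : 0 < normc (1 - w' * circ x) by exact: lt_le_trans (sd _).
  rewrite /lnfac -lnM ?posrE ?addr_gt0 ?divr_gt0//.
  have z0 : 0 < normc (1 - w * circ x).
    apply: lt_le_trans (normcBl _ _); rewrite normc1 normcM normc_circ mulr1; lra.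
  rewrite ler_ln ?posrE ?mulr_gt0 ?addr_gt0 ?divr_gt0// mulrDr mulr1 mulrCA.
  rewrite mulfV ?gt_eqF// mulr1.
  have -> : 1 - w * circ x = (1 - w' * circ x) - (w * circ x - w' * circ x) by ring.
  by apply: le_trans (normcB _ _) _; rewrite lerD2l shrink_dist ?ltW.
rewrite iavgD; apply: lerD.
  have := iavg_far p.+1 t sep Q0 _ w'd; rewrite d0 d1 => /(_ isT).
  by rewrite ler_norml => /andP[].
rewrite iavgS; rewrite -[X in _ <= X](iavg_cst b p _ t K0); apply: ler_iavg => r _.
have e : d * (132 + 256 * J%:R) = d * (129 * 1 + 256 * J%:R + 3) by ring.
rewrite e; apply: (oavg_near (e := d)) => //; first by apply: le_trans w'd _; lra.
rewrite divff ?gt_eqF//; apply: le_trans (le_ln1Dx _) _ => //; lra.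
Qed.

(** Here [w] and the shrunk zero exchange roles, so the correction is singular at [w] itself and the
    orbit must keep a distance [e] from it; [e] is felt only through the logarithm [L]. *)
Lemma iavg_zero_ge b (Q J p : nat) w (d e L : R) t : separated b Q -> (0 < Q)%N ->
  normc w <= 1 -> Q%:R^-1 <= d -> d <= 1 -> (Q <= 2 ^ J)%N -> 0 < e -> 0 <= L ->
  ln (1 + d / e) <= L ->
  (forall r : nat, (r <= p.+1 * (64 * Q))%N -> e <= normc (1 - w * circ (t + r%:R * b))) ->
  0 <= far_err Q p.+1 d + d * (129 * L + 256 * J%:R + 3) +
    iavg b (64 * Q) p.+1 (lnfac w) t.
Proof.
move=> sep Q0 w1 Qd d1 QJ e0 L0 eL er; have K0 : (0 < 64 * Q)%N by lia.
have d0 : 0 < d by apply: lt_le_trans Qd; rewrite invr_gt0 ltr0n.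
pose w' := shrink w d; have w'd : normc w' <= 1 - d by apply: shrink_far.
have sd x : d <= normc (1 - w' * circ x).
  apply: le_trans (normcBl _ _); rewrite normc1 normcM normc_circ mulr1; lra.
rewrite -lerBlDl sub0r; apply: (@le_trans _ _ (iavg b (64 * Q) p.+1 (fun x => lnfac w' x +
    (-1) * ln (1 + d / normc (1 - w * circ x))) t)); last first.
  apply: ler_iavg => r rK; set x := t + _.
  have s0 : 0 < normc (1 - w * circ x) by exact: lt_le_trans (er _ rK).
  have s1 : 0 < normc (1 - w' * circ x) by exact: lt_le_trans (sd _).
  rewrite mulN1r lerBlDr /lnfac -lnM ?posrE ?addr_gt0 ?divr_gt0//.
  rewrite ler_ln ?posrE ?mulr_gt0 ?addr_gt0 ?divr_gt0// mulrDr mulr1 mulrCA.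
  rewrite mulfV ?gt_eqF// mulr1.
  have -> : 1 - w' * circ x = (1 - w * circ x) + (w * circ x - w' * circ x) by ring.
  by apply: le_trans (normcD _ _) _; rewrite lerD2l shrink_dist// ltW.
rewrite iavgD iavgZ opprD; apply: lerD.
  have := iavg_far p.+1 t sep Q0 _ w'd; rewrite d0 d1 => /(_ isT).
  by rewrite ler_norml => /andP[].
rewrite mulN1r lerN2.
rewrite iavgS; rewrite -[X in _ <= X](iavg_cst b p _ t K0); apply: ler_iavg => r rp.
apply: (oavg_near (e := e)) => // s sK.
rewrite -addrA -mulrDl -natrD; apply: er; rewrite mulSn; lia.
Qed.

End NearZeros.

(** * Polynomials on circles *)

Section PolyOnCircles.
Variable R : realType.
Implicit Types (b t : R) (z w : R[i]) (p g : {poly R[i]}) (rs : seq R[i]).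

Lemma circ_surj z : normc z = 1 -> exists t, z = circ t.
Proof.
move=> z1; have := sqr_normcE z; rewrite z1 expr1n; case: z z1 => a c _ /= h.
have a1 : -1 <= a <= 1 by have := sqr_ge0 c => c0; apply/andP; split; nra.
have pi0 := pi_gt0 R.
have ac : cos (acos a) = a by apply: acosK; rewrite in_itv.
have as' : sin (acos a) = `|c|.
  by rewrite sin_acos// -sqrtr_sqr; congr Num.sqrt; rewrite h; ring.
have key (s : R) : 2 * pi * (s / (2 * pi)) = s.
  by rewrite mulrC divfK// mulf_neq0 ?gt_eqF.
have [c0|c0] := leP 0 c.
  exists (acos a / (2 * pi)); rewrite /circ key ac as' ger0_norm//.
exists (- acos a / (2 * pi)); rewrite /circ key cosN sinN ac as' ltr0_norm// opprK//.
Qed.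

Lemma grid_sep (M k : nat) (j : int) : (0 < k < M)%N ->
  M%:R^-1 <= `|k%:R / M%:R - j%:~R| :> R.
Proof.
move=> /andP[k0 kM]; have M0 : (0 : R) < M%:R by rewrite ltr0n; lia.
have -> : k%:R / M%:R - j%:~R = (k%:Z - j * M%:Z)%:~R / M%:R :> R.
  by rewrite rmorphB rmorphM /= mulrBl mulfK ?gt_eqF.
rewrite normrM normfV (ger0_norm (ltW M0)) -[X in X <= _]mul1r ler_pM2r ?invr_gt0//.
rewrite -intr_norm (ler_int _ 1); apply: contraT; rewrite -ltNge => h.
have : k%:Z - j * M%:Z = 0 by lia.
move=> /eqP; rewrite subr_eq0 => /eqP h2.
have : (0 < j)%R by nia.
by move=> ?; nia.
Qed.

Lemma circ_ratio_neq1 (M k : nat) : (0 < k < M)%N -> circ (k%:R / M%:R) != 1 :> R[i].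
Proof.
move=> kM; have M0 : (0 : R) < M%:R by rewrite ltr0n; case/andP: kM; lia.
rewrite -subr_eq0 -normc_eq0 normc_distC gt_eqF//.
have h : M%:R^-1 <= normc (1 - circ (k%:R / M%:R)) :> R.
  by apply: chord_dist => j; exact: grid_sep.
by apply: lt_le_trans h; rewrite invr_gt0.
Qed.

Lemma sum_roots_of_unity (M k : nat) : (0 < k < M)%N ->
  \sum_(j < M) (circ (k%:R / M%:R) : R[i]) ^+ j = 0.
Proof.
move=> kM; have M0 : (0 : R) < M%:R by rewrite ltr0n; case/andP: kM; lia.
have := circ_ratio_neq1 kM.
rewrite -subr_eq0 => n1; apply: (mulfI n1); rewrite mulr0 -subrX1 -circMn.
by rewrite mulrC divfK ?gt_eqF// circ_nat subrr.
Qed.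

(** A discrete mean value property in place of a contour integral: with at least as many roots of
    unity as coefficients, all nonconstant terms sum to zero. *)
Lemma coef0_avg g (M : nat) (s : R[i]) : (0 < M)%N -> (size g <= M)%N ->
  \sum_(j < M) g.[s * circ (j%:R / M%:R)] = M%:R * g`_0.
Proof.
move=> M0 gM.
have hE x : g.[x] = \sum_(k < M) g`_k * x ^+ k by rewrite (horner_coef_wide _ gM).
under eq_bigr do rewrite hE.
rewrite exchange_big /=; case: M M0 gM hE => // M _ gM hE.
rewrite big_ord_recl [X in _ + X]big1 => [|i _].
  rewrite addr0 (eq_bigr (fun=> g`_0)) ?sumr_const ?card_ord ?mulr_natl// => j _.
  by rewrite /= expr0 mulr1.
have /sum_roots_of_unity h : (0 < i.+1 < M.+1)%N by rewrite /= ltnS ltn_ord.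
rewrite (eq_bigr (fun j : 'I_M.+1 => g`_(lift ord0 i) * s ^+ (lift ord0 i) *
   circ (i.+1%:R / M.+1%:R) ^+ j)); first by rewrite -mulr_sumr h mulr0.
move=> j _.
rewrite exprMn -mulrA; congr (_ * (_ * _)); rewrite -!circMn; congr circ.
by rewrite lift0 mulrCA mulrA.
Qed.

Definition root_poly (a : R[i]) rs := a *: \prod_(z <- rs) ('X - z%:P).

Lemma normc_root_poly a rs z :
  normc (root_poly a rs).[z] = normc a * \prod_(x <- rs) normc (z - x).
Proof.
rewrite /root_poly hornerZ normcM horner_prod normc_prod; congr (_ * _).
by apply: eq_bigr => x _; rewrite hornerXsubC.
Qed.

(* Jensen's inequality without logarithms: reflecting the roots inside the
   circle of radius [s] does not change the modulus on the circle, and the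
   constant coefficient is the mean of the values at roots of unity. *)
Lemma landau_jensen a rs (s B : R) : 0 < s ->
  (forall z, normc z = s -> normc (root_poly a rs).[z] <= B) ->
  normc a * \prod_(z <- rs) Num.max s (normc z) <= B.
Proof.
move=> s0 pB.
pose f (z : R[i]) : {poly R[i]} := if normc z <= s then (s%:C)%:P - (z^* / s%:C) *: 'X else 'X - z%:P.
pose g := a *: \prod_(z <- rs) f z.
have gz z : normc z = s -> normc g.[z] = normc (root_poly a rs).[z].
  move=> zs; rewrite normc_root_poly /g hornerZ normcM horner_prod normc_prod.
  congr (_ * _); apply: eq_bigr => x _; rewrite /f; case: ifP => _; last by rewrite hornerXsubC.
  rewrite hornerD hornerN hornerZ hornerX hornerC.
  have zz : z * z^* = (s ^+ 2)%:C.
    rewrite -zs sqr_normcE; case: (z) => u v.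
    by apply/eqP; rewrite eq_complex /=; apply/andP; split; apply/eqP; ring.
  have sC : s%:C != 0 by rewrite -normc_gt0 normcR ger0_norm ?ltW.
  have -> : s%:C - x^* / s%:C * z = z * (z - x)^* / s%:C.
    apply: (mulIf sC); rewrite divfK// rmorphB mulrBr zz rmorphXn /=.
    by field.
  by rewrite normcM normcM normc_conj normcV normcR (ger0_norm (ltW s0)) zs mulrAC mulfV ?gt_eqF// mul1r.
have g0 : normc g`_0 = normc a * \prod_(z <- rs) Num.max s (normc z).
  rewrite -horner_coef0 /g hornerZ normcM horner_prod normc_prod; congr (_ * _).
  apply: eq_bigr => x _; rewrite /f; case: leP => h.
    by rewrite hornerD hornerN hornerZ hornerX hornerC mulr0 subr0 normcR ger0_norm ?ltW.
  by rewrite hornerXsubC sub0r normcN.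
rewrite -g0; pose M := (size g).+1.
have M0 : (0 : R) < M%:R by rewrite ltr0n.
rewrite -(ler_pM2l M0) -normc_nat -normcM -(coef0_avg (s%:C) (ltn0Sn _) (leqnSn _)).
apply: le_trans (normc_sum _ _ _) _.
apply: (@le_trans _ _ (\sum_(j < M) B)).
  apply: ler_sum => j _.
  have sj : normc (s%:C * circ (j%:R / M%:R)) = s.
    by rewrite normcM normc_circ mulr1 normcR ger0_norm ?ltW.
  by rewrite gz// pB.
by rewrite sumr_const card_ord normc_nat mulr_natl.
Qed.

(* On the unit circle [|z - x|] equals [max 1 |x| * |1 - wfac x * z|]. *)
Definition wfac z : R[i] := if normc z < 1 then z^* else z^-1.

Lemma wfac_lt1 z : normc z != 1 -> normc (wfac z) < 1.
Proof.
rewrite /wfac; case: (ltP (normc z) 1) => [|z1 zn1]; first by rewrite normc_conj.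
have z2 : 1 < normc z by rewrite lt_neqAle eq_sym zn1.
by rewrite normcV invf_lt1// (lt_trans ltr01).
Qed.

Lemma circ_wfac z t :
  normc (circ t - z) = Num.max 1 (normc z) * normc (1 - wfac z * circ t).
Proof.
rewrite /wfac; case: ltP => [z1|z1].
  have cc : (circ t)^* * circ t = 1 :> R[i].
    have := sqr_normcE (circ t); rewrite normc_circ expr1n; case: (circ t) => u v /= h.
    by apply/eqP; rewrite eq_complex /=; apply/andP; split; apply/eqP; [rewrite h|]; ring.
  have -> : 1 - z^* * circ t = (circ t - z)^* * circ t.
    by rewrite rmorphB mulrBl cc.
  by rewrite mul1r normcM normc_conj normc_circ mulr1.
have z0 : z != 0 by rewrite -normc_gt0 (lt_le_trans _ z1).
rewrite -normcM mulrBr mulr1 mulVKf//.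
by rewrite normc_distC.
Qed.

Definition mahler a rs : R := normc a * \prod_(z <- rs) Num.max 1 (normc z).

Lemma ln_prod (I : Type) (s : seq I) (F : I -> R) : (forall i, 0 < F i) ->
  ln (\prod_(i <- s) F i) = \sum_(i <- s) ln (F i).
Proof.
move=> F0; suff : 0 < \prod_(i <- s) F i /\ ln (\prod_(i <- s) F i) = \sum_(i <- s) ln (F i).
  by case.
elim: s => [|i s [IH1 IH2]]; first by rewrite !big_nil ln1.
by rewrite !big_cons mulr_gt0// lnM ?posrE// IH2.
Qed.

Definition off_circle rs := forall z, z \in rs -> normc z != 1.

Lemma ln_root_poly a rs t : a != 0 -> off_circle rs ->
  ln (normc (root_poly a rs).[circ t]) =
  ln (mahler a rs) + \sum_(z <- rs) lnfac (wfac z) t.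
Proof.
move=> a0 off; rewrite normc_root_poly /mahler.
have m0 (z : R[i]) : 0 < Num.max 1 (normc z) by rewrite lt_max ltr01.
have p0 (s : seq R[i]) : 0 < \prod_(x <- s) Num.max 1 (normc x).
  by rewrite prodr_gt0// => i _; exact: m0.
have a0' : 0 < normc a by rewrite normc_gt0.
have f0 z : z \in rs -> 0 < normc (1 - wfac z * circ t).
  move=> /off /wfac_lt1 h; apply: lt_le_trans (normcBl _ _).
  by rewrite normc1 normcM normc_circ mulr1 subr_gt0.
rewrite (eq_bigr (fun x => Num.max 1 (normc x) * normc (1 - wfac x * circ t))); last first.
  by move=> z _; exact: circ_wfac.
rewrite big_split mulrA lnM ?posrE ?mulr_gt0//; last first.
  by rewrite big_seq prodr_gt0.
congr (_ + _); elim: rs off f0 => [|z s IH] off f0; first by rewrite !big_nil ln1.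
have z0 := f0 z (mem_head _ _).
have f0' x : x \in s -> 0 < normc (1 - wfac x * circ t) by move=> xs; apply: f0; rewrite inE xs orbT.
rewrite !big_cons lnM ?posrE// ?IH//; first by move=> x xs; apply: off; rewrite inE xs orbT.
by rewrite big_seq prodr_gt0.
Qed.

(** Jensen's inequality on the circles of radius e^l and e^-l, multiplied together: the terms in [D]
    cancel, every root contributes at least max(1, |z|)^2, and a root near the unit circle
    contributes a further factor e^(l/2). *)
Lemma near_roots_bound a rs (D B l d : R) : a != 0 -> 1 <= mahler a rs ->
  0 < d -> d <= 2^-1 -> 4 * d <= l -> 
  (forall z, normc z = expR l \/ normc z = expR (- l) ->
     normc (root_poly a rs).[z] <= expR (D * ln (normc z) + B)) ->
  (count (fun z => 1 - d < normc (wfac z)) rs)%:R * l <= 4 * B.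
Proof.
move=> a0 m1 d0 d2 dl pB.
have a0' : 0 < normc a by rewrite normc_gt0.
have : normc a * \prod_(z <- rs) Num.max (expR l) (normc z) <= expR (D * l + B).
  apply: landau_jensen (expR_gt0 _) _ => z zl; apply: le_trans (pB z (or_introl zl)) _.
  by rewrite zl expRK.
have : normc a * \prod_(z <- rs) Num.max (expR (- l)) (normc z) <= expR (D * - l + B).
  apply: landau_jensen (expR_gt0 _) _ => z zl; apply: le_trans (pB z (or_intror zl)) _.
  by rewrite zl expRK.
move=> h2 h1.
have mx0 (s : R) z : 0 < s -> 0 < Num.max s (normc z) by move=> s0; rewrite lt_max s0.
have pr0 (s : R) : 0 < s -> 0 <= normc a * \prod_(z <- rs) Num.max s (normc z).
  by move=> s0; rewrite mulr_ge0 ?normc_ge0// prodr_ge0// => z _; exact: ltW (mx0 _ _ s0).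
have h3 := ler_pM (pr0 _ (expR_gt0 l)) (pr0 _ (expR_gt0 (- l))) h1 h2.
rewrite -expRD in h3.
have e3 : D * l + B + (D * - l + B) = 2 * B by ring.
rewrite e3 mulrACA -big_split /= in h3.
pose near z := 1 - d < normc (wfac z).
have l0 : 0 < l by apply: lt_le_trans dl; rewrite mulr_gt0.
have fac z : Num.max 1 (normc z) ^+ 2 * expR (l / 2 * (near z)%:R) <=
    Num.max (expR l) (normc z) * Num.max (expR (- l)) (normc z).
  have el1 : 1 < expR l by rewrite expR_gt1.
  have el2 : expR (- l) < 1 by rewrite expR_lt1 oppr_lt0.
  have el3 : expR (- l) * expR l = 1 by rewrite -expRD addNr expR0.
  have e2 : expR (l / 2) ^+ 2 = expR l by rewrite -expRM_natl; congr expR; field.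
  have e2' : 1 < expR (l / 2) by rewrite expR_gt1 divr_gt0.
  (* Because l / 2 >= 2 d, and (1 - d) (1 + 2 d) >= 1 for d <= 1/2. *)
  have nw : near z -> 1 <= normc (wfac z) * expR (l / 2).
    rewrite /near => nz.
    have : 1 + l / 2 <= expR (l / 2) by rewrite expR_ge1Dx.
    by move=> h; nra.
  have z0 := normc_ge0 z.
  move: nw; rewrite /wfac; case: (ltP (normc z) 1) => z1.
    rewrite normc_conj expr1n mul1r => nw.
    have -> : Num.max (expR l) (normc z) = expR l by apply: max_idPl; lra.
    case: (near z) nw => [/(_ isT) nw|_]; rewrite ?mulr1 ?mulr0 ?expR0.
      apply: (@le_trans _ _ (expR l * normc z)); last by rewrite ler_pM2l ?expR_gt0// le_max lexx orbT.
      by rewrite -e2; nra.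
    by rewrite -el3 mulrC ler_pM2l ?expR_gt0// le_max lexx.
  have zi : normc z * normc z^-1 = 1 by rewrite normcV mulfV// gt_eqF//; lra.
  move=> nw.
  have -> : Num.max (expR (- l)) (normc z) = normc z by apply: max_idPr; lra.
  rewrite expr2 mulrAC ler_wpM2r//.
  case: (near z) nw => [/(_ isT) nw|_]; rewrite ?mulr1 ?mulr0 ?expR0; last by rewrite mulr1 le_max lexx orbT.
  apply: (@le_trans _ _ (expR l)); last by rewrite le_max lexx.
  have i0 := normc_ge0 z^-1.
  by rewrite -e2; nra.
have h4 : normc a * normc a * \prod_(z <- rs) (Num.max 1 (normc z) ^+ 2 * expR (l / 2 * (near z)%:R))
    <= expR (2 * B).
  apply: le_trans h3; rewrite ler_wpM2l ?mulr_ge0 ?normc_ge0//.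
  apply: ler_prod => z _; rewrite fac andbT mulr_ge0 ?expR_ge0 ?exprn_ge0//.
  by rewrite le_max ler01.
have h5 : expR (l / 2 * (count near rs)%:R) <= expR (2 * B).
  apply: le_trans h4; rewrite big_split /= prodrXl mulrA -expr2 -exprMn -/(mahler a rs).
  have -> : \prod_(z <- rs) expR (l / 2 * (near z)%:R) = expR (l / 2 * (count near rs)%:R).
    elim: (rs) => [|z s IH]; first by rewrite big_nil /= mulr0 expR0.
    by rewrite big_cons IH -expRD /= natrD mulrDr.
  by rewrite ler_peMl ?expR_ge0// exprn_ege1.
move: h5; rewrite ler_expR => h5; rewrite -/near; lra.
Qed.

(** Error of the averages of ln |P| for [n] roots: each root pays [far_err], and each of the at most
    4 B / l roots near the unit circle pays for being moved. [L] is the logarithmic price of coming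
    close to a root, 0 in the upper bound. *)
Definition deviation (Q J m n : nat) (d l B L : R) : R :=
  n%:R * far_err Q m.+1 d + (4 * B / l) * (d * (132 + 129 * L + 256 * J%:R)).

Section PolyDeviation.
Variables (b : R) (Q J m : nat) (d l D B : R) (a : R[i]) (rs : seq R[i]).
Hypotheses (sep : separated b Q) (Q0 : (0 < Q)%N) (Qd : Q%:R^-1 <= d)
  (d2 : d <= 2^-1) (dl : 4 * d <= l) (QJ : (Q <= 2 ^ J)%N)
  (a0 : a != 0) (off : off_circle rs) (m1 : 1 <= mahler a rs)
  (pB : forall z, normc z = expR l \/ normc z = expR (- l) ->
     normc (root_poly a rs).[z] <= expR (D * ln (normc z) + B)).

Let F t := ln (normc (root_poly a rs).[circ t]).

Let d0 : 0 < d. Proof. by apply: lt_le_trans Qd; rewrite invr_gt0 ltr0n. Qed.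
Let d1 : d <= 1. Proof. by apply: le_trans d2 _; lra. Qed.
Let l0 : 0 < l. Proof. by apply: lt_le_trans dl; rewrite mulr_gt0. Qed.
Let near z := 1 - d < normc (wfac z).

Let sum_near (G : R) : 0 <= G ->
  \sum_(z <- rs) (far_err Q m.+1 d + G * (near z)%:R) <=
    (size rs)%:R * far_err Q m.+1 d + 4 * B / l * G.
Proof.
move=> G0.
have -> : \sum_(z <- rs) (far_err Q m.+1 d + G * (near z)%:R) =
    (size rs)%:R * far_err Q m.+1 d + (count near rs)%:R * G.
  elim: (rs) => [|z s IH]; first by rewrite big_nil /= !mul0r addr0.
  by rewrite big_cons IH /= natrD -[(size s).+1]addn1 natrD; ring.
rewrite lerD2l ler_wpM2r// ler_pdivlMr//.
exact: near_roots_bound a0 m1 d0 d2 dl pB.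
Qed.

Let FE t : iavg b (64 * Q) m.+1 F t =
  ln (mahler a rs) + \sum_(z <- rs) iavg b (64 * Q) m.+1 (lnfac (wfac z)) t.
Proof.
have K0 : (0 < 64 * Q)%N by lia.
rewrite -iavg_sum// -[X in X + _](iavg_cst b m.+1 _ t K0) -iavgD.
by apply: eq_iavg => x; exact: ln_root_poly.
Qed.

Lemma iavg_root_poly_le t :
  iavg b (64 * Q) m.+1 F t <= ln (mahler a rs) + deviation Q J m (size rs) d l B 0.
Proof.
rewrite FE lerD2l /deviation mulr0 addr0.
have G0 : 0 <= d * (132 + 256 * J%:R) by rewrite mulr_ge0 ?(ltW d0)// addr_ge0.
apply: le_trans (sum_near G0); rewrite big_seq [X in _ <= X]big_seq.
apply: ler_sum => z zr; case nz: (near z).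
  by rewrite mulr1; apply: iavg_zero_le => //; exact/wfac_lt1/off.
rewrite mulr0 addr0; move: nz => /negbT; rewrite /near -leNgt => nz.
have := iavg_far m.+1 t sep Q0 _ nz; rewrite d0 d1 => /(_ isT).
by rewrite ler_norml => /andP[].
Qed.

Lemma iavg_root_poly_ge (e L : R) t : 0 < e -> 0 <= L -> ln (1 + d / e) <= L ->
  (forall z (r : nat), z \in rs -> (r <= m.+1 * (64 * Q))%N ->
    e <= normc (1 - wfac z * circ (t + r%:R * b))) ->
  ln (mahler a rs) - deviation Q J m (size rs) d l B L <= iavg b (64 * Q) m.+1 F t.
Proof.
move=> e0 L0 eL er; rewrite FE lerD2l /deviation -lerN2 opprK.
have G0 : 0 <= d * (132 + 129 * L + 256 * J%:R).
  by rewrite mulr_ge0 ?(ltW d0)// !addr_ge0// mulr_ge0.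
apply: le_trans (sum_near G0); rewrite -sumrN big_seq [X in _ <= X]big_seq.
apply: ler_sum => z zr; case nz: (near z).
  have h := iavg_zero_ge sep Q0 (ltW (wfac_lt1 (off zr))) Qd d1 QJ e0 L0 eL
    (fun r => er z r zr).
  rewrite mulr1; have : 0 <= d * 3 by rewrite mulr_ge0 ?ltW.
  by move: h; set x := iavg _ _ _ _ _; lra.
rewrite mulr0 addr0; move: nz => /negbT; rewrite /near -leNgt => nz.
have := iavg_far m.+1 t sep Q0 _ nz; rewrite d0 d1 => /(_ isT).
by rewrite ler_norml => /andP[h _]; rewrite lerNl.
Qed.

End PolyDeviation.

End PolyOnCircles.

(** * Means over the circle *)

Local Notation mu := lebesgue_measure.

Section Mean.
Variable R : realType.
Implicit Types (f g : R -> R) (w : R[i]).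

Definition ucont f : Prop := forall e, 0 < e -> exists2 d, 0 < d &
  forall x y, `|x - y| <= d -> `|f x - f y| <= e.

Lemma ucont_lip f (c : R) : (forall x y, `|f x - f y| <= c * `|x - y|) -> ucont f.
Proof.
move=> fc e e0; exists (e / (`|c| + 1)); first by rewrite divr_gt0// ltr_wpDl.
move=> x y; rewrite ler_pdivlMr ?ltr_wpDl// => h.
apply: le_trans (fc _ _) _; apply: le_trans h; rewrite mulrC ler_wpM2l//.
by apply: le_trans (ler_norm _) _; rewrite lerDl.
Qed.

Lemma ucont_cst (c : R) : ucont (fun=> c).
Proof. by apply: (@ucont_lip _ 0) => x y; rewrite subrr normr0 mul0r. Qed.

Lemma ucontD f g : ucont f -> ucont g -> ucont (fun x => f x + g x).
Proof.
move=> uf ug e e0; have e2 : 0 < e / 2 by rewrite divr_gt0.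
have [d1 d10 h1] := uf _ e2; have [d2 d20 h2] := ug _ e2.
exists (Num.min d1 d2); first by rewrite lt_min d10.
move=> x y; rewrite le_min => /andP[/h1 {}h1 /h2 {}h2].
have -> : f x + g x - (f y + g y) = (f x - f y) + (g x - g y) by ring.
by apply: le_trans (ler_normD _ _) _; lra.
Qed.

Lemma ucontZ (c : R) f : ucont f -> ucont (fun x => c * f x).
Proof.
move=> uf e e0; have e2 : 0 < e / (`|c| + 1) by rewrite divr_gt0// ltr_wpDl.
have [d d0 h] := uf _ e2; exists d => // x y /h {}h.
rewrite -mulrBr normrM; move: h; rewrite ler_pdivlMr ?ltr_wpDl//.
apply: le_trans; rewrite mulrC ler_wpM2l// lerDl//.
Qed.

Lemma ucont_sum (I : Type) (s : seq I) (F : I -> R -> R) :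
  (forall i, ucont (F i)) -> ucont (fun x => \sum_(i <- s) F i x).
Proof.
move=> uF; elim: s => [|i s IH].
  by rewrite (_ : (fun x => _) = fun=> 0); [exact: ucont_cst|apply/funext => x; rewrite big_nil].
rewrite (_ : (fun x => _) = fun x => F i x + \sum_(i <- s) F i x); first exact: ucontD.
by apply/funext => x; rewrite big_cons.
Qed.

Lemma ucont_shift f (s : R) : ucont f -> ucont (fun x => f (x + s)).
Proof.
move=> uf e /uf[d d0 h]; exists d => // x y xy; apply: h.
by have -> : x + s - (y + s) = x - y by ring.
Qed.

Lemma ln_lip (c x y : R) : 0 < c -> c <= x -> c <= y -> `|ln x - ln y| <= `|x - y| / c.
Proof.
move=> c0; wlog xy : x y / y <= x.
  move=> H cx cy; case: (leP y x) => [|/ltW] h; first exact: H.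
  by rewrite distrC (distrC x); exact: H.
move=> cx cy; have x0 := lt_le_trans c0 cx; have y0 := lt_le_trans c0 cy.
rewrite ger0_norm ?subr_ge0 ?ler_ln ?posrE// [`|x - y|]ger0_norm ?subr_ge0//.
rewrite -ln_div ?posrE//; have -> : x / y = 1 + (x - y) / y.
  by rewrite mulrBl mulfV ?gt_eqF//; ring.
have h : 0 <= (x - y) / y by rewrite divr_ge0 ?subr_ge0// ltW.
apply: le_trans (le_ln1Dx _) _; first by apply: lt_le_trans h; lra.
by rewrite ler_wpM2l ?subr_ge0// lef_pV2.
Qed.

Lemma ucont_ln f (c : R) : 0 < c -> (forall x, c <= f x) -> ucont f -> ucont (fun x => ln (f x)).
Proof.
move=> c0 cf uf e e0; have [d d0 h] := uf (e * c) (mulr_gt0 e0 c0).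
exists d => // x y /h {}h; apply: le_trans (ln_lip c0 (cf _) (cf _)) _.
by rewrite ler_pdivrMr.
Qed.

Lemma normc_circB (x y : R) : normc (circ x - circ y) <= 16 * `|x - y|.
Proof.
have pi4 : pi <= 4 :> R by have := pihalf_lt2 R; lra.
have pi0 := pi_gt0 R.
have lip (f df : R -> R) : (forall u : R, is_derive u 1 f (df u)) -> (forall u, `|df u| <= 1) ->
    forall u v, `|f u - f v| <= `|u - v|.
  move=> fd df1 u v; wlog uv : u v / v <= u.
    move=> H; case: (leP v u) => [|/ltW]; first exact: H.
    by move=> h; rewrite distrC (distrC u); exact: H.
  have [|c _ ->] := @MVT_segment R f df v u uv (fun z _ => fd z).
    by apply: derivable_within_continuous => z _; apply: ex_derive.
  by rewrite normrM ler_piMl.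
have hc := lip cos (fun u => - sin u) (fun u => is_derive_cos u)
  (fun u => ltac:(rewrite normrN; exact: sin_max)).
have hs := lip sin cos (fun u => is_derive_sin u) (fun u => cos_max u).
have ab (a b : R) : normc (a +i* b) <= `|a| + `|b|.
  rewrite -(@ler_sqr _ (normc _)) ?nnegrE ?normc_ge0 ?addr_ge0// sqr_normcE /=.
  rewrite -(real_normK (num_real a)) -(real_normK (num_real b)).
  have := normr_ge0 a; have := normr_ge0 b; nra.
apply: le_trans (ab _ _) _.
have := hc (2 * pi * x) (2 * pi * y); have := hs (2 * pi * x) (2 * pi * y).
rewrite -mulrBr normrM (ger0_norm (mulr_ge0 (ler0n _ 2) (ltW pi0))) => h1 h2.
have := normr_ge0 (x - y); nra.
Qed.

Lemma ucont_lnfac w : normc w < 1 -> ucont (lnfac w).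
Proof.
move=> w1; apply: (@ucont_ln _ (1 - normc w)); first by rewrite subr_gt0.
  by move=> x; apply: le_trans (normcBl _ _); rewrite normc1 normcM normc_circ mulr1.
apply: (@ucont_lip _ 16) => x y.
have h u v : normc (1 - w * circ u) - normc (1 - w * circ v) <= normc (circ u - circ v).
  apply: le_trans (normcBl _ _) _.
  have -> : 1 - w * circ u - (1 - w * circ v) = w * (circ v - circ u) by ring.
  by rewrite normcM normc_distC ler_piMl ?normc_ge0// ltW.
apply: le_trans _ (normc_circB x y); rewrite ler_norml h andbT lerNl opprB.
by rewrite normc_distC h.
Qed.

Lemma ucont_continuous f : ucont f -> continuous f.
Proof.
move=> uf x; apply/cvgrPdist_le => e /uf[d d0 h].
have /= := nbhsx_ballx x d d0; apply: filterS => y; rewrite /ball_ /= => xy.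
by apply: h; exact: ltW.
Qed.

Lemma ucont_integrable f (a b : R) : ucont f -> mu.-integrable `[a, b] (EFin \o f).
Proof.
move=> uf; apply: continuous_compact_integrable; first exact: segment_compact.
exact/continuous_subspaceT/ucont_continuous.
Qed.

Definition mean f : R := \int[mu]_(t in `[0, 1]) f t.

Lemma integral_near f (a b c e : R) : a <= b -> ucont f ->
  (forall x, a <= x <= b -> `|f x - c| <= e) ->
  `|\int[mu]_(t in `]a, b]) f t - (b - a) * c| <= (b - a) * e.
Proof.
move=> ab uf fc.
have i1 : mu.-integrable `]a, b] (EFin \o f).
  apply: integrableS (ucont_integrable a b uf) => //.
  by apply: subset_itv; rewrite !bnd_simp.
have muab : fine (mu (`]a, b]%classic : set R)) = b - a.
  rewrite lebesgue_measure_itv /= lte_fin; case: ltP => [//|ba].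
  by have -> : a = b; [apply/le_anti; rewrite ab|rewrite subrr].
have ic (k : R) : \int[mu]_(t in `]a, b]) k = (b - a) * k.
  by rewrite Rintegral_cst// muab mulrC.
have i2 (k : R) : mu.-integrable `]a, b] (EFin \o fun=> k).
  apply: integrableS (ucont_integrable a b (ucont_cst k)) => //.
  by apply: subset_itv; rewrite !bnd_simp.
have up : \int[mu]_(t in `]a, b]) f t <= (b - a) * (c + e).
  rewrite -ic; apply: le_Rintegral => // x /=; rewrite in_itv /= => /andP[/ltW ax xb].
  by have := fc x; rewrite ax xb => /(_ isT); rewrite ler_norml => /andP[*]; lra.
have lo : (b - a) * (c - e) <= \int[mu]_(t in `]a, b]) f t.
  rewrite -ic; apply: le_Rintegral => // x /=; rewrite in_itv /= => /andP[/ltW ax xb].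
  by have := fc x; rewrite ax xb => /(_ isT); rewrite ler_norml => /andP[*]; lra.
move: up lo; set I := Rintegral _ _ _; move: I => I up lo.
by rewrite ler_norml; apply/andP; split; lra.
Qed.

(** Integrals are reached through Riemann sums, which are the averages [oavg] along the rotation by
    1 / M; the counting lemmas for orbits thus also serve to measure arcs. *)
Lemma mean_riemann f (e d s : R) (M : nat) : ucont f ->
  (forall x y, `|x - y| <= d -> `|f x - f y| <= e) ->
  (0 < M)%N -> M%:R^-1 <= d -> 0 <= s <= M%:R^-1 ->
  `|oavg M%:R^-1 M f s - mean f| <= e.
Proof.
move=> uf fd M0 Md /andP[s0 s1].
have M0' : (0 : R) < M%:R by rewrite ltr0n.
pose h := M%:R^-1 : R; have h0 : 0 < h by rewrite invr_gt0.
have key n : `|\int[mu]_(t in `[0, n%:R * h]) f t - h * \sum_(j < n) f (s + j%:R * h)|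
    <= n%:R * h * e.
  elim: n => [|n IH].
    by rewrite big_ord0 !mul0r mulr0 subr0 set_itv1 Rintegral_set1 normr0.
  have nh : n%:R * h <= n.+1%:R * h by rewrite ler_wpM2r ?(ltW h0)// ler_nat.
  have := @Rintegral_itvB R f (BLeft 0) (BRight (n.+1%:R * h)) (n%:R * h)
    (ucont_integrable 0 _ uf).
  rewrite !bnd_simp => /(_ (mulr_ge0 (ler0n _ _) (ltW h0)) nh) /eqP.
  rewrite subr_eq => /eqP ->; rewrite big_ord_recr /= mulrDr.
  have -> : n.+1%:R * h * e = h * e + n%:R * h * e by rewrite -natr1; ring.
  have hh : n.+1%:R * h - n%:R * h = h by rewrite -natr1; ring.
  have := @integral_near f (n%:R * h) (n.+1%:R * h) (f (s + n%:R * h)) e nh uf.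
  rewrite hh => /(_ _)/Wrap[].
    move=> x /andP[x1 x2]; apply: fd; apply: le_trans Md; rewrite -/h.
    by rewrite ler_norml; move: hh s1; rewrite -/h => hh s1; apply/andP; split; lra.
  set A := Rintegral _ _ _; set B := Rintegral _ _ _ in IH *; set S := \sum_(i < n) _ in IH *.
  move=> h1; have -> : A + B - (h * S + h * f (s + n%:R * h)) =
    (A - h * f (s + n%:R * h)) + (B - h * S) by ring.
  by apply: le_trans (ler_normD _ _) _; exact: lerD.
have := key M; rewrite mulfV ?gt_eqF// mul1r distrC.
by rewrite /oavg /mean.
Qed.

Lemma oavg_grid_shift f (M : nat) (s : R) (k : int) : periodic1 f -> (0 < M)%N ->
  oavg M%:R^-1 M f (s + k%:~R * M%:R^-1) = oavg M%:R^-1 M f s.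
Proof.
move=> pf M0; have M0' : (0 : R) < M%:R by rewrite ltr0n.
have h1 u : oavg M%:R^-1 M f (u + M%:R^-1) = oavg M%:R^-1 M f u.
  rewrite /oavg; congr (_ * _); case: M M0 M0' => // M _ M0.
  rewrite big_ord_recr big_ord_recl /= mul0r addr0 addrC; congr (_ + _).
    rewrite -[RHS]pf; congr f; rewrite -addrA; congr (_ + _).
    by rewrite -[X in X + _]mul1r -mulrDl addrC natr1 mulfV ?gt_eqF.
  by apply: eq_bigr => i _; congr f; rewrite /bump /= add1n -[i.+1%:R]natr1; ring.
have h2 (n : nat) u : oavg M%:R^-1 M f (u + n%:R * M%:R^-1) = oavg M%:R^-1 M f u.
  elim: n => [|n IH]; first by rewrite mul0r addr0.
  by rewrite -natr1 mulrDl mul1r addrA h1.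
case: k => n; first by rewrite -pmulrn h2.
rewrite NegzE mulrNz -pmulrn -(h2 n.+1); congr (oavg _ _ _ _); ring.
Qed.

Lemma mean_approx f : ucont f -> periodic1 f -> forall e, 0 < e ->
  exists M0 : nat, forall M s, (M0 <= M)%N -> (0 < M)%N ->
    `|oavg M%:R^-1 M f s - mean f| <= e.
Proof.
move=> uf pf e e0; have [d d0 fd] := uf e e0.
exists (Num.truncn d^-1).+1 => M s MM M0.
have M0' : (0 : R) < M%:R by rewrite ltr0n.
pose k := Num.floor (s * M%:R).
rewrite -(oavg_grid_shift s (- k) pf M0).
apply: (mean_riemann uf fd) => //.
  rewrite invf_ple ?posrE//; apply: ltW.
  have d1 : 0 <= d^-1 by rewrite invr_ge0 ltW.
  by have /andP[_ h] := truncn_itv d1; apply: lt_le_trans h _; rewrite ler_nat.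
rewrite mulrNz mulNr; have := floor_le (s * M%:R); have := floorD1_gt (s * M%:R).
rewrite -/k rmorphD /= => h1 h2.
have sE : s = s * M%:R / M%:R by rewrite mulfK ?gt_eqF.
rewrite {1 2}sE -mulrBl; apply/andP; split.
  by rewrite mulr_ge0 ?invr_ge0// subr_ge0.
by rewrite -[X in _ <= X]mul1r ler_pM2r ?invr_gt0//; lra.
Qed.


Lemma mean_eq f (L : R) : ucont f -> periodic1 f ->
  (forall e, 0 < e -> exists M0 : nat, forall M, (M0 <= M)%N -> (0 < M)%N ->
    `|oavg M%:R^-1 M f 0 - L| <= e) -> mean f = L.
Proof.
move=> uf pf fL; apply/eqP; rewrite -subr_eq0 -normr_le0.
apply/ler_addgt0Pl => e e0; rewrite addr0.
have e2 : 0 < e / 2 by rewrite divr_gt0.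
have [M1 h1] := fL _ e2; have [M2 h2] := mean_approx uf pf e2.
pose M := (maxn M1 M2).+1.
have {}h1 := h1 M (leq_trans (leq_maxl _ _) (leqnSn _)) (ltn0Sn _).
have {}h2 := h2 M 0 (leq_trans (leq_maxr _ _) (leqnSn _)) (ltn0Sn _).
set A := oavg _ _ _ _ in h1 h2.
have -> : mean f - L = (A - L) - (A - mean f) by ring.
by apply: le_trans (ler_normB _ _) _; lra.
Qed.

Lemma meanD f g : ucont f -> ucont g -> mean (fun x => f x + g x) = mean f + mean g.
Proof. by move=> uf ug; apply: RintegralD => //; exact: ucont_integrable. Qed.

Lemma meanZ (c : R) f : ucont f -> mean (fun x => c * f x) = c * mean f.
Proof. by move=> uf; apply: RintegralZl => //; exact: ucont_integrable. Qed.

Lemma mean_cst (c : R) : mean (fun=> c) = c.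
Proof.
rewrite /mean Rintegral_cst//=; have := @lebesgue_measure_itv R `[0, 1].
by rewrite /= lte01 -EFinB subr0 => ->; rewrite mulr1.
Qed.

Lemma mean_sum (I : Type) (s : seq I) (F : I -> R -> R) : (forall i, ucont (F i)) ->
  mean (fun x => \sum_(i <- s) F i x) = \sum_(i <- s) mean (F i).
Proof.
move=> uF; elim: s => [|i s IH].
  by rewrite big_nil -[RHS](mean_cst 0); congr mean; apply/funext => x; rewrite big_nil.
rewrite big_cons -IH -meanD//; last exact: ucont_sum.
by congr mean; apply/funext => x; rewrite big_cons.
Qed.

Lemma ler_mean f g : ucont f -> ucont g -> (forall x, f x <= g x) -> mean f <= mean g.
Proof. by move=> uf ug fg; apply: le_Rintegral => //; exact: ucont_integrable. Qed.

Lemma mean_near f g (e : R) : ucont f -> ucont g -> (forall x, `|f x - g x| <= e) ->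
  `|mean f - mean g| <= e.
Proof.
move=> uf ug fg.
have ue (h : R -> R) (c : R) : ucont h -> ucont (fun x => h x + c).
  by move=> uh; apply: ucontD uh (ucont_cst _).
have h1 : mean f <= mean g + e.
  rewrite -[X in _ + X]mean_cst -meanD//; last exact: ucont_cst.
  by apply: ler_mean => // [|x]; [exact: ue|have := fg x; rewrite ler_norml => /andP[*]; lra].
have h2 : mean g <= mean f + e.
  rewrite -[X in _ + X]mean_cst -meanD//; last exact: ucont_cst.
  by apply: ler_mean => // [|x]; [exact: ue|have := fg x; rewrite ler_norml => /andP[*]; lra].
by rewrite ler_norml; move: h1 h2; move: (mean f) (mean g) => u v *; apply/andP; split; lra.
Qed.

Lemma mean_shift f (s : R) : ucont f -> periodic1 f -> mean (fun x => f (x + s)) = mean f.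
Proof.
move=> uf pf; apply: mean_eq; first exact: ucont_shift.
  by move=> t; rewrite -addrAC pf.
move=> e e0; have [M0 h] := mean_approx uf pf e0; exists M0 => M MM M1.
have := h M s MM M1; congr (`|_ - _| <= _).
by rewrite /oavg; congr (_ * _); apply: eq_bigr => i _; rewrite add0r addrC.
Qed.

Lemma lnfac_period w : periodic1 (lnfac w).
Proof. by move=> t; rewrite /lnfac -(circDint t 1). Qed.

Lemma prod_roots_of_unity (M : nat) (y : R[i]) : (0 < M)%N ->
  \prod_(j < M) (1 - y * circ (j%:R * M%:R^-1)) = 1 - y ^+ M :> R[i].
Proof.
move=> M0; have M0' : (0 : R) < M%:R by rewrite ltr0n.
have prim : M.-primitive_root (circ M%:R^-1 : R[i]).
  apply/andP; split=> //; apply/forallP => /= i; apply/eqP; rewrite unity_rootE -circMn.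
  have [->|iM] := eqVneq i.+1 M; first by have := circ1 R; rewrite -{1}(mulfV (lt0r_neq0 M0')) => ->; rewrite !eqxx.
  apply/negbTE/circ_ratio_neq1; have := ltn_ord i; lia.
have [->|y0] := eqVneq y 0.
  rewrite expr0n gtn_eqF// subr0 big1// => j _; by rewrite mul0r subr0.
have := congr1 (fun q : {poly R[i]} => y ^+ M * q.[y^-1]) (factor_Xn_sub_1 prim).
rewrite hornerD hornerN hornerXn hornerC horner_prod mulrBr mulr1 -exprMn mulfV// expr1n => <-.
rewrite big_mkord; have -> : y ^+ M = \prod_(j < M) y by rewrite prodr_const card_ord.
rewrite -big_split /=; apply: eq_bigr => j _.
by rewrite hornerXsubC mulrBr mulfV// circMn.
Qed.

(** Over the M-th roots of unity the product of the factors is 1 - w^M, whose modulus lies between 1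
    - |w| and 2, so the Riemann sums are O(1 / M). *)
Lemma mean_lnfac w : normc w < 1 -> mean (lnfac w) = 0.
Proof.
move=> w1; apply: mean_eq; [exact: ucont_lnfac|exact: lnfac_period|].
move=> e e0; have w1' : 0 < 1 - normc w by rewrite subr_gt0.
pose c := `|ln (1 - normc w)| + 1.
have c0 : 0 < c by rewrite ltr_wpDl.
exists (Num.truncn (c / e)).+1 => M MM M0.
have M0' : (0 : R) < M%:R by rewrite ltr0n.
have f0 y : normc y <= normc w -> 1 - normc w <= normc (1 - y).
  by move=> h; apply: le_trans (normcBl _ _); rewrite normc1 lerD2l lerN2.
have -> : oavg M%:R^-1 M (lnfac w) 0 = M%:R^-1 * ln (normc (1 - w ^+ M)).
  rewrite /oavg; congr (_ * _); rewrite -prod_roots_of_unity// normc_prod ln_prod.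
    by apply: eq_bigr => i _; rewrite add0r.
  by move=> i; apply: lt_le_trans (f0 _ _) => //; rewrite normcM normc_circ mulr1.
rewrite subr0 normrM ger0_norm ?invr_ge0// ler_pdivrMl//.
apply: (@le_trans _ _ c).
  have h1 : 1 - normc w <= normc (1 - w ^+ M).
    apply: f0; rewrite normcX; case: (M) M0 => // n _.
    by rewrite exprS ler_piMr ?normc_ge0// exprn_ile1 ?normc_ge0// ltW.
  have h2 : normc (1 - w ^+ M) <= 2.
    apply: le_trans (normcB _ _) _; rewrite normc1 normcX.
    have := exprn_ile1 M (normc_ge0 w) (ltW w1); lra.
  have h3 : 0 < normc (1 - w ^+ M) by exact: lt_le_trans h1.
  have h4 : ln (1 - normc w) <= ln (normc (1 - w ^+ M)) by rewrite ler_ln ?posrE.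
  have h5 : ln (normc (1 - w ^+ M)) <= 1.
    apply: le_trans (_ : ln (1 + 1) <= 1); last exact: le_ln1Dx.
    by rewrite ler_ln ?posrE// (le_trans h2)//; lra.
  rewrite ler_norml /c; have := ler_norm (- ln (1 - normc w)); rewrite normrN.
  by have := normr_ge0 (ln (1 - normc w)) => *; apply/andP; split; lra.
have ce : 0 <= c / e by rewrite divr_ge0 ?ltW.
have /andP[_ h] := truncn_itv ce.
by rewrite -ler_pdivrMr//; apply: ltW; apply: lt_le_trans h _; rewrite ler_nat.
Qed.

(** By the pigeonhole count an excluded arc carries at most a proportion 8 eta + 1 / M of the grid
    of step 1 / M; letting M grow leaves 8 eta per arc. *)
Lemma mean_le_off f g (ws : seq R[i]) (eta e C : R) :
  ucont f -> ucont g -> periodic1 f -> periodic1 g ->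
  0 <= eta -> 0 <= e -> 0 <= C -> (forall w, w \in ws -> normc w <= 1) ->
  (forall x, (forall w, w \in ws -> eta <= normc (1 - w * circ x)) -> f x <= g x + e) ->
  (forall x, f x <= g x + C) ->
  mean f <= mean g + e + C * ((size ws)%:R * (8 * eta)).
Proof.
move=> uf ug pf pg eta0 e0 C0 ws1 fge fgC.
pose cl w x : R := ((normc (1 - w * circ x) < eta)%R)%:R.
have cl0 w x : 0 <= cl w x by rewrite /cl.
have fg x : f x <= g x + e + C * \sum_(w <- ws) cl w x.
  have [h|h] := pselect (forall w, w \in ws -> eta <= normc (1 - w * circ x)).
    apply: le_trans (fge _ h) _; rewrite lerDl mulr_ge0// sumr_ge0// => w _; exact: cl0.
  have [w wws] : exists2 w, w \in ws & normc (1 - w * circ x) < eta.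
    apply: contrapT => H; apply: h => w wws; rewrite leNgt; apply/negP => h.
    by apply: H; exists w.
  move=> wx; apply: le_trans (fgC x) _.
  have : 1 <= \sum_(w <- ws) cl w x.
    rewrite (big_rem w)//= {1}/cl wx lerDl sumr_ge0// => v _; exact: cl0.
  by nra.
have step (M : nat) : (0 < M)%N -> oavg M%:R^-1 M f 0 <= oavg M%:R^-1 M g 0 + e +
    C * ((size ws)%:R * (8 * eta + M%:R^-1)).
  move=> M0; have M0' : (0 : R) < M%:R by rewrite ltr0n.
  apply: (@le_trans _ _ (oavg M%:R^-1 M (fun x => g x + e + C * \sum_(w <- ws) cl w x) 0)).
    by apply: ler_oavg => r _; exact: fg.
  rewrite oavgD oavgD oavg_cst// oavgZ lerD2l ler_wpM2l//.
  have -> : oavg M%:R^-1 M (fun x => \sum_(w <- ws) cl w x) 0 =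
      \sum_(w <- ws) oavg M%:R^-1 M (cl w) 0.
    by rewrite /oavg exchange_big /= mulr_sumr.
  apply: (@le_trans _ _ (\sum_(w <- ws) (8 * eta + M%:R^-1))); last first.
    move: (8 * eta + _) => K; elim: (ws) => [|w s IH]; first by rewrite big_nil mul0r.
    by rewrite big_cons /= -natr1 mulrDl mul1r [X in _ <= X]addrC lerD2l.
  rewrite big_seq [X in _ <= X]big_seq; apply: ler_sum => w wws.
  rewrite /oavg ler_pdivrMl// mulrDr mulfV ?gt_eqF//.
  have -> : M%:R * (8 * eta) = 8 * eta / M%:R^-1 by rewrite invrK; ring.
  apply: (card_close (x := fun r => 0 + r%:R * M%:R^-1)); rewrite ?invr_gt0//.
    exact: ws1.
  move=> r r' j /andP[r'r rM]; rewrite !add0r -mulrBl -natrB; last exact: ltnW.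
  by apply: grid_sep; lia.
apply/ler_addgt0Pl => d d0.
have d4 : 0 < d / 4 by rewrite divr_gt0.
have [M1 h1] := mean_approx uf pf d4; have [M2 h2] := mean_approx ug pg d4.
pose K := C * (size ws)%:R; have K0 : 0 <= K by rewrite mulr_ge0.
pose M3 := (Num.truncn (K / (d / 4))).+1.
pose M := (M1 + M2 + M3)%N.
have M0 : (0 < M)%N by rewrite /M /M3 addnS.
have M0' : (0 : R) < M%:R by rewrite ltr0n.
have := h1 M 0 _ M0; have := h2 M 0 _ M0; have := step M M0.
have KM : K * M%:R^-1 <= d / 4.
  rewrite ler_pdivrMr// mulrC -ler_pdivrMr//.
  have Kd : 0 <= K / (d / 4) by rewrite divr_ge0// ltW.
  have /andP[_ h] := truncn_itv Kd.
  by apply: ltW; apply: lt_le_trans h _; rewrite ler_nat /M leq_addl.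
have -> : C * ((size ws)%:R * (8 * eta + M%:R^-1)) =
  C * ((size ws)%:R * (8 * eta)) + K * M%:R^-1 by rewrite /K; ring.
move=> a1 a2 a3; have {}a2 := a2 (ltac:(rewrite /M; lia)); have {}a3 := a3 (ltac:(rewrite /M; lia)).
move: a1 a2 a3 KM; rewrite !ler_norml.
move: (mean f) (mean g) (oavg _ _ f _) (oavg _ _ g _) (K * _) (C * _) => u v a b k c.
by move=> a1 /andP[b1 b2] /andP[c1 c2] *; lra.
Qed.

End Mean.

(** * Norms and the avalanche principle *)

Section L1Norm.
Variables (R : realType) (K : nzRingType) (abs : K -> R).
Hypotheses (abs0 : abs 0 = 0) (abs1 : abs 1 = 1) (abs_ge0 : forall x, 0 <= abs x)
  (absD : forall x y, abs (x + y) <= abs x + abs y)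
  (absM : forall x y, abs (x * y) = abs x * abs y).

(** The entrywise norm is submultiplicative and suits exact algebra on entries, as in
    [nrm_interlace]. On d by d matrices it is within a factor d^2 of the operator norm, which does
    not affect exponents. The ring stays abstract to cover both R and R[i]. *)
Definition l1norm (m n : nat) (M : 'M[K]_(m, n)) : R := \sum_i \sum_j abs (M i j).

Lemma l1norm_ge0 m n (M : 'M[K]_(m, n)) : 0 <= l1norm M.
Proof. by rewrite sumr_ge0// => i _; rewrite sumr_ge0. Qed.

Lemma abs_sum (I : Type) (s : seq I) (F : I -> K) :
  abs (\sum_(i <- s) F i) <= \sum_(i <- s) abs (F i).
Proof.
elim: s => [|i s IH]; rewrite ?big_nil ?abs0// !big_cons.
by apply: le_trans (absD _ _) _; rewrite lerD2l.
Qed.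

Lemma entry_le_l1norm m n (M : 'M[K]_(m, n)) i j : abs (M i j) <= l1norm M.
Proof.
rewrite /l1norm (bigD1 i)//= (bigD1 j)//= -addrA lerDl addr_ge0 ?sumr_ge0//.
by move=> k _; rewrite sumr_ge0.
Qed.

Lemma l1normD m n (M N : 'M[K]_(m, n)) : l1norm (M + N) <= l1norm M + l1norm N.
Proof.
rewrite /l1norm -big_split /=; apply: ler_sum => i _.
by rewrite -big_split /=; apply: ler_sum => j _; rewrite mxE.
Qed.

Lemma l1normM m n p (M : 'M[K]_(m, n)) (N : 'M[K]_(n, p)) :
  l1norm (M *m N) <= l1norm M * l1norm N.
Proof.
rewrite /l1norm mulr_suml; apply: ler_sum => i _.
apply: (@le_trans _ _ (\sum_j \sum_k abs (M i k) * abs (N k j))).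
  apply: ler_sum => j _; rewrite mxE; apply: le_trans (abs_sum _ _) _.
  by apply: ler_sum => k _; rewrite absM.
rewrite exchange_big /= mulr_suml; apply: ler_sum => k _.
rewrite -mulr_sumr ler_wpM2l// [X in _ <= X](bigD1 k)//= lerDl sumr_ge0// => l _.
by rewrite sumr_ge0.
Qed.

Lemma l1norm0 m n : l1norm (0 : 'M[K]_(m, n)) = 0.
Proof. by rewrite /l1norm big1// => i _; rewrite big1// => j _; rewrite mxE. Qed.

Lemma l1norm_sum m n (I : Type) (s : seq I) (F : I -> 'M[K]_(m, n)) :
  l1norm (\sum_(i <- s) F i) <= \sum_(i <- s) l1norm (F i).
Proof.
elim: s => [|i s IH]; rewrite ?big_nil ?l1norm0// !big_cons.
by apply: le_trans (l1normD _ _) _; rewrite lerD2l.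
Qed.

Lemma l1normZ m n (c : K) (M : 'M[K]_(m, n)) : l1norm (c *: M) = abs c * l1norm M.
Proof.
rewrite /l1norm mulr_sumr; apply: eq_bigr => i _; rewrite mulr_sumr.
by apply: eq_bigr => j _; rewrite mxE absM.
Qed.

Lemma euclid_le_sum d (v : 'cV[K]_d) : euclid_norm abs v <= \sum_i abs (v i 0).
Proof.
rewrite /euclid_norm -[X in _ <= X]ger0_norm ?sumr_ge0// -sqrtr_sqr ler_wsqrtr//.
rewrite expr2 mulr_suml; apply: ler_sum => i _; rewrite expr2 ler_wpM2l//.
by rewrite (bigD1 i)//= lerDl sumr_ge0.
Qed.

Lemma entry_le_euclid d (v : 'cV[K]_d) i : abs (v i 0) <= euclid_norm abs v.
Proof.
rewrite /euclid_norm -[X in X <= _]ger0_norm// -sqrtr_sqr ler_wsqrtr//.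
by rewrite (bigD1 i)//= lerDl sumr_ge0// => j _; rewrite sqr_ge0.
Qed.

Lemma euclid_mulmx_le d (M : 'M[K]_d) (v : 'cV[K]_d) : euclid_norm abs v <= 1 ->
  euclid_norm abs (M *m v) <= l1norm M.
Proof.
move=> v1; apply: le_trans (euclid_le_sum _) _; apply: ler_sum => i _.
rewrite mxE; apply: le_trans (abs_sum _ _) _; apply: ler_sum => k _.
by rewrite absM ler_piMr//; apply: le_trans (entry_le_euclid _ _) v1.
Qed.

Lemma euclid0 d : euclid_norm abs (0 : 'cV[K]_d) = 0.
Proof.
by rewrite /euclid_norm big1 ?sqrtr0// => i _; rewrite mxE abs0 expr0n.
Qed.

Let opset d (M : 'M[K]_d) := [set euclid_norm abs (M *m v) | v in [set v | euclid_norm abs v <= 1]].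

Lemma opset_sup d (M : 'M[K]_d) : has_sup (opset M).
Proof.
split; first by exists (euclid_norm abs (M *m 0)); exists 0 => //=; rewrite euclid0.
by exists (l1norm M) => _ [v v1 <-]; exact: euclid_mulmx_le.
Qed.

Lemma op_norm_le_l1 d (M : 'M[K]_d) : op_norm abs M <= l1norm M.
Proof.
apply: ge_sup; first by case: (opset_sup M).
by move=> _ [v v1 <-]; exact: euclid_mulmx_le.
Qed.

Lemma entry_le_op_norm d (M : 'M[K]_d) i j : abs (M i j) <= op_norm abs M.
Proof.
have -> : M i j = (M *m delta_mx j (0 : 'I_1)) i 0 by rewrite -colE mxE.
apply: le_trans (entry_le_euclid _ _) _.
apply: ub_le_sup; first by case: (opset_sup M).
exists (delta_mx j 0) => //=.
rewrite /euclid_norm (bigD1 j)//= big1 ?addr0 => [|k kj].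
  by rewrite mxE !eqxx abs1 expr1n sqrtr1.
by rewrite mxE (negbTE kj) abs0 expr0n.
Qed.

Lemma l1norm_le_op d (M : 'M[K]_d) : l1norm M <= (d * d)%:R * op_norm abs M.
Proof.
apply: (@le_trans _ _ (\sum_(i < d) \sum_(j < d) op_norm abs M)).
  by apply: ler_sum => i _; apply: ler_sum => j _; exact: entry_le_op_norm.
by rewrite !sumr_const !card_ord -mulrnA mulr_natl.
Qed.

(** Gives the continuity of the operator norm. Bounding the perturbation by the sum of its entries
    takes the place of the triangle inequality for the Euclidean norm. *)
Lemma op_norm_near d (M N : 'M[K]_d) :
  op_norm abs M <= op_norm abs N + l1norm (M - N).
Proof.
apply: ge_sup; first by case: (opset_sup M).
move=> _ [v v1 <-].
set D := l1norm _; have D0 : 0 <= D by exact: l1norm_ge0.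
apply: (@le_trans _ _ (euclid_norm abs (N *m v) + D)); last first.
  by rewrite lerD2r; apply: ub_le_sup; [case: (opset_sup N)|exists v].
pose a i := abs ((N *m v) i 0); pose b i := abs (((M - N) *m v) i 0).
have ab i : abs ((M *m v) i 0) <= a i + b i.
  by rewrite /a /b -[M in X in X <= _](subrK N) addrC mulmxDl [X in abs X]mxE absD.
have bD : \sum_i b i <= D.
  apply: ler_sum => i _; rewrite /b mxE; apply: le_trans (abs_sum _ _) _.
  apply: ler_sum => k _; rewrite absM ler_piMr//.
  exact: le_trans (entry_le_euclid _ _) v1.
have b0 : 0 <= \sum_i b i by rewrite sumr_ge0// => i _; exact: abs_ge0.
set e := euclid_norm abs (N *m v).
have e0 : 0 <= e by rewrite sqrtr_ge0.
apply: (@le_trans _ _ (e + \sum_i b i)); last by rewrite lerD2l.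
rewrite -[X in _ <= X]ger0_norm ?addr_ge0// -sqrtr_sqr ler_wsqrtr//.
have -> : (e + \sum_i b i) ^+ 2 = e ^+ 2 + (2 * e + \sum_i b i) * \sum_i b i by ring.
rewrite sqr_sqrtr; last by rewrite sumr_ge0// => i _; rewrite sqr_ge0.
rewrite mulr_sumr -big_split /=; apply: ler_sum => i _.
have a0 : 0 <= a i := abs_ge0 _; have bi0 : 0 <= b i := abs_ge0 _.
have ae : a i <= e by exact: entry_le_euclid.
have bb : b i <= \sum_i b i.
  by rewrite [X in _ <= X](bigD1 i)//= lerDl sumr_ge0// => j _; exact: abs_ge0.
apply: (@le_trans _ _ ((a i + b i) ^+ 2)).
  by apply: lerXn2r => //; rewrite nnegrE ?addr_ge0.
rewrite -/(a i); nra.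
Qed.

End L1Norm.

(** * Products of matrices of determinant 1 *)

Section Avalanche.
Variable R : realType.
Implicit Types (g X Y : 'M[R]_2).

Definition nrm g : R := l1norm (Num.norm : R -> R) g.

Lemma nrm_ge0 g : 0 <= nrm g.
Proof. by apply: l1norm_ge0 => x; exact: normr_ge0. Qed.

Lemma nrmM X Y : nrm (X *m Y) <= nrm X * nrm Y.
Proof.
by apply: l1normM => [|x|x y|x y]; rewrite ?normr0 ?normr_ge0 ?ler_normD ?normrM.
Qed.

Lemma nrmD X Y : nrm (X + Y) <= nrm X + nrm Y.
Proof. by apply: l1normD => x y; exact: ler_normD. Qed.

Lemma det2 g : \det g = g 0 0 * g 1 1 - g 0 1 * g 1 0.
Proof.
rewrite (expand_det_row _ 0) !big_ord_recl big_ord0 addr0 /cofactor !det_mx11 !mxE /=.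
rewrite /bump /= !addn0 expr0 expr1 mul1r mulN1r mulrN.
by congr (g _ _ * g _ _ - g _ _ * g _ _); apply: val_inj.
Qed.

Lemma sum2 (F : 'I_2 -> R) : \sum_i F i = F 0 + F 1.
Proof.
by rewrite !big_ord_recl big_ord0 addr0; congr (_ + F _); apply: val_inj.
Qed.

Lemma nrm2 g : nrm g = `|g 0 0| + `|g 0 1| + (`|g 1 0| + `|g 1 1|).
Proof. by rewrite /nrm /l1norm !sum2. Qed.

(** By 1 <= |a d| + |b c| <= ((|a| + |d|)^2 + (|b| + |c|)^2) / 4. This keeps the logarithms of norms
    nonnegative and away from the singularity of ln. *)
Lemma nrm_det1_ge2 g : \det g = 1 -> 2 <= nrm g.
Proof.
rewrite det2 nrm2 => d1.
have : 1 <= `|g 0 0| * `|g 1 1| + `|g 0 1| * `|g 1 0|.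
  by rewrite -!normrM -(normr1 R) -d1 ler_normB.
have := normr_ge0 (g 0 0); have := normr_ge0 (g 0 1).
have := normr_ge0 (g 1 0); have := normr_ge0 (g 1 1).
move: `|g 0 0| `|g 0 1| `|g 1 0| `|g 1 1| => a b c d d0 c0 b0 a0 h.
rewrite leNgt; apply/negP => h2.
have := sqr_ge0 (a - d); have := sqr_ge0 (b - c).
nra.
Qed.

(* Both products are sums of 16 terms that agree pairwise up to a minor of
   [g]; a rank-one [g] would give equality. *)
Lemma nrm_interlace X g Y :
  `|nrm (X *m g *m Y) * nrm g - nrm (X *m g) * nrm (g *m Y)|
    <= `|\det g| * (nrm X * nrm Y).
Proof.
pose o (k : 'I_2) : 'I_2 := if k == 0 then 1 else 0.
pose S (F : 'I_2 -> 'I_2 -> 'I_2 -> 'I_2 -> R) := \sum_i \sum_j \sum_k \sum_l F i j k l.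
have -> : nrm (X *m g *m Y) * nrm g = S (fun i j k l => `|(X *m g *m Y) i j| * `|g k l|).
  by rewrite /S !nrm2 !sum2; ring.
have -> : nrm (X *m g) * nrm (g *m Y) = S (fun i j k l => `|(X *m g) i l| * `|(g *m Y) k j|).
  by rewrite /S !nrm2 !sum2; ring.
have -> : `|\det g| * (nrm X * nrm Y) = S (fun i j k l => `|\det g| * (`|X i (o k)| * `|Y (o l) j|)).
  by rewrite /S !nrm2 !sum2 /o /=; ring.
have SB F G : S F - S G = S (fun i j k l => F i j k l - G i j k l).
  by rewrite /S !sum2; ring.
rewrite SB; apply: le_trans (ler_norm_sum _ _ _) _; apply: ler_sum => i _.
apply: le_trans (ler_norm_sum _ _ _) _; apply: ler_sum => j _.
apply: le_trans (ler_norm_sum _ _ _) _; apply: ler_sum => k _.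
apply: le_trans (ler_norm_sum _ _ _) _; apply: ler_sum => l _.
rewrite -!normrM; apply: le_trans (ler_dist_dist _ _) _.
suff [->|->] : (X *m g *m Y) i j * g k l - (X *m g) i l * (g *m Y) k j =
    \det g * (X i (o k) * Y (o l) j) \/
  (X *m g *m Y) i j * g k l - (X *m g) i l * (g *m Y) k j = - (\det g * (X i (o k) * Y (o l) j)) by rewrite ?normrN.
rewrite det2 !mxE !sum2 !mxE !sum2 /o.
have [->|->] : k = 0 \/ k = 1 by case: k => [[|[|]]]// ?; [left|right]; exact: val_inj.
  have [->|->] : l = 0 \/ l = 1 by case: l => [[|[|]]]// ?; [left|right]; exact: val_inj.
    by left => /=; ring.
  by right => /=; ring.
have [->|->] : l = 0 \/ l = 1 by case: l => [[|[|]]]// ?; [left|right]; exact: val_inj.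
  by right => /=; ring.
by left => /=; ring.
Qed.

Lemma ln_near1 (x : R) : `|x| <= 2^-1 -> `|ln (1 + x)| <= 2 * `|x|.
Proof.
move=> x2; have /andP[x3 x4] : - 2^-1 <= x <= 2^-1 by rewrite -ler_norml.
have x0 : 0 < 1 + x by lra.
rewrite ler_norml; apply/andP; split; last first.
  apply: le_trans (le_ln1Dx _) _; first lra.
  by have := ler_norm x; have := normr_ge0 x; lra.
rewrite lerNl -lnV ?posrE//.
have -> : (1 + x)^-1 = 1 + (- x / (1 + x)) by field; rewrite gt_eqF.
have h : - x / (1 + x) <= 2 * `|x|.
  rewrite ler_pdivrMr//; have := ler_norm (- x); rewrite normrN; have := normr_ge0 x; nra.
apply: le_trans (le_ln1Dx _) h.
by rewrite ltr_pdivlMr//; lra.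
Qed.

Fixpoint mprod (g : nat -> 'M[R]_2) (n : nat) : 'M[R]_2 :=
  if n is n'.+1 then g n' *m mprod g n' else 1%:M.

(** With T_k the partial products, [nrm_interlace] gives |T_(k+3)| |g_(k+1)| = |g_(k+2) g_(k+1)|
    |T_(k+2)| up to the relative error |g_(k+2)| |T_(k+1)| / (|g_(k+2) g_(k+1)| |T_(k+2)|), at most
    2 / lam^2 as long as the partial products grow by lam / 2. Logarithms at most double the error,
    and the steps telescope. *)
Lemma avalanche (g : nat -> 'M[R]_2) (n : nat) (lam : R) :
  (forall k, \det (g k) = 1) -> 4 <= lam ->
  (forall k, (k < n)%N -> lam * nrm (g k) <= nrm (g k.+1 *m g k)) ->
  (forall k, (k < n)%N -> lam * nrm (g k.+1) <= nrm (g k.+1 *m g k)) ->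
  `|ln (nrm (mprod g n.+1)) - (ln (nrm (g 0%N)) +
     \sum_(k < n) (ln (nrm (g k.+1 *m g k)) - ln (nrm (g k))))|
    <= n%:R * (4 / lam ^+ 2).
Proof.
move=> d1 lam4 h1 h2.
have lam0 : 0 < lam by apply: lt_le_trans lam4.
have gd (M : 'M[R]_2) : \det M = 1 -> 0 < nrm M.
  by move=> /nrm_det1_ge2; apply: lt_le_trans.
have Td k : \det (mprod g k) = 1.
  by elim: k => [|k IH] /=; rewrite ?det1// det_mulmx d1 IH mulr1.
have g0 k : 0 < nrm (g k) by exact: gd.
have gg0 k : 0 < nrm (g k.+1 *m g k) by apply: gd; rewrite det_mulmx !d1 mulr1.
have T0 k : 0 < nrm (mprod g k) by exact: gd.
have lam2 : 2 / lam ^+ 2 <= 2^-1 by rewrite ler_pdivrMr ?exprn_gt0//; nra.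
have step k : (k.+1 < n)%N -> lam / 2 * nrm (mprod g k.+1) <= nrm (mprod g k.+2) ->
    `|nrm (mprod g k.+3) * nrm (g k.+1) / (nrm (g k.+2 *m g k.+1) * nrm (mprod g k.+2)) - 1| <= 2 / lam ^+ 2.
  move=> kn IH; set D := nrm (g k.+2 *m g k.+1) * nrm (mprod g k.+2).
  have D0 : 0 < D by rewrite mulr_gt0.
  have := nrm_interlace (g k.+2) (g k.+1) (mprod g k.+1).
  rewrite d1 normr1 mul1r -mulmxA -/(mprod g k.+2) -/(mprod g k.+3) -/D => h.
  have -> : nrm (mprod g k.+3) * nrm (g k.+1) / D - 1 =
      (nrm (mprod g k.+3) * nrm (g k.+1) - D) / D by field; rewrite gt_eqF.
  rewrite normrM normfV (gtr0_norm D0) ler_pdivrMr//.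
  apply: le_trans h _; have := h2 _ kn.
  move: IH; rewrite /D; have := T0 k.+1; have := g0 k.+2.
  move: (nrm (mprod g k.+1)) (nrm (mprod g k.+2)) (nrm (g k.+2)) (nrm (_ *m _)) => t t' a b.
  move=> a0 t0 tt' ab.
  rewrite mulrAC ler_pdivlMr ?exprn_gt0//.
  apply: (@le_trans _ _ (2 * ((lam * a) * (lam / 2 * t)))); first by rewrite le_eqVlt; apply/orP; left; apply/eqP; field.
  by rewrite ler_pM2l//; apply: ler_pM => //; rewrite !mulr_ge0 ?invr_ge0// ltW.
(* Growth and [step] feed each other: growth makes the ratio in [step] at least 1/2, so of the next
   factor [lam] at least a half survives. *)
have grow k : (k < n)%N -> lam / 2 * nrm (mprod g k.+1) <= nrm (mprod g k.+2).
  elim: k => [|k IH] kn.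
    rewrite /= mulmx1; apply: le_trans (h1 _ kn); have := g0 0%N; nra.
  have := step _ kn (IH (ltnW kn)); set D := _ * nrm (mprod g k.+2).
  have D0 : 0 < D by rewrite mulr_gt0.
  rewrite ler_norml => /andP[h _].
  have {}h : 2^-1 <= nrm (mprod g k.+3) * nrm (g k.+1) / D by lra.
  move: h; rewrite ler_pdivlMr// /D; have := h1 _ kn; have := T0 k.+2; have := g0 k.+1.
  move: (nrm (mprod g k.+2)) (nrm (mprod g k.+3)) (nrm (g k.+1)) (nrm (_ *m _)) => t t' a b.
  by move=> a0 t0 ab h; nra.
elim: n h1 h2 step grow => [|n IH] h1 h2 step grow.
  by rewrite big_ord0 /= mulmx1 addr0 subrr normr0 mul0r.
have {}IH := IH (fun k kn => h1 k (ltnW kn)) (fun k kn => h2 k (ltnW kn))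
  (fun k kn => step k (ltnW kn)) (fun k kn => grow k (ltnW kn)).
rewrite big_ord_recr /=.
have last_step : `|ln (nrm (mprod g n.+2)) - ln (nrm (mprod g n.+1)) -
    (ln (nrm (g n.+1 *m g n)) - ln (nrm (g n)))| <= 4 / lam ^+ 2.
  (* The first step is an identity, the product being g_1 g_0. *)
  case: n {IH} h1 h2 step grow => [|n] h1 h2 step grow.
    by rewrite /= !mulmx1 subrr normr0 divr_ge0// exprn_ge0// ltW.
  have := step n (ltnSn _) (grow n (ltnW (ltnSn _))).
  set r := (X in `|X - 1| <= _) => r1.
  have r0 : 0 < r by rewrite divr_gt0 ?mulr_gt0.
  have -> : ln (nrm (mprod g n.+3)) - ln (nrm (mprod g n.+2)) -
    (ln (nrm (g n.+2 *m g n.+1)) - ln (nrm (g n.+1))) = ln r.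
    by rewrite /r ln_div ?posrE ?mulr_gt0// !lnM ?posrE//; ring.
  have -> : r = 1 + (r - 1) by ring.
  apply: le_trans (ln_near1 _) _; first exact: le_trans lam2.
  by lra.
rewrite -natr1 mulrDl mul1r.
move: IH last_step; set A := ln (nrm (mprod g n.+1)); rewrite -/(mprod g n.+2).
set B := ln (nrm (mprod g n.+2)); set S := \sum_(i < n) _.
move: (ln (nrm (g 0%N))) (ln _ - ln _) => u v.
have -> : B - (u + (S + v)) = (A - (u + S)) + (B - A - v) by ring.
by move=> a1 a2; apply: le_trans (ler_normD _ _) _; exact: lerD.
Qed.

End Avalanche.

(** * Algebra of the cocycle *)

Section Cocycle.
Variable R : realType.
Implicit Types (b t : R) (A B : R -> 'M[R]_2).

Lemma cocycleD b A m n t :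
  cocycle b A (m + n) t = cocycle b A m (t + n%:R * b) *m cocycle b A n t.
Proof.
elim: m => [|m IH] /=; first by rewrite mul1mx.
by rewrite IH mulmxA; congr (A _ *m _ *m _); rewrite natrD; ring.
Qed.

Lemma cocycle_mprod b A N n t :
  cocycle b A (n * N) t = mprod (fun k => cocycle b A N (t + (k * N)%:R * b)) n.
Proof. by elim: n => [//|n IH]; rewrite mulSn cocycleD IH. Qed.

Lemma det_cocycle b A N t : (forall x, \det (A x) = 1) -> \det (cocycle b A N t) = 1.
Proof.
by move=> dA; elim: N => [|N IH] /=; rewrite ?det1// det_mulmx dA IH mulr1.
Qed.

Lemma cocycle_period b A N t : periodic1 A -> cocycle b A N (t + 1) = cocycle b A N t.
Proof. by move=> pA; elim: N => [//|N IH] /=; rewrite IH addrAC pA. Qed.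

Lemma nrm_cocycle_le b A N t (C : R) : 1 <= C -> (forall x, nrm (A x) <= C) ->
  nrm (cocycle b A N t) <= 2 * C ^+ N.
Proof.
move=> C1 AC; elim: N => [|N IH] /=.
  by rewrite nrm2 !mxE /= normr1 normr0 expr0; lra.
apply: le_trans (nrmM _ _) _; rewrite exprS mulrCA.
by apply: ler_pM; rewrite ?nrm_ge0.
Qed.

End Cocycle.

(** * Fourier series in the Gevrey class *)

Section SymmetricSums.
Variable V : nmodType.

Definition symsum (F : int -> V) (N : nat) : V :=
  \sum_(0 <= m < N.*2.+1) F (m%:Z - N%:Z).

Lemma symsumS F N : symsum F N.+1 = symsum F N + (F N.+1%:Z + F (- N.+1%:Z)).
Proof.
rewrite /symsum doubleS big_nat_recr//= big_nat_recl//=.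
have -> : \sum_(0 <= i < N.*2.+1) F (i.+1%:Z - N.+1%:Z) = symsum F N.
  by apply: eq_bigr => i _; congr F; lia.
have -> : N.*2.+2%:Z - N.+1%:Z = N.+1%:Z :> int by lia.
have -> : 0%N%:Z - N.+1%:Z = - N.+1%:Z :> int by lia.
by rewrite addrAC addrC [F _ + F _]addrC addrC.
Qed.

Lemma symsum0 F : symsum F 0 = F 0.
Proof. by rewrite /symsum big_nat1 subr0. Qed.

End SymmetricSums.

Section FourierCoefficients.
Variable R : realType.
Implicit Types (c : int -> 'M[R[i]]_2) (f : R -> 'M[R]_2) (nu rho C t : R).

Definition cnrm m n (M : 'M[R[i]]_(m, n)) : R := l1norm (@normc R) M.
Definition cmx (M : 'M[R]_2) : 'M[R[i]]_2 := map_mx (real_complex R) M.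

Lemma cnrm_ge0 m n (M : 'M[R[i]]_(m, n)) : 0 <= cnrm M.
Proof. by apply: l1norm_ge0 => x; exact: normc_ge0. Qed.

Lemma cnrmD m n (M N : 'M[R[i]]_(m, n)) : cnrm (M + N) <= cnrm M + cnrm N.
Proof. by apply: l1normD => x y; exact: normcD. Qed.

Lemma cnrmM m n p (M : 'M[R[i]]_(m, n)) (N : 'M[R[i]]_(n, p)) : cnrm (M *m N) <= cnrm M * cnrm N.
Proof.
by apply: l1normM => [|x|x y|x y]; [exact: (@normc0 R)|exact: normc_ge0|exact: normcD|exact: normcM].
Qed.

Lemma cnrmZ m n (a : R[i]) (M : 'M[R[i]]_(m, n)) : cnrm (a *: M) = normc a * cnrm M.
Proof. by apply: l1normZ => x y; exact: normcM. Qed.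

Lemma cnrmN m n (M : 'M[R[i]]_(m, n)) : cnrm (- M) = cnrm M.
Proof. by rewrite -scaleN1r cnrmZ normcN normc1 mul1r. Qed.

Lemma cnrm_distC m n (M N : 'M[R[i]]_(m, n)) : cnrm (M - N) = cnrm (N - M).
Proof. by rewrite -cnrmN opprB. Qed.

Lemma cnrm_sum m n (I : Type) (s : seq I) (F : I -> 'M[R[i]]_(m, n)) :
  cnrm (\sum_(i <- s) F i) <= \sum_(i <- s) cnrm (F i).
Proof. by apply: l1norm_sum => [|x y]; [exact: (@normc0 R)|exact: normcD]. Qed.

Lemma cnrm_cmx M : cnrm (cmx M) = nrm M.
Proof.
by apply: eq_bigr => i _; apply: eq_bigr => j _; rewrite mxE normcR.
Qed.

Lemma entry_le_cnrm m n (M : 'M[R[i]]_(m, n)) i j : normc (M i j) <= cnrm M.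
Proof. by apply: entry_le_l1norm => x; exact: normc_ge0. Qed.

Definition weight nu rho (k : int) : R := expR (`|2 * pi * k%:~R| `^ nu * rho).

(** Finite partial sums replace the extended-real norm. The estimates use the Fourier series only
    through this bound and [represents], so any coefficients may be fed in, in particular those of a
    difference. *)
Definition coef_bound nu rho c C := forall N,
  symsum (fun k => cnrm (c k) * weight nu rho k) N <= C.

Definition fsum c t N : 'M[R[i]]_2 := symsum (fun k => cexp2pi k t *: c k) N.

Definition represents c f := forall t e, 0 < e ->
  exists K0 : nat, forall K, (K0 <= K)%N -> cnrm (fsum c t K - cmx (f t)) <= e.

Lemma cexp2piE k t : cexp2pi k t = circ (k%:~R * t) :> R[i].
Proof. by rewrite /cexp2pi /circ !mulrA. Qed.

Lemma weight_ge1 nu rho k : 0 <= rho -> 1 <= weight nu rho k.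
Proof. by move=> r0; rewrite -expR0 ler_expR mulr_ge0 ?powR_ge0. Qed.

Lemma weight_sym nu rho k : weight nu rho (- k) = weight nu rho k.
Proof. by rewrite /weight rmorphN mulrN normrN. Qed.

Section Bounds.
Variables (nu rho C : R) (c : int -> 'M[R[i]]_2).
Hypotheses (nu0 : 0 <= nu) (rho0 : 0 <= rho) (cC : coef_bound nu rho c C).

(** The weights increase with |k|, so beyond [K] a coefficient is at most its weighted value divided
    by the weight at [K]. *)
Lemma fsum_tail t K N : (K <= N)%N ->
  cnrm (fsum c t N - fsum c t K) <= (weight nu rho K)^-1 * C.
Proof.
move=> KN; pose W N := symsum (fun k => cnrm (c k) * weight nu rho k) N.
have W0 n : 0 <= W n.
  by rewrite /W /symsum sumr_ge0// => i _; rewrite mulr_ge0 ?cnrm_ge0 ?expR_ge0.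
have w0 : 0 < weight nu rho K by exact: expR_gt0.
suff h : cnrm (fsum c t N - fsum c t K) <= (weight nu rho K)^-1 * (W N - W K).
  apply: le_trans h _; rewrite ler_wpM2l ?invr_ge0 ?(ltW w0)//.
  by have := cC N; have := W0 K; rewrite -/(W N); lra.
elim: N KN => [|N IH].
  by rewrite leqn0 => /eqP ->; rewrite !subrr mulr0 /cnrm l1norm0 ?normc0.
rewrite leq_eqVlt => /predU1P[->|].
  by rewrite !subrr mulr0 /cnrm l1norm0 ?normc0.
rewrite ltnS => KN; rewrite /fsum /W !symsumS -/(fsum c t N) -/(W N).
rewrite -/(fsum c t K) -/(W K) [X in cnrm X]addrAC [X in _ * X]addrAC mulrDr.
apply: le_trans (cnrmD _ _) _; apply: lerD; first exact: IH.
apply: le_trans (cnrmD _ _) _; rewrite !cnrmZ !cexp2piE !normc_circ !mul1r.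
rewrite weight_sym -mulrDl mulrCA -[X in X <= _]mulr1 ler_wpM2l ?addr_ge0 ?cnrm_ge0//.
rewrite ler_pdivlMl// mulr1 ler_expR ler_wpM2r// ge0_ler_powR// ?nnegrE//.
rewrite !normrM ler_wpM2l ?mulr_ge0 ?normr_ge0//.
by rewrite !ger0_norm ?ler0z// ler_int; lia.
Qed.

Lemma fsum_le t N : cnrm (fsum c t N) <= C.
Proof.
apply: le_trans (cC N); rewrite /fsum /symsum; apply: le_trans (cnrm_sum _ _) _.
apply: ler_sum => i _; rewrite cnrmZ cexp2piE normc_circ mul1r.
by rewrite ler_peMr ?cnrm_ge0 ?weight_ge1.
Qed.

Variable f : R -> 'M[R]_2.
Hypothesis cf : represents c f.

Lemma represents_le t : nrm (f t) <= C.
Proof.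
apply/ler_addgt0Pr => e e0; have [K0 /(_ K0 (leqnn _))] := cf t e0.
rewrite cnrm_distC => h; rewrite -cnrm_cmx -[cmx _](subrK (fsum c t K0)).
apply: le_trans (cnrmD _ _) _; rewrite addrC; apply: lerD => //; exact: fsum_le.
Qed.

Lemma truncation t K : cnrm (fsum c t K - cmx (f t)) <= (weight nu rho K)^-1 * C.
Proof.
apply/ler_addgt0Pr => e e0; have [K0 h] := cf t e0.
have {}h := h (maxn K0 K) (leq_maxl _ _).
have -> : fsum c t K - cmx (f t) = (fsum c t (maxn K0 K) - cmx (f t)) -
   (fsum c t (maxn K0 K) - fsum c t K) by apply/matrixP => i j; rewrite !mxE; ring.
apply: le_trans (cnrmD _ _) _; rewrite cnrmN addrC; apply: lerD => //.
exact: fsum_tail (leq_maxr _ _).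
Qed.

End Bounds.

Definition mucont f := forall e, 0 < e -> exists2 d, 0 < d &
  forall x y, `|x - y| <= d -> nrm (f x - f y) <= e.

Lemma mucont_entry f i j : mucont f -> ucont (fun t => f t i j).
Proof.
move=> uf e /uf[d d0 h]; exists d => // x y /h; apply: le_trans.
have -> : f x i j - f y i j = (f x - f y) i j by rewrite !mxE.
by apply: entry_le_l1norm => z; exact: normr_ge0.
Qed.

Lemma weight_unbounded nu rho (A : R) : 0 < nu -> 0 < rho ->
  exists K : nat, A <= weight nu rho K.
Proof.
move=> nu0 rho0.
pose B := (`|A| / rho) `^ nu^-1.
exists (Num.truncn B).+1.
have B0 : 0 <= B by exact: powR_ge0.
have /andP[_ /ltW h] := truncn_itv B0.
have A0 : 0 <= `|A| / rho by rewrite divr_ge0// ltW.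
have h1 : `|A| / rho <= `|2 * pi * (Num.truncn B).+1%:R| `^ nu.
  have -> : `|A| / rho = B `^ nu by rewrite /B -powRrM mulVf ?gt_eqF// powRr1.
  apply: ge0_ler_powR; rewrite ?nnegrE//; first exact: ltW.
  apply: le_trans h _.
  have pi2 := pi_ge2 R.
  by rewrite ger0_norm ?mulr_ge0 ?pi_ge0// ler_peMl//; lra.
apply: le_trans (ler_norm _) _; rewrite ler_pdivrMr// in h1.
apply: le_trans (expR_ge1Dx _); rewrite -pmulrn; lra.
Qed.

(** The truncation error at a large [K] is at most e / 4 at every point, and the truncated series is
    Lipschitz. *)
Lemma represents_mucont nu rho c C f : 0 < nu -> 0 < rho ->
  coef_bound nu rho c C -> represents c f -> mucont f.
Proof.
move=> nu0 rho0 cC cf e e0.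
have C0 : 0 <= C by apply: le_trans (cC 0%N); rewrite symsum0 mulr_ge0 ?cnrm_ge0 ?expR_ge0.
have [K hK] := weight_unbounded (4 * C / e) nu0 rho0.
have w0 : 0 < weight nu rho K by exact: expR_gt0.
have tail t : cnrm (fsum c t K - cmx (f t)) <= e / 4.
  apply: le_trans (truncation (ltW nu0) (ltW rho0) cC cf t K) _.
  by rewrite mulrC ler_pdivrMr//; move: hK; rewrite ler_pdivrMr//; lra.
pose S := symsum (fun k => `|k%:~R| * cnrm (c k)) K.
have S0 : 0 <= S by rewrite /S /symsum sumr_ge0// => i _; rewrite mulr_ge0 ?cnrm_ge0.
have lip x y : cnrm (fsum c x K - fsum c y K) <= 16 * S * `|x - y|.
  rewrite /fsum /symsum -sumrB; apply: le_trans (cnrm_sum _ _) _.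
  rewrite /S /symsum mulr_sumr mulr_suml; apply: ler_sum => i _.
  rewrite -scalerBl cnrmZ !cexp2piE.
  apply: le_trans (ler_wpM2r (cnrm_ge0 _) (normc_circB _ _)) _.
  by rewrite -mulrBr normrM le_eqVlt; apply/orP; left; apply/eqP; ring.
exists (e / (2 * (16 * S + 1))).
  by rewrite divr_gt0// mulr_gt0// ltr_wpDl// mulr_ge0.
move=> x y xy; rewrite -cnrm_cmx.
have -> : cmx (f x - f y) = (fsum c x K - fsum c y K) - (fsum c x K - cmx (f x))
    + (fsum c y K - cmx (f y)).
  by apply/matrixP => i j; rewrite /cmx !mxE rmorphB /=; ring.
apply: le_trans (cnrmD _ _) _; apply: le_trans (lerD (cnrmD _ _) (lexx _)) _.
rewrite cnrmN; have := tail x; have := tail y; have := lip x y.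
move: (cnrm _) (cnrm _) (cnrm _) => u v w h1 h2 h3.
suff : 16 * S * `|x - y| <= e / 2 by lra.
move: xy; rewrite ler_pdivlMr; last by rewrite mulr_gt0// ltr_wpDl// mulr_ge0.
have := normr_ge0 (x - y); nra.
Qed.

Lemma coef_boundD nu rho c c' C C' : 0 <= rho -> coef_bound nu rho c C ->
  coef_bound nu rho c' C' -> coef_bound nu rho (fun k => c k + c' k) (C + C').
Proof.
move=> r0 h h' N; apply: le_trans (lerD (h N) (h' N)).
rewrite /symsum -big_split /=; apply: ler_sum => i _.
by rewrite -mulrDl ler_wpM2r ?expR_ge0// cnrmD.
Qed.

Lemma representsB c c' f f' : represents c f -> represents c' f' ->
  represents (fun k => c k - c' k) (fun t => f t - f' t).
Proof.
move=> h h' t e e0; have e2 : 0 < e / 2 by rewrite divr_gt0.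
have [K1 h1] := h t _ e2; have [K2 h2] := h' t _ e2.
exists (maxn K1 K2) => K; rewrite geq_max => /andP[/h1 {}h1 /h2 {}h2].
have -> : fsum (fun k => c k - c' k) t K = fsum c t K - fsum c' t K.
  by rewrite /fsum /symsum -sumrB; apply: eq_bigr => i _; rewrite scalerBr.
have -> : fsum c t K - fsum c' t K - cmx (f t - f' t) =
    (fsum c t K - cmx (f t)) - (fsum c' t K - cmx (f' t)).
  by apply/matrixP => i j; rewrite /cmx !mxE rmorphB /=; ring.
by apply: le_trans (cnrmD _ _) _; rewrite cnrmN; lra.
Qed.

End FourierCoefficients.

(** * From the Gevrey norm to bounds on Fourier coefficients *)

Section FromGevrey.
Variable R : realType.
Implicit Types (f g : R -> 'M[R]_2) (nu rho t : R).

(** The factor 4 is the cost of passing from the operator norm to the entrywise norm of 2 by 2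
    matrices. *)
Lemma gevrey_coef_bound nu rho f C : (gevrey_norm nu rho f <= C%:E)%E ->
  coef_bound nu rho (fourier_coef f) (4 * C).
Proof.
move=> fC N; pose op := op_norm (@normc R).
apply: (@le_trans _ _ (symsum (fun k => 4 * (op _ (fourier_coef f k) * weight nu rho k)) N)).
  rewrite /symsum; apply: ler_sum => i _; rewrite mulrA ler_wpM2r ?expR_ge0//.
  by apply: l1norm_le_op => [||x|x y|x y];
    [exact: (@normc0 R)|exact: (@normc1 R)|exact: normc_ge0|exact: normcD|exact: normcM].
rewrite /symsum -mulr_sumr ler_pM2l// -lee_fin; apply: le_trans fC.
pose r := [seq m%:Z - N%:Z | m <- index_iota 0 N.*2.+1].
apply: esum_ge; exists [set` r]; first by split=> //; exact: finite_seq.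
rewrite -fsbig_seq; last by rewrite map_inj_uniq ?iota_uniq// => x y; lia.
by rewrite big_map /= -sumEFin.
Qed.

Lemma gevrey_represents nu rho f : gevrey nu rho f -> represents (fourier_coef f) f.
Proof.
move=> [_ _ h] t e e0.
have e4 : 0 < e / 4 by rewrite divr_gt0.
have /cvgrPdist_le/(_ _ e4) [K0 _ hK] := h t; exists K0 => K /hK.
rewrite sub0r normrN => hh.
have := @l1norm_le_op R _ (@normc R) (@normc0 R) (@normc1 R) (@normc_ge0 R) (@normcD R)
  (@normcM R) _ (fsum (fourier_coef f) t K - cmx (f t)).
rewrite -/(cnrm _) => h2; apply: le_trans h2 _.
by move: hh; rewrite /fourier_partial => /(le_trans (ler_norm _)); rewrite /fsum /symsum /cmx; lra.
Qed.

(** Continuity supplies the integrability needed for the linearity of the integral. Through this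
    identity the norm of A_n - A controls the difference of the coefficients. *)
Lemma fourier_coefB f g k : mucont f -> mucont g ->
  fourier_coef (fun t => f t - g t) k = fourier_coef f k - fourier_coef g k.
Proof.
move=> uf ug; apply/matrixP => i j; rewrite !mxE.
have int (u : R -> R) : continuous u -> mu.-integrable `[0, 1] (EFin \o u).
  move=> cu; apply: continuous_compact_integrable; first exact: segment_compact.
  exact: continuous_subspaceT.
have cc : continuous (fun t : R => cos (2 * pi * k%:~R * t)).
  by move=> x; apply: continuous_comp; [exact: mulrl_continuous|exact: continuous_cos].
have cs : continuous (fun t : R => sin (2 * pi * k%:~R * t)).
  by move=> x; apply: continuous_comp; [exact: mulrl_continuous|exact: continuous_sin].
have cm (u : R -> 'M[R]_2) (h : R -> R) : mucont u -> continuous h ->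
    continuous (fun t => u t i j * h t).
  move=> uu ch x; apply: cvgM; last exact: ch.
  exact: (ucont_continuous (mucont_entry i j uu)).
have key (h : R -> R) : continuous h ->
    \int[mu]_(t in `[0, 1]) ((f t - g t) i j * h t) =
    \int[mu]_(t in `[0, 1]) (f t i j * h t) - \int[mu]_(t in `[0, 1]) (g t i j * h t).
  move=> ch; rewrite -RintegralB//; [|exact/int/cm|exact/int/cm].
  by apply: eq_Rintegral => x _; rewrite !mxE mulrBl.
rewrite !key//; apply/eqP; rewrite eq_complex /=; apply/andP; split; apply/eqP => //.
by rewrite opprB addrC opprK.
Qed.

End FromGevrey.

(** * Large deviations at a finite scale *)

Section TruncatedCocycle.
Variable R : realType.
Variables (c : int -> 'M[R[i]]_2) (b : R) (K : nat).
Implicit Types (t : R) (z : R[i]) (N k : nat).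

(** At z = e(t) this is (z e(k b))^K times the truncated series at t + k b; the power clears the
    negative frequencies and has modulus 1 on the circle. *)
Definition shiftpoly k : 'M[{poly R[i]}]_2 := \matrix_(i, j)
  \poly_(m < K.*2.+1) (c (m%:Z - K%:Z) i j * circ (k%:R * b) ^+ m).

Fixpoint polycocycle N : 'M[{poly R[i]}]_2 :=
  if N is N'.+1 then shiftpoly N' *m polycocycle N' else 1%:M.

Fixpoint trcocycle N t : 'M[R[i]]_2 :=
  if N is N'.+1 then fsum c (t + N'%:R * b) K *m trcocycle N' t else 1%:M.

(** Squares of entries, not of their moduli, so that the result is a polynomial. As the true cocycle
    is real, its sum of squares is a squared Hilbert-Schmidt norm, which truncation changes
    little. *)
Definition normpoly N : {poly R[i]} := \sum_i \sum_j polycocycle N i j ^+ 2.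

Definition evmx z (M : 'M[{poly R[i]}]_2) : 'M[R[i]]_2 := map_mx (horner_eval z) M.

Lemma evmxM z M M' : evmx z (M *m M') = evmx z M *m evmx z M'.
Proof. exact: map_mxM. Qed.

Lemma evmx_shiftpoly z k : evmx z (shiftpoly k) =
  \sum_(0 <= m < K.*2.+1) (z * circ (k%:R * b)) ^+ m *: c (m%:Z - K%:Z).
Proof.
apply/matrixP => i j; rewrite !mxE /horner_eval horner_poly summxE big_mkord.
by apply: eq_bigr => m _; rewrite mxE exprMn; ring.
Qed.

Lemma evmx_polycocycle N t : exists2 u : R[i], normc u = 1 &
  evmx (circ t) (polycocycle N) = u *: trcocycle N t.
Proof.
elim: N => [|N [u u1 IH]].
  by exists 1; [exact: (@normc1 R)|rewrite scale1r /evmx map_mx1].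
exists (circ (t + N%:R * b) ^+ K * u).
  by rewrite normcM normcX normc_circ expr1n u1 mul1r.
have FE : evmx (circ t) (shiftpoly N) =
    circ (t + N%:R * b) ^+ K *: fsum c (t + N%:R * b) K.
  rewrite evmx_shiftpoly /fsum /symsum scaler_sumr.
  apply: eq_bigr => m _; rewrite scalerA; congr (_ *: _).
  rewrite -circD cexp2piE -!circMn -circD; congr circ.
  by rewrite rmorphB /= -!pmulrn; ring.
by rewrite /= evmxM IH FE -scalemxAl -scalemxAr scalerA.
Qed.

Lemma size_polycocycle N i j : (size (polycocycle N i j) <= (K * N).*2.+1)%N.
Proof.
elim: N i j => [|N IH] i j /=.
  by rewrite mxE muln0; case: (i == j); rewrite ?size_poly1 ?size_poly0.
rewrite mxE; apply: leq_trans (size_sum _ _ _) _; apply/bigmax_leqP => k _.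
apply: leq_trans (size_polyMleq _ _) _.
have h1 : (size (shiftpoly N i k) <= K.*2.+1)%N by rewrite mxE size_poly.
have h2 := IH k j; apply: (@leq_trans (K.*2.+1 + (K * N).*2.+1).-1).
  by rewrite -!subn1 leq_sub2r// leq_add.
by rewrite mulnS; lia.
Qed.

Lemma size_normpoly N : (size (normpoly N) <= (4 * (K * N)).+1)%N.
Proof.
apply: leq_trans (size_sum _ _ _) _; apply/bigmax_leqP => i _.
apply: leq_trans (size_sum _ _ _) _; apply/bigmax_leqP => j _.
rewrite expr2; apply: leq_trans (size_polyMleq _ _) _.
by have := size_polycocycle N i j; lia.
Qed.

Lemma normc_normpoly z N : normc (normpoly N).[z] <= cnrm (evmx z (polycocycle N)) ^+ 2.
Proof.
rewrite /normpoly horner_sum expr2 {1}/cnrm /l1norm mulr_suml.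
apply: le_trans (normc_sum _ _ _) _; apply: ler_sum => i _.
rewrite horner_sum mulr_suml; apply: le_trans (normc_sum _ _ _) _; apply: ler_sum => j _.
rewrite horner_exp expr2 normcM.
have -> : normc (polycocycle N i j).[z] = normc (evmx z (polycocycle N) i j) by rewrite mxE.
by rewrite ler_wpM2l ?normc_ge0// entry_le_cnrm.
Qed.

Variables (nu rho C l : R) (f : R -> 'M[R]_2).
Hypotheses (nu0 : 0 <= nu) (rho0 : 0 <= rho) (cC : coef_bound nu rho c C) (C1 : 1 <= C).
Hypothesis (cf : represents c f).
Hypothesis kl : forall k : nat, (k <= K)%N -> k%:R * l <= `|2 * pi * k%:R| `^ nu * rho.
Hypothesis l0 : 0 <= l.

Let cnrm1 : cnrm (1%:M : 'M[R[i]]_2) = 2.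
Proof.
have -> : (1%:M : 'M[R[i]]_2) = cmx 1%:M by rewrite /cmx map_mx1.
by rewrite cnrm_cmx nrm2 !mxE /= normr1 normr0; ring.
Qed.

(** On these circles the mode k grows by at most e^(|k| l), which [kl] bounds by the Gevrey weight
    for |k| <= K; the prefactor |z|^K comes from clearing negative powers. *)
Lemma cnrm_evmx_shiftpoly z k : normc z = expR l \/ normc z = expR (- l) ->
  cnrm (evmx z (shiftpoly k)) <= expR (K%:R * ln (normc z)) * C.
Proof.
move=> zl; rewrite evmx_shiftpoly; apply: le_trans (cnrm_sum _ _) _.
apply: le_trans (ler_wpM2l (expR_ge0 _) (cC K)).
rewrite /symsum mulr_sumr; rewrite !big_mkord; apply: ler_sum => m _.
rewrite cnrmZ normcX normcM normc_circ mulr1 mulrCA mulrC ler_wpM2l ?cnrm_ge0//.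
have zE : normc z = expR (ln (normc z)).
  by case: zl => ->; rewrite expRK.
rewrite {1}zE -expRM_natl -expRD ler_expR.
set x := ln _ in zE *.
have xl : `|x| <= l.
  by case: zl; rewrite /x => ->; rewrite expRK ?normrN ger0_norm.
have -> : m%:R = K%:R + (m%:Z - K%:Z)%:~R :> R by rewrite rmorphB /= -!pmulrn; ring.
rewrite mulrDl lerD2l.
have [k' k'K kE] : exists2 k' : nat, (k' <= K)%N & `|m%:Z - K%:Z| = k'%:Z.
  by exists `|m%:Z - K%:Z|%N; [have := ltn_ord m; lia|rewrite abszE].
apply: le_trans (ler_norm _) _; rewrite normrM -intr_norm kE -pmulrn.
apply: le_trans (ler_wpM2l _ xl) _ => //; apply: le_trans (kl k'K) _.
rewrite ler_wpM2r// le_eqVlt; apply/orP; left; apply/eqP; congr (_ `^ _).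
rewrite normrM [RHS]normrM; congr (_ * _).
by rewrite -intr_norm kE -pmulrn normr_nat.
Qed.

Lemma normpoly_circles N z : normc z = expR l \/ normc z = expR (- l) ->
  normc (normpoly N).[z] <= expR ((K * N).*2%:R * ln (normc z) + 2 * (N%:R * ln C + 1)).
Proof.
move=> zl; have C0 : 0 < C by apply: lt_le_trans C1.
have h : cnrm (evmx z (polycocycle N)) <= 2 * (expR (K%:R * ln (normc z)) * C) ^+ N.
  elim: N => [|N IH] /=; first by rewrite /evmx map_mx1 cnrm1 expr0 mulr1.
  rewrite evmxM; apply: le_trans (cnrmM _ _) _; rewrite exprS mulrCA.
  by apply: ler_pM; rewrite ?cnrm_ge0//; exact: cnrm_evmx_shiftpoly.
apply: le_trans (normc_normpoly _ _) _.
set x := ln _ in h *.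
have e1 : 2 <= expR 1 :> R by have := @expR_ge1Dx R 1; lra.
have -> : expR ((K * N).*2%:R * x + 2 * (N%:R * ln C + 1)) =
    (expR 1 * (expR (K%:R * x) * C) ^+ N) ^+ 2.
  have CE : C = expR (ln C) by rewrite lnK ?posrE.
  rewrite [in RHS]CE -expRD -expRM_natl -expRD -expRM_natl; congr expR.
  by rewrite -muln2 !natrM; ring.
apply: lerXn2r; rewrite ?nnegrE ?cnrm_ge0//.
  by rewrite mulr_ge0 ?exprn_ge0 ?mulr_ge0 ?expR_ge0// ltW.
by apply: le_trans h _; rewrite ler_wpM2r// exprn_ge0// mulr_ge0 ?expR_ge0// ltW.
Qed.

Lemma trcocycle_near N t :
  cnrm (trcocycle N t - cmx (cocycle b f N t)) <= 2 * N%:R * C ^+ N.+1 * (weight nu rho K)^-1.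
Proof.
have C0 : 0 < C by apply: lt_le_trans C1.
have w0 : 0 < (weight nu rho K)^-1 by rewrite invr_gt0 expR_gt0.
have tr x : cnrm (trcocycle x t) <= 2 * C ^+ x.
  elim: x => [|x IH] /=; first by rewrite cnrm1 expr0 mulr1.
  apply: le_trans (cnrmM _ _) _; rewrite exprS mulrCA.
  by apply: ler_pM; rewrite ?cnrm_ge0//; exact: (fsum_le rho0 cC).
elim: N => [|N IH] /=.
  rewrite /cmx map_mx1 subrr /cnrm l1norm0; last exact: (@normc0 R).
  by rewrite mulr0 !mul0r.
set S := fsum _ _ _; set A := f _; set T := trcocycle _ _; set D := cocycle _ _ _ _.
have -> : S *m T - cmx (A *m D) = (S - cmx A) *m T + cmx A *m (T - cmx D).
  by rewrite mulmxBl mulmxBr addrA subrK /cmx map_mxM.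
apply: le_trans (cnrmD _ _) _.
have h1 : cnrm ((S - cmx A) *m T) <= (weight nu rho K)^-1 * C * (2 * C ^+ N).
  apply: le_trans (cnrmM _ _) _; apply: ler_pM; rewrite ?cnrm_ge0//.
    exact: (truncation nu0 rho0 cC cf).
  exact: tr.
have h2 : cnrm (cmx A *m (T - cmx D)) <= C * (2 * N%:R * C ^+ N.+1 * (weight nu rho K)^-1).
  apply: le_trans (cnrmM _ _) _; apply: ler_pM; rewrite ?cnrm_ge0//.
  by rewrite cnrm_cmx; exact: (represents_le rho0 cC cf).
apply: le_trans (lerD h1 h2) _.
rewrite -[N.+1%:R]natr1 !exprS; move: w0; set w := _^-1; set CN := C ^+ N => w0.
have CN0 : 0 <= CN by rewrite exprn_ge0// ltW.
have -> : w * C * (2 * CN) + C * (2 * N%:R * (C * CN) * w) =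
  2 * w * (C * CN) * (1 + N%:R * C) by ring.
have -> : 2 * (N%:R + 1) * (C * (C * CN)) * w = 2 * w * (C * CN) * (C + N%:R * C) by ring.
by rewrite ler_wpM2l ?lerD2r// !mulr_ge0// ltW.
Qed.

Hypothesis det1f : forall x, \det (f x) = 1.

(** With n the entrywise norm, the sum of squares of the true entries is at least 2 and lies between
    n^2 / 4 and n^2; a truncation error of 1/32 keeps |P| above 1 and between n^2 / 16 and 2 n^2.
    The lower bound 1 will exclude roots on the circle. *)
Lemma ln_normpoly_near N t : 2 * N%:R * C ^+ N.+1 * (weight nu rho K)^-1 <= 32^-1 ->
  [/\ 1 <= normc (normpoly N).[circ t] &
   `|ln (normc (normpoly N).[circ t]) - 2 * ln (nrm (cocycle b f N t))| <= 5].
Proof.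
move=> small; set D := cocycle b f N t.
have dD : \det D = 1 by exact: det_cocycle.
set n := nrm D; have n2 : 2 <= n by exact: nrm_det1_ge2.
have [u u1 eu] := evmx_polycocycle N t.
set T := trcocycle N t in eu.
have dT : cnrm (T - cmx D) <= 32^-1 by apply: le_trans (trcocycle_near N t) small.
pose S := \sum_i \sum_j D i j ^+ 2.
have PE : normc (normpoly N).[circ t] = normc (\sum_i \sum_j T i j ^+ 2).
  rewrite -[RHS]mul1r -[1](expr1n R 2) -u1 -normcX -normcM; congr normc.
  rewrite /normpoly horner_sum mulr_sumr; apply: eq_bigr => i _.
  rewrite horner_sum mulr_sumr; apply: eq_bigr => j _.
  have := congr1 (fun M : 'M[R[i]]_2 => M i j) eu; rewrite !mxE /horner_eval => h.
  by rewrite horner_exp h exprMn.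
have SE : \sum_i \sum_j T i j ^+ 2 - S%:C = \sum_i \sum_j ((T - cmx D) i j * ((T - cmx D) i j + 2%:R * (D i j)%:C)).
  rewrite /S rmorph_sum -sumrB; apply: eq_bigr => i _.
  by rewrite rmorph_sum -sumrB; apply: eq_bigr => j _; rewrite /cmx !mxE rmorphXn /=; ring.
have De i j : normc (D i j)%:C <= n.
  by rewrite normcR; apply: entry_le_l1norm => x; exact: normr_ge0.
have dS : normc (\sum_i \sum_j T i j ^+ 2 - S%:C) <= 32^-1 * (32^-1 + 2 * n).
  rewrite SE; apply: le_trans (normc_sum _ _ _) _.
  apply: (@le_trans _ _ (cnrm (T - cmx D) * (32^-1 + 2 * n))); last first.
    by rewrite ler_wpM2r//; lra.
  rewrite /cnrm /l1norm mulr_suml; apply: ler_sum => i _; rewrite mulr_suml.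
  apply: le_trans (normc_sum _ _ _) _; apply: ler_sum => j _.
  rewrite normcM ler_wpM2l ?normc_ge0//; apply: le_trans (normcD _ _) _; apply: lerD.
    exact: le_trans (entry_le_cnrm _ _ _) dT.
  by rewrite normcM normc_nat ler_wpM2l.
have [S1 S2 S3] : [/\ 2 <= S, S <= n ^+ 2 & n ^+ 2 <= 4 * S].
  rewrite /S /n nrm2 !sum2; move: dD; rewrite det2.
  move: (D 0 0) (D 0 1) (D 1 0) (D 1 1) => a a1 a2 a3 h.
  have sq (x : R) : x ^+ 2 = `|x| ^+ 2 by rewrite real_normK ?num_real.
  rewrite (sq a) (sq a1) (sq a2) (sq a3).
  have h1 : 1 <= `|a| * `|a3| + `|a1| * `|a2|.
    by rewrite -!normrM -(normr1 R) -h ler_normB.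
  move: h1 (normr_ge0 a) (normr_ge0 a1) (normr_ge0 a2) (normr_ge0 a3).
  clear h sq; move: `|a| `|a1| `|a2| `|a3| => {}a {}a1 {}a2 {}a3 h1 a0 a10 a20 a30.
  split; first by have := sqr_ge0 (a - a3); have := sqr_ge0 (a1 - a2); nra.
    have := mulr_ge0 a0 a10; have := mulr_ge0 a0 a20; have := mulr_ge0 a0 a30.
    by have := mulr_ge0 a10 a20; have := mulr_ge0 a10 a30; have := mulr_ge0 a20 a30; nra.
  by have := sqr_ge0 (a - a3); have := sqr_ge0 (a1 - a2); have := sqr_ge0 (a - a1);
     have := sqr_ge0 (a - a2); have := sqr_ge0 (a1 - a3); have := sqr_ge0 (a2 - a3); nra.
have S0 : 0 <= S by lra.
set P := normc _ in PE *.
have P1 : P <= S + 32^-1 * (32^-1 + 2 * n).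
  rewrite PE -[\sum_i _](subrK S%:C); apply: le_trans (normcD _ _) _.
  by rewrite addrC normcR (ger0_norm S0) lerD2l.
have P2 : S - 32^-1 * (32^-1 + 2 * n) <= P.
  have : normc S%:C - normc (S%:C - \sum_i \sum_j T i j ^+ 2) <= P.
    rewrite PE; apply: le_trans (normcBl _ _) _; rewrite opprB addrC subrK//.
  by rewrite normc_distC normcR (ger0_norm S0); lra.
have Q1 : n ^+ 2 / 16 <= P by nra.
have Q2 : P <= 2 * n ^+ 2 by nra.
split; first by nra.
have P0 : 0 < P by nra.
have n20 : 0 < n ^+ 2 by nra.
have -> : 2 * ln n = ln (n ^+ 2) by rewrite lnXn ?mulr_natl//; lra.
rewrite -ln_div ?posrE//.
have r0 : 0 < P / n ^+ 2 by rewrite divr_gt0.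
rewrite ler_norml; apply/andP; split; last first.
  have -> : P / n ^+ 2 = 1 + (P / n ^+ 2 - 1) by ring.
  apply: le_trans (le_ln1Dx _) _; first lra.
  suff : P / n ^+ 2 <= 2 by lra.
  by rewrite ler_pdivrMr.
rewrite lerNl -lnV ?posrE//.
apply: (@le_trans _ _ (ln 16)).
  rewrite ler_ln ?posrE ?invr_gt0//; rewrite invf_ple ?posrE// ler_pdivlMr//; lra.
have -> : ln 16 = 4 * ln 2 :> R.
  have -> : 16 = 2 ^+ 4 :> R by ring.
  by rewrite lnXn// mulr_natl.
have := @le_ln1Dx R 1; have -> : 1 + 1 = 2 :> R by ring.
by move=> h; have := h ltac:(lra); lra.
Qed.

End TruncatedCocycle.

(** * The function ln |A_N|: continuity, almost invariance and deviations *)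

Section FiniteScale.
Variable R : realType.
Implicit Types (f : R -> 'M[R]_2) (b t : R).

Lemma nrmN (M : 'M[R]_2) : nrm (- M) = nrm M.
Proof. by rewrite !nrm2 !mxE !normrN. Qed.

Lemma nrmBl (M N : 'M[R]_2) : nrm M - nrm N <= nrm (M - N).
Proof. by rewrite lerBlDr -{1}(subrK N M) nrmD. Qed.

Lemma mucont_cocycle f b (C : R) N : mucont f -> (forall x, nrm (f x) <= C) -> 1 <= C ->
  mucont (cocycle b f N).
Proof.
move=> uf fC C1; have C0 : 0 < C by apply: lt_le_trans C1.
elim: N => [|N IH] e e0.
  by exists 1 => // x y _ /=; rewrite subrr nrm2 !mxE normr0 !addr0 ltW.
have k0 : 0 < 2 * C ^+ N by rewrite mulr_gt0// exprn_gt0.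
have [d1 d10 h1] := uf (e / 2 / (2 * C ^+ N)) ltac:(by rewrite !divr_gt0).
have [d2 d20 h2] := IH (e / 2 / C) ltac:(by rewrite !divr_gt0).
exists (Num.min d1 d2); first by rewrite lt_min d10.
move=> x y; rewrite le_min => /andP[xy1 /h2 {}h2] /=.
set A := f _; set T := cocycle _ _ _ _ in h2 *; set B := f _; set S := cocycle _ _ _ y in h2 *.
have -> : A *m T - B *m S = (A - B) *m T + B *m (T - S).
  by rewrite mulmxBl mulmxBr addrA subrK.
apply: le_trans (nrmD _ _) _; rewrite (splitr e); apply: lerD.
  apply: le_trans (nrmM _ _) _.
  have h3 : nrm (A - B) <= e / 2 / (2 * C ^+ N).
    by apply: h1; have -> : x + N%:R * b - (y + N%:R * b) = x - y by ring.
  apply: (@le_trans _ _ (e / 2 / (2 * C ^+ N) * (2 * C ^+ N))); last by rewrite divfK ?gt_eqF.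
  by apply: ler_pM; rewrite ?nrm_ge0//; exact: nrm_cocycle_le.
apply: le_trans (nrmM _ _) _.
apply: (@le_trans _ _ (C * (e / 2 / C))); last by rewrite mulrC divfK ?gt_eqF.
by apply: ler_pM; rewrite ?nrm_ge0//; exact: fC.
Qed.

Definition lncoc b f N t : R := ln (nrm (cocycle b f N t)).

Section Basic.
Variables (f : R -> 'M[R]_2) (b C : R).
Hypotheses (uf : mucont f) (fC : forall x, nrm (f x) <= C) (C1 : 1 <= C)
  (det1f : forall x, \det (f x) = 1) (pf : periodic1 f).

Let C0 : 0 < C. Proof. by apply: lt_le_trans C1. Qed.

Lemma nrm_cocycle_ge2 N t : 2 <= nrm (cocycle b f N t).
Proof. by apply: nrm_det1_ge2; exact: det_cocycle. Qed.

Lemma ucont_lncoc N : ucont (lncoc b f N).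
Proof.
apply: (@ucont_ln _ _ 2) => //; first exact: nrm_cocycle_ge2.
move=> e e0; have [d d0 h] := mucont_cocycle b N uf fC C1 e0; exists d => // x y /h.
apply: le_trans; rewrite ler_norml nrmBl andbT lerNl opprB.
by apply: le_trans (nrmBl _ _) _; rewrite -opprB nrmN.
Qed.

Lemma lncoc_period N : periodic1 (lncoc b f N).
Proof. by move=> t; rewrite /lncoc cocycle_period. Qed.

Lemma lncoc_ge0 N t : 0 <= lncoc b f N t.
Proof. by rewrite ln_ge0//; apply: le_trans (nrm_cocycle_ge2 N t); lra. Qed.

Lemma lncoc_le N t : lncoc b f N t <= 1 + N%:R * ln C.
Proof.
have n2 := nrm_cocycle_ge2 N t.
apply: (@le_trans _ _ (ln (2 * C ^+ N))).
  by rewrite ler_ln ?posrE ?mulr_gt0 ?exprn_gt0 ?nrm_cocycle_le//; lra.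
rewrite lnM ?posrE ?exprn_gt0// lnXn// -[ln C *+ N]mulr_natl lerD2r.
by have := @le_ln1Dx R 1; rewrite -[1 + 1]/(2); apply; lra.
Qed.

Lemma lncocD M N t : lncoc b f (M + N) t <= lncoc b f M (t + N%:R * b) + lncoc b f N t.
Proof.
have h1 := nrm_cocycle_ge2 M (t + N%:R * b); have h2 := nrm_cocycle_ge2 N t.
have h3 := nrm_cocycle_ge2 (M + N) t.
rewrite /lncoc -lnM ?posrE; [|lra|lra]; rewrite ler_ln ?posrE; [|lra|nra].
by rewrite cocycleD nrmM.
Qed.

(** The adjugate permutes the entries up to sign. In determinant 1 it is the inverse, so inverses
    have the same norm. *)
Lemma nrm_adj (M : 'M[R]_2) : nrm (\adj M) = nrm M.
Proof.
rewrite !nrm2 !mxE /cofactor !det_mx11 !mxE !normrM !normrX !normrN1 !expr1n !mul1r.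
have i0 : lift 1 0 = 0 :> 'I_2 by exact: val_inj.
have i1 : lift 0 0 = 1 :> 'I_2 by exact: val_inj.
by rewrite !i0 !i1; ring.
Qed.

Lemma adj_det1 (M : 'M[R]_2) : \det M = 1 -> M *m \adj M = 1%:M /\ \adj M *m M = 1%:M.
Proof. by move=> d1; rewrite mul_mx_adj mul_adj_mx d1. Qed.

(** The products based at t and t + b differ by one factor [f] at each end, so the bound is
    independent of [N]. *)
Lemma lncoc_shift N t : `|lncoc b f N (t + b) - lncoc b f N t| <= 2 * ln C.
Proof.
have e1 : cocycle b f N (t + b) *m f t = f (t + N%:R * b) *m cocycle b f N t.
  have := cocycleD b f N 1 t; have := cocycleD b f 1 N t.
  rewrite addnC /= !mul0r !addr0 !mulmx1 !mul1r => h1 h2.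
  by rewrite -h2 h1.
have [a1 a2] := adj_det1 (det1f t); have [a3 a4] := adj_det1 (det1f (t + N%:R * b)).
have n0 x : 0 < nrm (cocycle b f N x) by apply: lt_le_trans (nrm_cocycle_ge2 N x).
have key x y : nrm x <= C * C * nrm y -> 0 < nrm x -> 0 < nrm y -> ln (nrm x) - ln (nrm y) <= 2 * ln C.
  move=> h x0 y0; rewrite lerBlDr.
  have -> : 2 * ln C + ln (nrm y) = ln (C * C * nrm y).
    by rewrite !lnM ?posrE ?mulr_gt0//; ring.
  by rewrite ler_ln ?posrE ?mulr_gt0.
rewrite /lncoc ler_norml; apply/andP; split.
  rewrite lerNl opprB; apply: key => //.
  have -> : cocycle b f N t = \adj (f (t + N%:R * b)) *m cocycle b f N (t + b) *m f t.
    by rewrite -mulmxA e1 mulmxA a4 mul1mx.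
  apply: le_trans (nrmM _ _) _; rewrite mulrAC.
  apply: ler_pM; rewrite ?nrm_ge0//.
  apply: le_trans (nrmM _ _) _; rewrite nrm_adj.
  by rewrite ler_wpM2r ?nrm_ge0.
apply: key => //.
have -> : cocycle b f N (t + b) = f (t + N%:R * b) *m cocycle b f N t *m \adj (f t).
  by rewrite -e1 -mulmxA a1 mulmx1.
apply: le_trans (nrmM _ _) _; rewrite mulrAC nrm_adj.
apply: ler_pM; rewrite ?nrm_ge0//.
by apply: le_trans (nrmM _ _) _; rewrite ler_wpM2r ?nrm_ge0.
Qed.

End Basic.

Section Deviation.
Variables (b : R) (Q J m K N : nat) (nu rho C l d : R).
Variables (c : int -> 'M[R[i]]_2) (f : R -> 'M[R]_2).
Hypotheses (nu0 : 0 < nu) (rho0 : 0 < rho) (cC : coef_bound nu rho c C) (C1 : 1 <= C)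
  (cf : represents c f) (det1f : forall x, \det (f x) = 1).
Hypothesis kl : forall k : nat, (k <= K)%N -> k%:R * l <= `|2 * pi * k%:R| `^ nu * rho.
Hypothesis small : 2 * N%:R * C ^+ N.+1 * (weight nu rho K)^-1 <= 32^-1.
Hypotheses (sep : separated b Q) (Q0 : (0 < Q)%N) (Qd : Q%:R^-1 <= d) (d2 : d <= 2^-1)
  (dl : 4 * d <= l) (QJ : (Q <= 2 ^ J)%N).

Let u := lncoc b f N.
Let B := 2 * (N%:R * ln C + 1).
Let dev L := deviation Q J m (4 * (K * N)) d l B L.
(** The cost of undoing the averages, 2 ln C per step along the orbit, plus the comparison of ln |P|
    with twice ln |A_N|. *)
Let X := (m.+1 * (64 * Q))%:R * (2 * ln C) + 5.

Let d0 : 0 < d. Proof. by apply: lt_le_trans Qd; rewrite invr_gt0 ltr0n. Qed.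
Let l0 : 0 <= l. Proof. by apply: le_trans dl; rewrite mulr_ge0 ?ltW. Qed.
Let lnC0 : 0 <= ln C. Proof. by rewrite ln_ge0. Qed.
Let fC x : nrm (f x) <= C. Proof. exact: (represents_le (ltW rho0) cC cf). Qed.
Let uf : mucont f. Proof. exact: represents_mucont nu0 rho0 cC cf. Qed.
Let K0 : (0 < 64 * Q)%N. Proof. by lia. Qed.
Let P := normpoly c b K N.

Let far0 : 0 <= far_err Q m.+1 d.
Proof.
by rewrite /far_err addr_ge0 ?mulr_ge0 ?exprn_ge0 ?invr_ge0 ?(ltW d0)// subr_ge0;
   apply: le_trans d2 _; lra.
Qed.

Let Pprop t : 1 <= normc P.[circ t] /\
  `|ln (normc P.[circ t]) - 2 * u t| <= 5.
Proof. exact: (ln_normpoly_near b (ltW nu0) (ltW rho0) cC C1 cf det1f t small). Qed.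

(** As |P| >= 1 on the circle, no root lies there. Each function ln |1 - w e(t)| has mean 0, so the
    logarithm of the Mahler measure is exactly the mean of ln |P|, which is what ties it to the mean
    of [u]. *)
Lemma normpoly_factor : exists (a : R[i]) (rs : seq R[i]),
  [/\ P = root_poly a rs, a != 0, off_circle rs, 1 <= mahler a rs &
      (size rs <= 4 * (K * N))%N /\
      `|ln (mahler a rs) - 2 * mean u| <= 5].
Proof.
have Pn0 : P != 0.
  apply/eqP => P0; have [] := Pprop 0; rewrite -/P P0 horner0.
  by rewrite (@normc0 R) ler10.
have [rs Prs] := closed_field_poly_normal P.
exists (lead_coef P), rs.
have a0 : lead_coef P != 0 by rewrite lead_coef_eq0.
have off : off_circle rs.
  move=> z zrs; apply/eqP => /circ_surj[t zt].
  have [] := Pprop t; rewrite -/P Prs -zt hornerZ.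
  have -> : (\prod_(x <- rs) ('X - x%:P)).[z] = 0.
    by apply/eqP; rewrite -[_ == 0]/(root _ z) root_prod_XsubC.
  by rewrite mulr0 (@normc0 R) ler10.
have lnm t : ln (normc P.[circ t]) = ln (mahler (lead_coef P) rs) + \sum_(z <- rs) lnfac (wfac z) t.
  by rewrite {1}Prs; apply: ln_root_poly.
have m0 : 0 < mahler (lead_coef P) rs.
  rewrite /mahler mulr_gt0 ?normc_gt0// prodr_gt0// => z _; by rewrite lt_max ltr01.
(* Extended by 0 off the roots, because [ucont_sum] and [mean_sum] ask for uniform continuity at
   every index. *)
pose G (z : R[i]) := if z \in rs then lnfac (wfac z) else fun=> 0.
have uG z : ucont (G z).
  rewrite /G; case: ifP => [/off/wfac_lt1|_]; [exact: ucont_lnfac|exact: ucont_cst].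
have FE : (fun t => ln (normc P.[circ t])) =
    (fun t => ln (mahler (lead_coef P) rs) + \sum_(z <- rs) G z t).
  apply/funext => t; rewrite lnm; congr (_ + _); rewrite big_seq [RHS]big_seq.
  by apply: eq_bigr => z zrs; rewrite /G zrs.
have uF : ucont (fun t => ln (normc P.[circ t])).
  by rewrite FE; apply: ucontD; [exact: ucont_cst|exact: ucont_sum].
have mF : mean (fun t => ln (normc P.[circ t])) = ln (mahler (lead_coef P) rs).
  rewrite FE meanD; [|exact: ucont_cst|exact: ucont_sum].
  rewrite mean_cst mean_sum// big_seq big1 ?addr0// => z zrs.
  by rewrite /G zrs mean_lnfac// wfac_lt1// off.
have uu := ucont_lncoc b uf fC C1 det1f N.
split => //.
  rewrite -(ler_ln _ m0) ?posrE// ln1 -mF -(mean_cst 0).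
  apply: ler_mean => // [|t]; first exact: ucont_cst.
  by rewrite ln_ge0//; have [] := Pprop t.
split.
  have sP : size P = (size rs).+1 by rewrite {1}Prs size_scale// size_prod_XsubC.
  by rewrite -ltnS -sP; exact: size_normpoly.
rewrite -mF -meanZ//; apply: mean_near => //; first exact: ucontZ.
by move=> t; have [] := Pprop t.
Qed.

Let dev_mono n L : (n <= 4 * (K * N))%N ->
  deviation Q J m n d l B L <= dev L.
Proof. by move=> nK; rewrite /dev /deviation lerD2r ler_wpM2r// ler_nat. Qed.

Let uX t : `|iavg b (64 * Q) m.+1 u t - u t| <= X - 5.
Proof.
rewrite /X addrK; apply: iavg_near => // x.
exact: (lncoc_shift b fC C1 det1f).
Qed.

Let FU t : `|iavg b (64 * Q) m.+1 (fun t => ln (normc P.[circ t])) t -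
   2 * iavg b (64 * Q) m.+1 u t| <= 5.
Proof.
have h1 := iavg_cst b m.+1 (5 : R) t K0.
rewrite -iavgZ ler_distl; apply/andP; split.
  rewrite -(iavg_cst b m.+1 (- 5 : R) t K0) -iavgD; apply: ler_iavg => r _.
  by have [_] := Pprop (t + r%:R * b); rewrite ler_distl => /andP[].
rewrite -h1 -iavgD; apply: ler_iavg => r _.
by have [_] := Pprop (t + r%:R * b); rewrite ler_distl => /andP[].
Qed.

Let PB a rs : P = root_poly a rs -> forall z, normc z = expR l \/ normc z = expR (- l) ->
     normc (root_poly a rs).[z] <= expR ((K * N).*2%:R * ln (normc z) + B).
Proof. by move=> PE z zl; rewrite -PE; exact: (normpoly_circles b (ltW nu0) (ltW rho0) cC C1 kl l0 N zl). Qed.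

Let B0 : 0 <= 4 * B / l.
Proof. by rewrite mulr_ge0 ?invr_ge0// mulr_ge0// /B mulr_ge0// addr_ge0// mulr_ge0. Qed.

Let dev0 L : 0 <= L -> 0 <= dev L.
Proof.
move=> L0; apply: addr_ge0; first exact: mulr_ge0.
apply: mulr_ge0; first exact: B0.
by apply: mulr_ge0; [exact: ltW|rewrite !addr_ge0// mulr_ge0].
Qed.

Lemma lncoc_upper t : u t <= mean u + X + dev 0.
Proof.
have [a [rs [PE a0 off m1 [szr mm]]]] := normpoly_factor.
have := iavg_root_poly_le m sep Q0 Qd d2 dl QJ a0 off m1 (PB PE) t.
rewrite -PE => h; have := dev_mono 0 szr; have := dev0 (lexx 0).
have := uX t; have := FU t; move: mm; rewrite !ler_norml => /andP[_ h1] /andP[h2 _] /andP[h3 _].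
by move: h h1 h2 h3; move: (iavg _ _ _ u _) (iavg _ _ _ _ _) (ln _) (mean u) (deviation _ _ _ _ _ _ _ _) => *; lra.
Qed.

(** The averages evaluate ln |P| along the orbit of t, which must avoid every root at every time of
    the window: hence one excluded arc for each root and each time. *)
Lemma lncoc_lower e L : 0 < e -> 0 <= L -> ln (1 + d / e) <= L ->
  exists ws : seq R[i], [/\ (size ws <= 4 * (K * N) * (m.+1 * (64 * Q)).+1)%N,
    (forall w, w \in ws -> normc w <= 1) &
    forall t, (forall w, w \in ws -> e <= normc (1 - w * circ t)) ->
      mean u - X - dev L <= u t].
Proof.
move=> e0 L0 eL.
have [a [rs [PE a0 off m1 [szr mm]]]] := normpoly_factor.
exists [seq wfac z * circ (r%:R * b) | z <- rs, r <- iota 0 (m.+1 * (64 * Q)).+1]; split.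
  by rewrite size_allpairs size_iota leq_mul2r szr orbT.
  move=> _ /allpairsP[[z r] /= [zrs _ ->]].
  by rewrite normcM normc_circ mulr1 ltW// wfac_lt1// off.
move=> t tw.
have er z (r : nat) : z \in rs -> (r <= m.+1 * (64 * Q))%N ->
    e <= normc (1 - wfac z * circ (t + r%:R * b)).
  move=> zrs rm; rewrite [t + _]addrC circD mulrA; apply: tw.
  by apply/allpairsP; exists (z, r); split=> //; rewrite mem_iota add0n ltnS.
have := iavg_root_poly_ge sep Q0 Qd d2 dl QJ a0 off m1 (PB PE) e0 L0 eL er.
rewrite -PE => h; have := dev_mono L szr; have := dev0 L0.
have := uX t; have := FU t; move: mm; rewrite !ler_norml => /andP[h1 _] /andP[_ h2] /andP[_ h3].
by move: h h1 h2 h3; move: (iavg _ _ _ u _) (iavg _ _ _ _ _) (ln _) (mean u) (deviation _ _ _ _ _ _ _ _) => *; lra.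
Qed.

End Deviation.
End FiniteScale.

(** * Choice of the parameters as functions of the scale *)

Section ScaleChoice.
Variable R : realType.

Lemma bernoulli_ge (h : R) n : 0 <= h -> 1 + n%:R * h <= (1 + h) ^+ n.
Proof.
move=> h0; elim: n => [|n IH]; first by rewrite mul0r addr0 expr0.
rewrite exprS -natr1; have := ler_wpM2l (_ : 0 <= 1 + h) IH.
move=> /(_ (addr_ge0 ler01 h0)); apply: le_trans.
have n0 : 0 <= n%:R :> R by []; nra.
Qed.

(** Most smallness conditions below set a power of [J] against a geometric sequence. With t =
    r^(1/(k+1)), Bernoulli's inequality bounds J t^J, and its (k+1)-st power leaves a factor 1 / J
    to spare. *)
Lemma poly_geo (r c e : R) (k : nat) : 0 < r -> r < 1 -> 0 < e ->
  exists J0 : nat, forall J : nat, (J0 <= J)%N -> c * J%:R ^+ k * r ^+ J <= e.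
Proof.
move=> r0 r1 e0.
pose t := r `^ (k.+1%:R)^-1.
have t0 : 0 < t by rewrite powR_gt0.
have tk : t ^+ k.+1 = r.
  by rewrite -powR_mulrn ?(ltW t0)// -powRrM mulVf ?pnatr_eq0// powRr1// ltW.
have t1 : t < 1.
  rewrite ltNge; apply/negP => h; have : 1 <= t ^+ k.+1 by rewrite exprn_ege1.
  by rewrite tk; lra.
pose h := t^-1 - 1; have h0 : 0 < h by rewrite subr_gt0 invf_gt1.
have Jt (J : nat) : J%:R * t ^+ J <= h^-1.
  have := bernoulli_ge J (ltW h0).
  have -> : 1 + h = t^-1 by rewrite /h addrC subrK.
  rewrite exprVn => hb.
  have tJ : 0 < t ^+ J by rewrite exprn_gt0.
  rewrite -[X in _ <= X]mul1r ler_pdivlMr//.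
  have : (1 + J%:R * h) * t ^+ J <= 1 by rewrite -ler_pdivlMr// div1r.
  nra.
pose H := h^-1 ^+ k.+1; have H0 : 0 < H by rewrite exprn_gt0// invr_gt0.
exists (Num.truncn (`|c| * H / e)).+1 => J JJ.
have J0 : (0 : R) < J%:R by rewrite ltr0n; lia.
have c0 : 0 <= `|c| * H / e.
  by apply: divr_ge0; [apply: mulr_ge0; [exact: normr_ge0|exact: ltW]|exact: ltW].
have /andP[_ cJ] := truncn_itv c0.
have {}cJ : `|c| * H <= e * J%:R.
  by rewrite [e * _]mulrC -ler_pdivrMr//; apply: ltW; apply: lt_le_trans cJ _; rewrite ler_nat.
have hJ : J%:R ^+ k.+1 * r ^+ J <= H.
  have -> : J%:R ^+ k.+1 * r ^+ J = (J%:R * t ^+ J) ^+ k.+1.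
    by rewrite exprMn -tk -!exprM mulnC.
  apply: lerXn2r (Jt J); rewrite nnegrE ?invr_ge0 ?(ltW h0)// mulr_ge0 ?exprn_ge0 ?ltW//.
rewrite -(ler_pM2r J0).
have -> : c * J%:R ^+ k * r ^+ J * J%:R = c * (J%:R ^+ k.+1 * r ^+ J) by rewrite exprS; ring.
apply: le_trans cJ; apply: (@le_trans _ _ (`|c| * (J%:R ^+ k.+1 * r ^+ J))).
  by rewrite ler_wpM2r ?ler_norm// mulr_ge0 ?exprn_ge0 ?ltW.
by rewrite ler_wpM2l.
Qed.

Variables (nu rho C : R).
Hypotheses (nu2 : 2^-1 < nu) (nu1 : nu < 1) (rho0 : 0 < rho) (C1 : 1 <= C).

(** Makes the weight at the truncation frequency beat 64 N C^(N+1): e^(64 N) takes care of 64 N, and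
    e^(2 N ln C) of C^(N+1). *)
Definition trconst : R := (64 + 2 * ln C) / rho + 1.
Definition gap : R := nu^-1 - 1.

Let nu0 : 0 < nu. Proof. by apply: lt_trans nu2; rewrite invr_gt0. Qed.
Let lnC0 : 0 <= ln C. Proof. by rewrite ln_ge0. Qed.

Lemma trconst_ge1 : 1 <= trconst.
Proof.
have h : 0 <= (64 + 2 * ln C) / rho by apply: divr_ge0; [rewrite addr_ge0// mulr_ge0|exact: ltW].
by rewrite /trconst; lra.
Qed.

Lemma gap_bounds : 0 < gap < 1.
Proof.
rewrite /gap subr_gt0 invf_gt1// nu1 /= ltrBlDr.
by rewrite invf_plt ?posrE//; apply: le_lt_trans nu2; lra.
Qed.

(* The width [l] of the strip where the truncation to frequencies [<= K]
   stays bounded is of order [K^(nu-1)], that is [N^(-gap)]; [gap < 1] is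
   where [nu > 1/2] enters. *)
Lemma truncation_choice N : (0 < N)%N -> exists (K : nat) (l : R),
  [/\ 0 < l, (forall k : nat, (k <= K)%N -> k%:R * l <= `|2 * pi * k%:R| `^ nu * rho),
    2 * N%:R * C ^+ N.+1 * (weight nu rho K)^-1 <= 32^-1,
    K%:R <= 2 * (trconst * N%:R) ^+ 2 &
    l^-1 <= 2 / rho * (trconst * N%:R) `^ gap].
Proof.
move=> N0; have N1 : (1 : R) <= N%:R by rewrite ler1n.
have a1 := trconst_ge1; set a := trconst in a1 *.
have aN : 1 <= a * N%:R by nra.
have aN0 : 0 < a * N%:R by apply: lt_le_trans aN.
pose x := (a * N%:R) `^ nu^-1.
have nui : 1 <= nu^-1 by rewrite invf_ge1// ltW.
have x1 : 1 <= x.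
  by have := ler_powR aN nui; rewrite powRr1 ?(ltW aN0)//; exact: le_trans aN.
have x0 : 0 <= x by apply: le_trans x1.
have /andP[x2 x3] := truncn_itv x0.
pose K := (Num.truncn x).+1; rewrite -/K in x3.
have K2x : K%:R <= 2 * x by rewrite /K -natr1; lra.
have K0 : (0 : R) < K%:R by rewrite ltr0n.
have pi2 := pi_ge2 R.
have powpi (k : nat) : k%:R `^ nu <= `|2 * pi * k%:R| `^ nu :> R.
  apply: ge0_ler_powR; rewrite ?nnegrE// ?(ltW nu0)//.
  by rewrite ger0_norm ?mulr_ge0 ?pi_ge0// ler_peMl//; lra.
have xnu : x `^ nu = a * N%:R by rewrite /x -powRrM mulVf ?gt_eqF// powRr1// ltW.
(* As nu < 1, k K^(nu - 1) <= k^nu for k <= K, so the weights dominate the growth on the strip of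
   width [l]. *)
exists K, (rho * K%:R `^ (nu - 1)); split.
- by rewrite mulr_gt0// powR_gt0.
- move=> k kK; rewrite mulrCA mulrC.
  apply: le_trans (ler_wpM2r (ltW rho0) (powpi k)); rewrite ler_wpM2r ?(ltW rho0)//.
  have [->|k0] := posnP k; first by rewrite mul0r powR_ge0.
  have k0' : (0 : R) < k%:R by rewrite ltr0n.
  rewrite -(mulr_powRB1 (ltW k0') nu0) ler_wpM2l//.
  have -> : nu - 1 = - (1 - nu) by ring.
  rewrite !powRN lef_pV2 ?posrE ?powR_gt0//.
  by apply: ge0_ler_powR; rewrite ?nnegrE ?ler_nat// subr_ge0 ltW.
- have w : expR ((64 + 2 * ln C) * N%:R) <= weight nu rho K.
    rewrite ler_expR; apply: le_trans (ler_wpM2r (ltW rho0) (powpi K)).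
    apply: (@le_trans _ _ (x `^ nu * rho)).
      have ar : a * rho = 64 + 2 * ln C + rho.
        by rewrite /a /trconst mulrDl mul1r divfK ?gt_eqF.
      by rewrite xnu mulrAC ar ler_wpM2r// lerDl ltW.
    rewrite ler_wpM2r ?(ltW rho0)//; apply: ge0_ler_powR; rewrite ?nnegrE ?(ltW nu0)//.
    exact: ltW.
  have w0 : 0 < weight nu rho K by exact: expR_gt0.
  rewrite ler_pdivrMr// ler_pdivlMl//; apply: le_trans w.
  have CE : C = expR (ln C) by rewrite lnK ?posrE//; apply: lt_le_trans C1.
  have -> : 32 * (2 * N%:R * C ^+ N.+1) = 64 * N%:R * C ^+ N.+1 by ring.
  have -> : expR ((64 + 2 * ln C) * N%:R) = expR (64 * N%:R) * expR (2 * N%:R * ln C).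
    by rewrite -expRD; congr expR; ring.
  apply: ler_pM; rewrite ?mulr_ge0 ?exprn_ge0//; first exact: le_trans C1.
    by apply: le_trans (expR_ge1Dx _); lra.
  rewrite {1}CE -expRM_natl ler_expR ler_wpM2r// -natr1; lra.
- apply: le_trans K2x _; rewrite ler_pM2l// -powR_mulrn ?(ltW aN0)//.
  apply: ler_powR => //; rewrite invf_ple ?posrE//; exact: ltW.
rewrite invfM [X in X <= _]mulrC.
have -> : 2 / rho * (a * N%:R) `^ gap = (2 * (a * N%:R) `^ gap) * rho^-1 by ring.
rewrite ler_wpM2r ?invr_ge0 ?(ltW rho0)//.
rewrite -powRN; have -> : - (nu - 1) = 1 - nu by ring.
apply: (@le_trans _ _ ((2 * x) `^ (1 - nu))).
  by apply: ge0_ler_powR; rewrite ?nnegrE ?mulr_ge0// subr_ge0 ltW.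
rewrite powRM//; apply: ler_pM; rewrite ?powR_ge0//.
  by rewrite -[X in _ <= X]powRr1//; apply: ler_powR; [rewrite ler1n|rewrite lerBlDr lerDl ltW].
rewrite /x -powRrM; apply: ler_powR => //.
by rewrite /gap mulrBr mulr1 mulVf ?gt_eqF.
Qed.

Lemma expR1_ge2 : 2 <= expR 1 :> R.
Proof. by have := @expR_ge1Dx R 1; lra. Qed.

(** Since (1 - d)^Q <= e^(-d Q) = e^(-8 J) and 1 / d <= Q, both terms of [far_err] are at most Q
    2^(-8 J). *)
Lemma far_err_le (Q J : nat) : (0 < Q)%N -> (0 < J)%N -> 8 * J%:R <= Q%:R / 2 :> R ->
  (Q <= 2 ^ J)%N ->
  far_err Q (8 * J) ((8 * J)%:R / Q%:R) <= 2 * 2^-1 ^+ (7 * J) :> R.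
Proof.
move=> Q0 J0 JQ QJ.
have Q0' : (0 : R) < Q%:R by rewrite ltr0n.
have J0' : (1 : R) <= J%:R by rewrite ler1n.
set d := (8 * J)%:R / Q%:R; have d0 : 0 < d by rewrite divr_gt0// ltr0n muln_gt0.
have d1 : d <= 1 by rewrite /d ler_pdivrMr// mul1r natrM; lra.
have dQ : d * Q%:R = (8 * J)%:R by rewrite /d divfK ?gt_eqF.
have Q2 : Q%:R <= 2 ^+ J :> R by rewrite -natrX ler_nat.
have t8 : Q%:R * 2^-1 ^+ (8 * J) <= 2^-1 ^+ (7 * J) :> R.
  have -> : (8 * J = J + 7 * J)%N by clear; lia.
  rewrite exprD mulrA ler_piMl ?exprn_ge0 ?invr_ge0// exprVn ler_pdivrMr ?exprn_gt0//.
  by rewrite mul1r.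
rewrite /far_err mulr2n mulrDl !mul1r; apply: lerD => //.
apply: le_trans t8; rewrite [X in _ <= X]mulrC; apply: ler_pM.
- by rewrite exprn_ge0// subr_ge0.
- by rewrite invr_ge0 ltW.
- apply: (@le_trans _ _ ((1 - d) ^+ Q)).
    by rewrite exprS ler_piMl ?exprn_ge0 ?subr_ge0// lerBlDr lerDl ltW.
  apply: (@le_trans _ _ (expR (- d) ^+ Q)).
    apply: lerXn2r; rewrite ?nnegrE ?expR_ge0 ?subr_ge0//.
    exact: expR_ge1Dx.
  rewrite -expRM_natr mulNr dQ expRN -[(8 * J)%:R]mulr1 expRM_natl exprVn.
  rewrite lef_pV2 ?posrE ?exprn_gt0 ?expR_gt0//.
  by apply: lerXn2r; rewrite ?nnegrE ?expR_ge0 ?expR1_ge2.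
by rewrite /d invf_div ler_pdivrMr ?ltr0n ?muln_gt0// ler_peMr ?(ltW Q0')// natrM; lra.
Qed.

Let a := trconst.
Let a1 : 1 <= a. Proof. exact: trconst_ge1. Qed.
Let a0 : 0 <= a. Proof. by apply: le_trans a1. Qed.
(** The rate Q^-(1 - gap) at which [d] becomes negligible against [l], per unit of J. *)
Definition decay : R := 2 `^ - (1 - gap).

Lemma decay_bounds : 0 < decay < 1.
Proof.
have [g0 g1] := andP gap_bounds.
rewrite /decay powR_gt0//= powRN invf_lt1 ?powR_gt0//.
have g1' : 0 < 1 - gap by rewrite subr_gt0.
have := gt0_ltr_powR g1' (_ : 1 \in Num.nneg) (_ : 2 \in Num.nneg).
by rewrite powR1; apply; rewrite ?nnegrE// ltr1n.
Qed.

(** d / l is of order (J / Q) (J^2 Q)^gap; the power of Q left over has the negative exponent gap -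
    1. *)
Lemma width_bound (J Q N : nat) (l : R) : (0 < J)%N -> (0 < Q)%N -> (0 < N)%N ->
  2 ^+ J <= 2 * Q%:R :> R -> N%:R <= 2 * (J%:R ^+ 2 * Q%:R) :> R ->
  l^-1 <= 2 / rho * (a * N%:R) `^ gap ->
  (8 * J)%:R / Q%:R * l^-1 <= 64 * a / rho * J%:R ^+ 3 * decay ^+ J.
Proof.
move=> Jp Q0 N0 EQ NQ li; have [g0 g1] := andP gap_bounds.
have Q0' : (0 : R) < Q%:R by rewrite ltr0n.
have J1 : (1 : R) <= J%:R by rewrite ler1n.
have hf : 0 <= (2^-1 : R) by rewrite invr_ge0.
have g1' : 0 <= 1 - gap by rewrite subr_ge0 ltW.
have E0 : 0 < (2 : R) ^+ J by rewrite exprn_gt0.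
have Qgap : Q%:R `^ gap / Q%:R <= 2 * decay ^+ J.
  have -> : Q%:R `^ gap / Q%:R = (Q%:R^-1) `^ (1 - gap) :> R.
    rewrite -powR_inv1 ?(ltW Q0')// -powRrM -powRD ?(gt_eqF Q0') ?implybT//.
    by congr (_ `^ _); ring.
  apply: (@le_trans _ _ ((2 * 2^-1 ^+ J) `^ (1 - gap))).
    apply: ge0_ler_powR; rewrite ?nnegrE ?invr_ge0 ?mulr_ge0 ?exprn_ge0//.
    by rewrite exprVn ler_pdivlMr// mulrC ler_pdivrMr.
  rewrite powRM ?exprn_ge0//; apply: ler_pM; rewrite ?powR_ge0//.
    by rewrite -[X in _ <= X]powRr1//; apply: ler_powR; [rewrite ler1n|rewrite lerBlDr lerDl ltW].
  have -> : 2^-1 ^+ J = 2 `^ (- J%:R) :> R by rewrite powR_invn// exprVn.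
  rewrite /decay -powR_mulrn ?powR_ge0// -!powRrM.
  by rewrite le_eqVlt; apply/orP; left; apply/eqP; congr (_ `^ _); ring.
have aNg : (a * N%:R) `^ gap <= 2 * a * J%:R ^+ 2 * Q%:R `^ gap.
  have J2 : 1 <= J%:R ^+ 2 :> R by rewrite exprn_ege1.
  have b1 : 1 <= 2 * a * J%:R ^+ 2.
    by move: J2 a1; move: (J%:R ^+ 2) a => y z *; nra.
  have b00 : 0 <= 2 * a * J%:R ^+ 2 by apply: le_trans b1.
  apply: (@le_trans _ _ ((2 * a * J%:R ^+ 2 * Q%:R) `^ gap)).
    apply: ge0_ler_powR; rewrite ?nnegrE ?(ltW g0)//; [exact: mulr_ge0|exact: mulr_ge0|].
    have -> : 2 * a * J%:R ^+ 2 * Q%:R = a * (2 * (J%:R ^+ 2 * Q%:R)) by ring.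
    by rewrite ler_wpM2l.
  rewrite powRM//; apply: ler_wpM2r; first exact: powR_ge0.
  by rewrite -[X in _ <= X]powRr1//; apply: ler_powR => //; exact: ltW.
have d0 : 0 <= (8 * J)%:R / Q%:R :> R by rewrite divr_ge0.
apply: (@le_trans _ _ ((8 * J)%:R / Q%:R * (2 / rho * (2 * a * J%:R ^+ 2 * Q%:R `^ gap)))).
  rewrite ler_wpM2l//; apply: le_trans li _.
  by rewrite ler_wpM2l// divr_ge0// ltW.
have -> : (8 * J)%:R / Q%:R * (2 / rho * (2 * a * J%:R ^+ 2 * Q%:R `^ gap)) =
    (32 * a / rho * J%:R ^+ 3) * (Q%:R `^ gap / Q%:R) by rewrite natrM; ring.
have -> : 64 * a / rho * J%:R ^+ 3 * decay ^+ J = (32 * a / rho * J%:R ^+ 3) * (2 * decay ^+ J) by ring.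
rewrite ler_wpM2l//; apply: mulr_ge0; last exact: exprn_ge0.
by apply: divr_ge0; [exact: mulr_ge0|exact: ltW].
Qed.

Lemma degree_bound (J N K : nat) : K%:R <= 2 * (a * N%:R) ^+ 2 ->
  N%:R <= 2 * J%:R ^+ 2 * 2 ^+ J :> R -> K%:R <= 8 * a ^+ 2 * J%:R ^+ 4 * (2 ^+ J) ^+ 2.
Proof.
move=> K2 NE; apply: le_trans K2 _.
have -> : 8 * a ^+ 2 * J%:R ^+ 4 * (2 ^+ J) ^+ 2 = 2 * (a * (2 * J%:R ^+ 2 * 2 ^+ J)) ^+ 2 by ring.
rewrite ler_pM2l//; apply: lerXn2r; rewrite ?nnegrE.
- exact: mulr_ge0.
- by apply: mulr_ge0.
by rewrite ler_wpM2l.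
Qed.

Let half_pow (J : nat) : (2 : R) ^+ J * 2^-1 ^+ J = 1.
Proof. by rewrite -exprMn mulfV ?expr1n// pnatr_eq0. Qed.

(** The number of roots is at most N times a power of J times 4^J, which the damping 2^(-7 J)
    beats. *)
Lemma far_bound (J N K : nat) (fe e : R) : K%:R <= 8 * a ^+ 2 * J%:R ^+ 4 * (2 ^+ J) ^+ 2 ->
  fe <= 2 * 2^-1 ^+ (7 * J) -> 64 * 2 * a ^+ 2 * J%:R ^+ 4 * 2^-1 ^+ J <= e ->
  (4 * (K * N))%:R * fe <= e * N%:R.
Proof.
move=> k1 fe2 c3.
apply: (@le_trans _ _ ((4 * (K * N))%:R * (2 * 2^-1 ^+ (7 * J)))); first by rewrite ler_wpM2l.
rewrite !natrM; have -> : 4 * (K%:R * N%:R) * (2 * 2^-1 ^+ (7 * J)) =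
  8 * (K%:R * 2^-1 ^+ (7 * J)) * N%:R :> R by ring.
rewrite ler_wpM2r//; apply: le_trans c3.
have hf : 0 <= (2^-1 : R) by rewrite invr_ge0.
apply: (@le_trans _ _ (8 * (8 * a ^+ 2 * J%:R ^+ 4 * (2 ^+ J) ^+ 2 * 2^-1 ^+ (7 * J)))).
  by rewrite ler_pM2l// ler_wpM2r ?exprn_ge0.
have -> : (7 * J = J * 2 + (J + 4 * J))%N by clear; lia.
rewrite (exprD _ (J * 2)) (exprD _ J) (exprM _ J 2); have -> : 8 * (8 * a ^+ 2 * J%:R ^+ 4 * (2 ^+ J) ^+ 2 *
   ((2^-1 ^+ J) ^+ 2 * (2^-1 ^+ J * 2^-1 ^+ (4 * J)))) =
   64 * a ^+ 2 * J%:R ^+ 4 * 2^-1 ^+ J * (2 ^+ J * 2^-1 ^+ J) ^+ 2 * 2^-1 ^+ (4 * J) by ring.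
rewrite half_pow expr1n mulr1.
have A0 : 0 <= 64 * a ^+ 2 * J%:R ^+ 4 * 2^-1 ^+ J.
  by apply: mulr_ge0; [apply: mulr_ge0; [apply: mulr_ge0 => //; exact: exprn_ge0|exact: exprn_ge0]|exact: exprn_ge0].
apply: (@le_trans _ _ (64 * a ^+ 2 * J%:R ^+ 4 * 2^-1 ^+ J)).
  by rewrite ler_piMr// exprn_ile1// invf_le1// ler1n.
have -> : 64 * 2 * a ^+ 2 * J%:R ^+ 4 * 2^-1 ^+ J = 2 * (64 * a ^+ 2 * J%:R ^+ 4 * 2^-1 ^+ J) by ring.
by move: A0; move: (64 * _ * _ * _) => ? ?; lra.
Qed.

Lemma dev_bound (J N b0 : nat) (d l e cb : R) : (0 < J)%N -> (0 < N)%N -> 0 <= d -> 0 < l ->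
  132 + 129 * (b0%:R * J%:R + 1) + 256 * J%:R <= cb * J%:R ->
  d * l^-1 <= 64 * a / rho * J%:R ^+ 3 * decay ^+ J ->
  8 * 64 * a * (ln C + 1) * cb / rho * J%:R ^+ 4 * decay ^+ J <= e ->
  4 * (2 * (N%:R * ln C + 1)) / l * (d * (132 + 129 * (b0%:R * J%:R + 1) + 256 * J%:R)) <= e * N%:R.
Proof.
move=> J0 N0 d0 l0 cL dli c4.
have Nr : (1 : R) <= N%:R by rewrite ler1n.
have B1 : 4 * (2 * (N%:R * ln C + 1)) <= 8 * (ln C + 1) * N%:R.
  by move: lnC0; move: (ln C) => s s0; nra.
set T := 132 + _ + _ in cL *.
have T0 : 0 <= T.
  by apply: addr_ge0; [apply: addr_ge0 => //; apply: mulr_ge0 => //; apply: addr_ge0 => //; exact: mulr_ge0|exact: mulr_ge0].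
have dl0 : 0 <= d * l^-1 by rewrite mulr_ge0 ?invr_ge0// ltW.
apply: (@le_trans _ _ (8 * (ln C + 1) * N%:R * (d * l^-1) * (cb * J%:R))).
  have -> : 4 * (2 * (N%:R * ln C + 1)) / l * (d * T) =
    (4 * (2 * (N%:R * ln C + 1)) * (d * l^-1)) * T by ring.
  apply: ler_pM => //; last by rewrite ler_wpM2r.
  apply: mulr_ge0 => //; apply: mulr_ge0 => //; apply: mulr_ge0 => //.
  by apply: addr_ge0 => //; exact: mulr_ge0.
have -> : 8 * (ln C + 1) * N%:R * (d * l^-1) * (cb * J%:R) =
   ((8 * (ln C + 1) * (cb * J%:R)) * (d * l^-1)) * N%:R by ring.
rewrite ler_wpM2r//; apply: le_trans c4.
have -> : 8 * 64 * a * (ln C + 1) * cb / rho * J%:R ^+ 4 * decay ^+ J =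
   (8 * (ln C + 1) * (cb * J%:R)) * (64 * a / rho * J%:R ^+ 3 * decay ^+ J) by ring.
rewrite ler_wpM2l//; apply: mulr_ge0; first by apply: mulr_ge0 => //; exact: addr_ge0.
exact: le_trans cL.
Qed.

(** Up to powers of J, the numbers K, N and J Q are at most of order 4^J, 2^J and 2^J; a fifth
    factor 2^J absorbs these powers. *)
Lemma size_bound (J Q N K : nat) : (0 < J)%N -> (0 < Q)%N ->
  K%:R <= 8 * a ^+ 2 * J%:R ^+ 4 * (2 ^+ J) ^+ 2 ->
  N%:R <= 2 * J%:R ^+ 2 * 2 ^+ J :> R -> Q%:R <= 2 ^+ J :> R ->
  64 * 513 * a ^+ 2 * J%:R ^+ 7 * 2^-1 ^+ J <= 1 ->
  (4 * (K * N) * (8 * J * (64 * Q)).+1)%:R <= 2 ^+ (5 * J) :> R.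
Proof.
move=> J0 Q0 k1 NE QE c6.
have JQ : (8 * J * (64 * Q)).+1%:R <= 513 * (J%:R * 2 ^+ J) :> R.
  have h : (1 : R) <= J%:R * Q%:R by rewrite -natrM ler1n muln_gt0 J0.
  have h2 : J%:R * Q%:R <= J%:R * 2 ^+ J :> R by rewrite ler_wpM2l.
  rewrite -natr1 !natrM; move: h h2; move: (J%:R * 2 ^+ J) => z.
  have -> : 8 * J%:R * (64 * Q%:R) = 512 * (J%:R * Q%:R) :> R by ring.
  by move: (J%:R * Q%:R) => y; lra.
apply: (@le_trans _ _ (4 * ((8 * a ^+ 2 * J%:R ^+ 4 * (2 ^+ J) ^+ 2) * (2 * J%:R ^+ 2 * 2 ^+ J)) *
    (513 * (J%:R * 2 ^+ J)))).
  rewrite natrM; apply: ler_pM => //; rewrite natrM ler_wpM2l// natrM; exact: ler_pM.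
have -> : 4 * ((8 * a ^+ 2 * J%:R ^+ 4 * (2 ^+ J) ^+ 2) * (2 * J%:R ^+ 2 * 2 ^+ J)) *
    (513 * (J%:R * 2 ^+ J)) = (64 * 513 * a ^+ 2 * J%:R ^+ 7) * (2 ^+ J) ^+ 4 by ring.
rewrite mulnC exprM [(2 ^+ J) ^+ 5]exprS ler_wpM2r ?exprn_ge0//.
have e0 : 0 < (2 : R) ^+ J by rewrite exprn_gt0.
move: c6; rewrite (exprVn 2 J); move: (64 * 513 * _ * _) => y; by rewrite ler_pdivrMr// mul1r.
Qed.

Lemma log_bound (b0 J : nat) (d : R) : 0 < d -> d <= 2^-1 ->
  ln (1 + d / (2^-1 ^+ (b0 * J))) <= b0%:R * J%:R + 1.
Proof.
move=> d0 d2; have E1 : 1 <= (2 : R) ^+ (b0 * J) by rewrite exprn_ege1// ler1n.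
have -> : (2^-1 ^+ (b0 * J))^-1 = 2 ^+ (b0 * J) :> R by rewrite exprVn invrK.
have h2 : 1 + d * 2 ^+ (b0 * J) <= 2 ^+ (b0 * J).+1.
  rewrite exprS; have : d * 2 ^+ (b0 * J) <= 2^-1 * 2 ^+ (b0 * J).
    by rewrite ler_wpM2r//; apply: le_trans E1.
  by move: E1; move: (2 ^+ (b0 * J)) (d * _) => u v *; lra.
apply: (@le_trans _ _ (ln (2 ^+ (b0 * J).+1))).
  rewrite ler_ln ?posrE ?exprn_gt0//; apply: addr_gt0 => //.
  by apply: mulr_gt0.
rewrite lnXn// -[ln 2 *+ _]mulr_natl.
have l2 : ln 2 <= 1 :> R by have := @le_ln1Dx R 1; rewrite -[1 + 1]/(2); apply; lra.
have -> : (b0 * J).+1%:R = b0%:R * J%:R + 1 :> R by rewrite -natr1 natrM.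
by rewrite ler_piMr// addr_ge0// mulr_ge0.
Qed.

(** The range of [N] contains J^2 Q and its double, the two lengths needed by the avalanche
    principle. The exponent [b0] of the radius is free because it enters the error only linearly,
    through L = b0 J + 1; a large [b0] will pay for a union of many translates of the arcs. *)
Lemma large_deviation (b0 : nat) (kap : R) : 0 < kap ->
  exists2 J0 : nat, (0 < J0)%N & forall J Q N : nat, (J0 <= J)%N ->
    (Q <= 2 ^ J < 2 * Q)%N -> (J ^ 2 * Q <= N <= 2 * (J ^ 2 * Q))%N ->
    forall (b : R) (c : int -> 'M[R[i]]_2) (f : R -> 'M[R]_2),
    coef_bound nu rho c C -> represents c f -> (forall x, \det (f x) = 1) ->
    separated b Q ->
    (forall t, lncoc b f N t <= mean (lncoc b f N) + kap * N%:R) /\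
    exists ws : seq R[i], [/\ (size ws)%:R <= 2 ^+ (5 * J) :> R,
      (forall w, w \in ws -> normc w <= 1) &
      forall t, (forall w, w \in ws -> 2^-1 ^+ (b0 * J) <= normc (1 - w * circ t)) ->
        mean (lncoc b f N) - kap * N%:R <= lncoc b f N t].
Proof.
move=> kap0.
have [r0 r1] := andP decay_bounds.
have hf : 0 < (2^-1 : R) by rewrite invr_gt0.
have h1 : (2^-1 : R) < 1 by rewrite invf_lt1// ltr1n.
(* 517 = 132 + 129 + 256: the constants of [deviation] at L = b0 J + 1, gathered using J >= 1. *)
pose cb : R := 517 + 129 * b0%:R.
have kap4 : 0 < kap / 4 by rewrite divr_gt0.
have kap2 : 0 < kap / 2 by rewrite divr_gt0.
have [j1 c2] := poly_geo 32 1 hf h1 ltr01.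
have [j2 c3] := poly_geo (64 * 2 * a ^+ 2) 4 hf h1 kap4.
have [j3 c4] := poly_geo (8 * 64 * a * (ln C + 1) * cb / rho) 4 r0 r1 kap4.
have [j4 c5] := poly_geo (4 * (64 * a / rho)) 3 r0 r1 ltr01.
have [j5 c6] := poly_geo (64 * 513 * a ^+ 2) 7 hf h1 ltr01.
have [j6 c7] : exists j : nat, forall J : nat, (j <= J)%N -> (8 * 64 * 2) * ln C + 5 <= kap / 2 * J%:R.
  pose A := ((8 * 64 * 2) * ln C + 5) / (kap / 2).
  have A0 : 0 <= A.
    by apply: divr_ge0; [apply: addr_ge0 => //; exact: mulr_ge0|exact: ltW].
  have /andP[_ h] := truncn_itv A0; exists (Num.truncn A).+1 => J jJ.
  rewrite [kap / 2 * _]mulrC -ler_pdivrMr//; apply: ltW; apply: lt_le_trans h _.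
  by rewrite ler_nat.
exists (1 + j1 + j2 + j3 + j4 + j5 + j6)%N; first by rewrite -!addnA.
move=> J Q N JJ /andP[QJ JQ] /andP[N1 N2] b c f cC cf df sep.
have [Jp [J1' [J2' [J3' [J4' [J5' J6']]]]]] : (0 < J)%N /\ (j1 <= J)%N /\ (j2 <= J)%N /\
    (j3 <= J)%N /\ (j4 <= J)%N /\ (j5 <= J)%N /\ (j6 <= J)%N by move: JJ; clear; lia.
have {}c2 := c2 J J1'; have {}c3 := c3 J J2'; have {}c4 := c4 J J3'.
have {}c5 := c5 J J4'; have {}c6 := c6 J J5'; have {}c7 := c7 J J6'.
have J1 : (1 : R) <= J%:R by rewrite ler1n.
have E0 : 0 < (2 : R) ^+ J by rewrite exprn_gt0.
have QE : Q%:R <= 2 ^+ J :> R by rewrite -natrX ler_nat.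
have EQ : 2 ^+ J <= 2 * Q%:R :> R by rewrite -natrX -natrM ler_nat ltnW.
have {}c2 : 32 * J%:R <= 2 ^+ J :> R by move: c2; rewrite expr1 exprVn ler_pdivrMr// mul1r.
have Q1 : 8 * J%:R <= Q%:R / 2 :> R.
  by move: c2 EQ; move: (2 ^+ J) (Q%:R) (J%:R) => u v w *; lra.
have Q0 : (0 < Q)%N by case: (Q) JQ => //; rewrite muln0.
have Q0' : (0 : R) < Q%:R by rewrite ltr0n.
have N1' : (J%:R ^+ 2 * Q%:R : R) <= N%:R by rewrite -natrX -natrM ler_nat.
have N2' : N%:R <= 2 * (J%:R ^+ 2 * Q%:R) :> R by rewrite -natrX -!natrM ler_nat.
have N0 : (0 < N)%N by apply: leq_trans N1; rewrite muln_gt0 expn_gt0 Jp.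
have NE : N%:R <= 2 * J%:R ^+ 2 * 2 ^+ J :> R.
  apply: le_trans N2' _; rewrite mulrA ler_wpM2l//.
have [K [l [l0 kl small K2 li]]] := truncation_choice N0.
pose d : R := (8 * J)%:R / Q%:R.
have d2 : d <= 2^-1 by rewrite /d ler_pdivrMr// mulrC natrM.
have d0 : 0 < d by rewrite divr_gt0// ltr0n muln_gt0.
have Qd : Q%:R^-1 <= d.
  by rewrite /d -[X in X <= _]mul1r ler_pM2r ?invr_gt0// ler1n muln_gt0.
have dli := width_bound Jp Q0 N0 EQ N2' li.
have dl : 4 * d <= l.
  rewrite -[X in _ <= X]mul1r -ler_pdivrMr// -mulrA; apply: le_trans c5.
  have -> : 4 * (64 * a / rho) * J%:R ^+ 3 * decay ^+ J = 4 * (64 * a / rho * J%:R ^+ 3 * decay ^+ J) by ring.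
  by rewrite ler_pM2l.
pose m := (8 * J).-1; have mE : m.+1 = (8 * J)%N by rewrite /m prednK// muln_gt0.
have e0 : 0 < (2^-1 : R) ^+ (b0 * J) by rewrite exprn_gt0.
have L0 : 0 <= b0%:R * J%:R + 1 :> R by rewrite addr_ge0 ?mulr_ge0.
have eL := log_bound b0 J d0 d2.
have K3 := degree_bound K2 NE.
have fe : far_err Q m.+1 d <= 2 * 2^-1 ^+ (7 * J) by rewrite mE; exact: far_err_le.
have far := far_bound N K3 fe c3.
have cL : 132 + 129 * (b0%:R * J%:R + 1) + 256 * J%:R <= cb * J%:R.
  by rewrite /cb; move: J1; move: (J%:R) (b0%:R) => u v *; nra.
have near := dev_bound Jp N0 (ltW d0) l0 cL dli c4.
have devL : deviation Q J m (4 * (K * N)) d l (2 * (N%:R * ln C + 1)) (b0%:R * J%:R + 1) <= kap / 2 * N%:R.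
  have -> : kap / 2 * N%:R = kap / 4 * N%:R + kap / 4 * N%:R by field.
  by apply: lerD; [exact: far|exact: near].
have B0 : 0 <= 4 * (2 * (N%:R * ln C + 1)) / l.
  by rewrite mulr_ge0 ?invr_ge0 ?(ltW l0)// mulr_ge0// mulr_ge0// addr_ge0// mulr_ge0.
have dev0 : deviation Q J m (4 * (K * N)) d l (2 * (N%:R * ln C + 1)) 0 <= kap / 2 * N%:R.
  apply: le_trans devL; rewrite /deviation lerD2l ler_wpM2l// ler_wpM2l ?(ltW d0)//.
  by rewrite lerD2r lerD2l mulr0 mulr_ge0.
(* The window costs order J Q ln C; this is where the second factor J in N >= J^2 Q is spent. *)
have XN : (m.+1 * (64 * Q))%:R * (2 * ln C) + 5 <= kap / 2 * N%:R.
  rewrite mE !natrM; apply: (@le_trans _ _ (kap / 2 * (J%:R ^+ 2 * Q%:R))); last first.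
    by rewrite ler_wpM2l// ltW.
  have JQ1 : 1 <= J%:R * Q%:R :> R by rewrite -natrM ler1n muln_gt0 Jp.
  have : ((8 * 64 * 2) * ln C + 5) * (J%:R * Q%:R) <= kap / 2 * J%:R * (J%:R * Q%:R).
    by rewrite ler_wpM2r//; apply: le_trans JQ1.
  have -> : kap / 2 * J%:R * (J%:R * Q%:R) = kap / 2 * (J%:R ^+ 2 * Q%:R) by ring.
  apply: le_trans.
  have -> : 8 * J%:R * (64 * Q%:R) * (2 * ln C) + 5 = (8 * 64 * 2) * ln C * (J%:R * Q%:R) + 5 by ring.
  by rewrite [X in _ <= X]mulrDl lerD2l ler_peMr.
split.
  move=> t; have := lncoc_upper (J := J) (d := d) (l := l) (K := K) m nu0 rho0 cC C1 cf df kl small sep Q0 Qd d2 dl QJ t.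
  move=> h; apply: le_trans h _; rewrite -addrA lerD2l.
  have -> : kap * N%:R = kap / 2 * N%:R + kap / 2 * N%:R by field.
  exact: lerD.
have [ws [sw w1 wlow]] := lncoc_lower (J := J) (d := d) (l := l) (K := K) m nu0 rho0 cC C1 cf df kl small sep Q0 Qd d2 dl QJ e0 L0 eL.
exists ws; split => //.
  apply: le_trans (size_bound Jp Q0 K3 NE QE c6).
  by rewrite ler_nat; rewrite mE in sw.
move=> t /wlow; apply: le_trans; rewrite -addrA lerD2l -opprD lerN2.
have -> : kap * N%:R = kap / 2 * N%:R + kap / 2 * N%:R by field.
exact: lerD.
Qed.

End ScaleChoice.

(** * From one scale to the next *)

Section Step.
Variable R : realType.
Variables (f : R -> 'M[R]_2) (b C : R).
Hypotheses (uf : mucont f) (fC : forall x, nrm (f x) <= C) (C1 : 1 <= C)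
  (det1f : forall x, \det (f x) = 1) (pf : periodic1 f).

Definition mlog b f N : R := mean (lncoc b f N).
Notation E := (mlog b f).

Let lnC0 : 0 <= ln C. Proof. by rewrite ln_ge0. Qed.
Let u := lncoc b f.
Let uu N : ucont (u N). Proof. exact: (ucont_lncoc b uf fC C1 det1f). Qed.
Let pu N : periodic1 (u N). Proof. exact: lncoc_period. Qed.
Let u0 N t : 0 <= u N t. Proof. exact: lncoc_ge0. Qed.
Let uC N t : u N t <= 1 + N%:R * ln C. Proof. exact: lncoc_le. Qed.

Lemma mlog_ge0 N : 0 <= E N.
Proof. by rewrite -(mean_cst 0) /mlog; apply: ler_mean => //; exact: ucont_cst. Qed.

Lemma mlog_le N : E N <= 1 + N%:R * ln C.
Proof. by rewrite -(mean_cst (1 + _)) /mlog; apply: ler_mean => //; exact: ucont_cst. Qed.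

Lemma mlogD M N : E (M + N) <= E M + E N.
Proof.
have <- : mean (fun t => u M (t + N%:R * b) + u N t) = E M + E N.
  by rewrite meanD ?mean_shift//; exact: ucont_shift.
by apply: ler_mean => //; [apply: ucontD => //; exact: ucont_shift|move=> t; exact: lncocD].
Qed.

(** The shorter product is the inverse of the prefix times the longer one, and the inverse has the
    norm of the prefix. Together with subadditivity this allows lengths to be rounded at the cost of
    one short block. *)
Lemma lncoc_suffix M N t : lncoc b f N t <= lncoc b f M (t + N%:R * b) + lncoc b f (M + N) t.
Proof.
have h1 := nrm_cocycle_ge2 b det1f M (t + N%:R * b).
have h2 := nrm_cocycle_ge2 b det1f N t.
have h3 := nrm_cocycle_ge2 b det1f (M + N) t.
rewrite /lncoc -lnM ?posrE; [|lra|lra]; rewrite ler_ln ?posrE; [|lra|nra].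
have [_ a2] := adj_det1 (det_cocycle b M (t + N%:R * b) det1f).
have -> : cocycle b f N t = \adj (cocycle b f M (t + N%:R * b)) *m cocycle b f (M + N) t.
  by rewrite cocycleD mulmxA a2 mul1mx.
by rewrite -[X in _ <= X * _]nrm_adj nrmM.
Qed.

Lemma mlog_suffix M N : E N <= E M + E (M + N).
Proof.
have <- : mean (fun t => u M (t + N%:R * b) + u (M + N) t) = E M + E (M + N).
  by rewrite meanD ?mean_shift//; exact: ucont_shift.
by apply: ler_mean => //; [apply: ucontD => //; exact: ucont_shift|move=> t; exact: lncoc_suffix].
Qed.

Section Avalanche.
(** [m] bounds the number of phases modulo 1 at which blocks start: as large as the number of blocks
    in general, the denominator for a rational frequency. The arcs are translated [m] times, however
    many blocks there are. *)
Variables (N n m : nat) (del eta : R) (ws : seq R[i]).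
Hypotheses (eta0 : 0 <= eta) (w1 : forall w, w \in ws -> normc w <= 1)
  (up : forall t, u N t <= E N + del)
  (low : forall t, (forall w, w \in ws -> eta <= normc (1 - w * circ t)) ->
     E (2 * N) - 2 * del <= u (2 * N) t)
  (cls : forall k, (k < n)%N -> exists2 k', (k' < m)%N &
     circ (k%:R * (N%:R * b)) = circ (k'%:R * (N%:R * b)))
  (gap4 : ln 4 <= E (2 * N) - E N - 3 * del).

Let s k : R := (k * N)%:R * b.
Let S : R := (m * size ws)%:R * (8 * eta).
Let lam : R := expR (E (2 * N) - E N - 3 * del).
(** The prediction of the avalanche principle for the product of the n + 1 blocks of length [N]
    starting at [t]. *)
Let G t : R := u N t + \sum_(k < n) (u (2 * N) (t + s k) - u N (t + s k)).
Let ws' := flatten [seq [seq w * circ (s k) | w <- ws] | k <- iota 0 m].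

Let sizews' : size ws' = (m * size ws)%N.
Proof.
rewrite size_flatten /shape -map_comp sumnE big_map.
rewrite (eq_bigr (fun=> size ws)); last by move=> i _ /=; rewrite size_map.
by rewrite big_const_seq count_predT size_iota iter_addn_0 mulnC.
Qed.

Let ws'1 w : w \in ws' -> normc w <= 1.
Proof.
move=> /flattenP[_ /mapP[k _ ->] /mapP[v vws ->]].
by rewrite normcM normc_circ mulr1 w1.
Qed.

Let good t k : (k < n)%N -> (forall w, w \in ws' -> eta <= normc (1 - w * circ t)) ->
  E (2 * N) - 2 * del <= u (2 * N) (t + s k).
Proof.
move=> kn h; apply: low => w wws.
have [k' k'm ck] := cls kn.
have -> : circ (t + s k) = circ (s k') * circ t.
  by rewrite circD mulrC /s !natrM -!mulrA ck.
rewrite mulrA; apply: h; apply/flattenP; exists [seq w * circ (s k') | w <- ws].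
  by apply/mapP; exists k' => //; rewrite mem_iota.
by apply/mapP; exists w.
Qed.

Let pairE t k : u (2 * N) (t + s k) =
  ln (nrm (cocycle b f N (t + s k.+1) *m cocycle b f N (t + s k))).
Proof.
rewrite /u /lncoc mul2n -addnn cocycleD; congr (ln (nrm (cocycle _ _ _ _ *m _))).
by rewrite /s mulSn natrD; ring.
Qed.

Let av t : (forall w, w \in ws' -> eta <= normc (1 - w * circ t)) ->
  `|u (n.+1 * N) t - G t| <= n%:R * (4 / lam ^+ 2).
Proof.
move=> h; pose g k := cocycle b f N (t + s k).
have dg k : \det (g k) = 1 by exact: det_cocycle.
have ng k : 0 < nrm (g k) by apply: lt_le_trans (nrm_det1_ge2 (dg k)).
have ngg k : 0 < nrm (g k.+1 *m g k).
  by apply: lt_le_trans (nrm_det1_ge2 _) => //; rewrite det_mulmx !dg mulr1.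
have lamle k k' : (k < n)%N -> lam * nrm (g k') <= nrm (g k.+1 *m g k).
  move=> kn; rewrite -(lnK (ng k' : _ \in Num.pos)) -(lnK (ngg k : _ \in Num.pos)) -expRD ler_expR.
  rewrite -pairE; have := good kn h; have := up (t + s k'); rewrite -/(g k').
  by rewrite {1}/u /lncoc -/(g k'); move: (ln _) (u _ _) (E _) (E _) => *; lra.
have := @avalanche R g n lam dg _ (fun k kn => lamle k k kn) (fun k kn => lamle k k.+1 kn).
have lam4 : 4 <= lam by rewrite -(lnK (_ : 4 \in Num.pos)) ?posrE// ler_expR.
move=> /(_ lam4); rewrite /G /u {1}/lncoc cocycle_mprod -/g.
have -> : lncoc b f N t = ln (nrm (g 0%N)) by rewrite /lncoc /g /s mul0n mul0r addr0.
have -> // : \sum_(k < n) (lncoc b f (2 * N) (t + s k) - lncoc b f N (t + s k)) =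
  \sum_(k < n) (ln (nrm (g k.+1 *m g k)) - ln (nrm (g k))).
by apply: eq_bigr => k _; rewrite -/u pairE.
Qed.

Let uG : ucont G.
Proof.
apply: ucontD => //; apply: ucont_sum => k; apply: ucontD; first exact: ucont_shift.
have := ucontZ (-1) (ucont_shift (s k) (uu N)).
by under eq_fun do rewrite mulN1r.
Qed.

Let pG : periodic1 G.
Proof.
move=> t; rewrite /G pu; congr (_ + _); apply: eq_bigr => k _.
by rewrite [t + 1 + _]addrAC !pu.
Qed.

Let meanG : mean G = E N + n%:R * (E (2 * N) - E N).
Proof.
have usub k : ucont (fun t => u (2 * N) (t + s k) - u N (t + s k)).
  apply: ucontD; first exact: ucont_shift.
  have := ucontZ (-1) (ucont_shift (s k) (uu N)).
  by under eq_fun do rewrite mulN1r.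
rewrite /G meanD//; last by apply: ucont_sum.
rewrite mean_sum//; congr (_ + _).
rewrite (eq_bigr (fun=> E (2 * N) - E N)); last first.
  move=> k _; have -> : (fun t => u (2 * N) (t + s k) - u N (t + s k)) =
      (fun t => u (2 * N) (t + s k) + (-1) * u N (t + s k)).
    by apply/funext => t; rewrite mulN1r.
  rewrite meanD; [|exact: ucont_shift|by apply: ucontZ; exact: ucont_shift].
  by rewrite meanZ ?mean_shift//; [rewrite mulN1r|exact: ucont_shift].
by rewrite sumr_const card_ord mulr_natl.
Qed.

Let crude t : `|u (n.+1 * N) t - G t| <= 2 * n.+1%:R * (1 + 2 * N%:R * ln C).
Proof.
set B := 1 + 2 * N%:R * ln C.
have B1 : 0 <= N%:R * ln C by rewrite mulr_ge0.
have sumb : `|\sum_(k < n) (u (2 * N) (t + s k) - u N (t + s k))| <= n%:R * B.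
  apply: le_trans (ler_norm_sum _ _ _) _.
  apply: (@le_trans _ _ (\sum_(k < n) B)); last by rewrite sumr_const card_ord mulr_natl.
  apply: ler_sum => k _; have := u0 (2 * N) (t + s k); have := u0 N (t + s k).
  have := uC (2 * N) (t + s k); have := uC N (t + s k); rewrite natrM /B -mulrA.
  move: B1; move: (N%:R * ln C) (u _ _) (u _ _) => x y z *.
  by rewrite ler_norml; apply/andP; split; lra.
have h1 := uC (n.+1 * N) t; have h2 := u0 (n.+1 * N) t; have h3 := uC N t; have h4 := u0 N t.
move: sumb h1 h2 h3 h4; rewrite /G natrM -!natr1 /B -!mulrA.
have nn : 0 <= n%:R :> R by [].
have : 0 <= n%:R * (N%:R * ln C) by rewrite mulr_ge0.
move: B1 nn; move: (n%:R) (N%:R * ln C) (u (n.+1 * N) t) (u N t) (\sum_(k < n) _).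
move=> x z v w T z0 x0 xz + *; rewrite !ler_norml => /andP[a1 a2].
by apply/andP; split; lra.
Qed.

(** Off the translated arcs the avalanche principle compares the logarithm with [G] pointwise; on
    them a crude bound is multiplied by their measure. Translations do not change means, which gives
    the mean of [G]. *)
Lemma mlog_avalanche : `|E (n.+1 * N) - (E N + n%:R * (E (2 * N) - E N))| <=
  n%:R * (4 / expR (E (2 * N) - E N - 3 * del) ^+ 2) +
  2 * n.+1%:R * (1 + 2 * N%:R * ln C) * ((m * size ws)%:R * (8 * eta)).
Proof.
rewrite -meanG -sizews' -/lam.
have e0 : 0 <= n%:R * (4 / lam ^+ 2) by rewrite mulr_ge0// divr_ge0// exprn_ge0// expR_ge0.
have c0 : 0 <= 2 * n.+1%:R * (1 + 2 * N%:R * ln C).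
  by apply: mulr_ge0 => //; apply: addr_ge0 => //; exact: mulr_ge0.
have h1 : E (n.+1 * N) <= mean G + n%:R * (4 / lam ^+ 2) +
    2 * n.+1%:R * (1 + 2 * N%:R * ln C) * ((size ws')%:R * (8 * eta)).
  apply: mean_le_off => //.
    by move=> x /av; rewrite ler_norml => /andP[_]; rewrite lerBlDl.
  by move=> x; have := crude x; rewrite ler_norml => /andP[_]; rewrite lerBlDl.
have h2 : mean G <= E (n.+1 * N) + n%:R * (4 / lam ^+ 2) +
    2 * n.+1%:R * (1 + 2 * N%:R * ln C) * ((size ws')%:R * (8 * eta)).
  apply: mean_le_off => //.
    by move=> x /av; rewrite ler_norml => /andP[+ _]; rewrite -/(u _) => h; lra.
  by move=> x; have := crude x; rewrite ler_norml => /andP[+ _]; rewrite -/(u _) => h; lra.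
move: h1 h2; move: (E _) (mean G) (_ * (4 / _)) (_ * (_ * (8 * _))) => x y z w *.
by rewrite ler_norml; apply/andP; split; lra.
Qed.

End Avalanche.

(** Write N' = r + (n + 1) N with r < N. The remainder, its share of the slope, and the difference
    between E N and E (2 N) - E N cost 4 (1 + N ln C) in all. *)
Lemma mlog_step (N N' m : nat) (del eta : R) (ws : seq R[i]) : (0 < N)%N -> (N <= N')%N ->
  0 <= eta -> (forall w, w \in ws -> normc w <= 1) ->
  (forall t, u N t <= E N + del) ->
  (forall t, (forall w, w \in ws -> eta <= normc (1 - w * circ t)) ->
     E (2 * N) - 2 * del <= u (2 * N) t) ->
  (forall k, (k < N')%N -> exists2 k', (k' < m)%N &
     circ (k%:R * (N%:R * b)) = circ (k'%:R * (N%:R * b))) ->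
  ln 4 <= E (2 * N) - E N - 3 * del ->
  `|E N' / N'%:R - (E (2 * N) - E N) / N%:R| <= 4 * (1 + ln C) * (N%:R / N'%:R) +
    4 / expR (E (2 * N) - E N - 3 * del) ^+ 2 +
    2 * (1 + 2 * ln C) * ((m * size ws)%:R * (8 * eta)).
Proof.
move=> N0 NN' eta0 w1 up low cls gap4.
have q0 : (0 < N' %/ N)%N by rewrite divn_gt0.
pose n := (N' %/ N).-1; pose r := (N' %% N)%N.
have NE : N' = (r + n.+1 * N)%N by rewrite /n prednK// addnC -divn_eq.
have rN : (r <= N)%N by rewrite ltnW// ltn_mod.
have clsn k : (k < n)%N -> exists2 k', (k' < m)%N &
     circ (k%:R * (N%:R * b)) = circ (k'%:R * (N%:R * b)).
  move=> kn; apply: cls; rewrite NE; move: kn N0; clear; nia.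
have := mlog_avalanche eta0 w1 up low clsn gap4.
set lt := 4 / _; set S := (_ * size ws)%:R * _.
have lt0 : 0 <= lt by rewrite divr_ge0// exprn_ge0// expR_ge0.
have S0 : 0 <= S by rewrite mulr_ge0// mulr_ge0.
have Nr : (1 : R) <= N%:R by rewrite ler1n.
have N'r : (0 : R) < N'%:R by rewrite ltr0n; apply: leq_trans NN'.
have h1 := mlogD r (n.+1 * N); have h2 := mlog_suffix r (n.+1 * N); rewrite -NE in h1 h2.
have er : E r <= 1 + N%:R * ln C.
  by apply: le_trans (mlog_le r) _; rewrite lerD2l ler_wpM2r// ler_nat.
have E1 := mlog_le N; have E2 := mlogD N N; rewrite addnn -mul2n in E2.
have E3 := mlog_ge0 (2 * N); have E4 := mlog_ge0 N.
have er0 := mlog_ge0 r.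
have NR : N'%:R = r%:R + n.+1%:R * N%:R :> R by rewrite NE natrD natrM.
have r0 : 0 <= r%:R :> R by [].
have rNR : r%:R <= N%:R :> R by rewrite ler_nat.
have n0 : 0 <= n%:R :> R by [].
have nE : n.+1%:R = n%:R + 1 :> R by rewrite -natr1.
have NnR : n.+1%:R * N%:R <= N'%:R :> R by rewrite NR lerDr.
set Y := E (2 * N) - E N in gap4 lt lt0 *.
have Y1 : `|Y| <= 1 + N%:R * ln C.
  by rewrite /Y ler_norml; move: E1 E2 E3 E4; move: (E _) (E _) => *; apply/andP; split; lra.
move=> av.
have NX : Y = N%:R * (Y / N%:R) by rewrite mulrC divfK// gt_eqF//; apply: lt_le_trans Nr.
have rX : `|r%:R * (Y / N%:R)| <= 1 + N%:R * ln C.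
  apply: le_trans Y1; rewrite {2}NX !normrM ler_wpM2r//.
  by rewrite !ger0_norm.
have key : `|E N' - N'%:R * (Y / N%:R)| <= 4 * (1 + N%:R * ln C) +
    (n%:R * lt + 2 * n.+1%:R * (1 + 2 * N%:R * ln C) * S).
  have -> : N'%:R * (Y / N%:R) = r%:R * (Y / N%:R) + (n%:R * Y + Y).
    have : forall X Z : R, Z = N%:R * X ->
      (r%:R + (n%:R + 1) * N%:R) * X = r%:R * X + (n%:R * Z + Z).
      by move=> X Z ->; ring.
    by move=> /(_ _ _ NX); rewrite NR nE.
  move: h1 h2 er er0 rX av Y1 E4 E1; rewrite -/Y !ler_norml.
  move: (E N') (E (n.+1 * N)) (E r) (E N) (_ * (Y / _)) (N%:R * ln C) => e1 e2 e3 e4 x z.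
  move: (n%:R * Y) (n%:R * lt) (2 * _ * _ * S) => y1 y2 y3.
  move=> h1 h2 h3 h4 /andP[h5 h6] /andP[h7 h8] /andP[h9 h10] h11 h12.
  by apply/andP; split; lra.
have -> : E N' / N'%:R - Y / N%:R = (E N' - N'%:R * (Y / N%:R)) / N'%:R.
  by field; rewrite !gt_eqF//; apply: lt_le_trans Nr.
rewrite normrM normfV (gtr0_norm N'r) ler_pdivrMr//.
apply: le_trans key _.
have -> : (4 * (1 + ln C) * (N%:R / N'%:R) + lt + 2 * (1 + 2 * ln C) * S) * N'%:R =
  4 * (N%:R * (1 + ln C)) + (lt * N'%:R + 2 * (N'%:R * (1 + 2 * ln C)) * S).
  by field; rewrite gt_eqF.
apply: lerD.
  by rewrite ler_pM2l// mulrDr mulr1 lerD2r.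
have nN' : n%:R <= N'%:R :> R.
  by apply: le_trans NnR; rewrite nE; move: n0 Nr; move: (n%:R) (N%:R) => *; nra.
apply: lerD; first by rewrite mulrC ler_wpM2l.
rewrite ler_wpM2r// -[2 * _ * _]mulrA ler_pM2l//.
apply: (@le_trans _ _ (n.+1%:R * (N%:R * (1 + 2 * ln C)))).
  rewrite ler_wpM2l// mulrDr mulr1; have -> : 2 * N%:R * ln C = N%:R * (2 * ln C) by ring.
  by rewrite lerD2r.
by rewrite mulrA ler_wpM2r// addr_ge0// mulr_ge0.
Qed.

End Step.

(** * Induction along a sequence of scales *)

Section Chain.
Variable R : realType.
Variables (nu rho C : R).
Hypotheses (nu2 : 2^-1 < nu) (nu1 : nu < 1) (rho0 : 0 < rho) (C1 : 1 <= C).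

Definition lrate b (f : R -> 'M[R]_2) N : R := mlog b f N / N%:R.

(* [2 L_2N - L_N], the limit of the exponents at scales much larger than [N]
   predicted by the avalanche principle. *)
Definition lpred b (f : R -> 'M[R]_2) N : R := (mlog b f (2 * N) - mlog b f N) / N%:R.

Lemma lpredE b f N : (0 < N)%N ->
  lpred b f N = lrate b f N - 2 * (lrate b f N - lrate b f (2 * N)).
Proof.
by move=> N0; rewrite /lpred /lrate natrM; field; rewrite pnatr_eq0 -lt0n.
Qed.

Definition in_class (f : R -> 'M[R]_2) := exists c : int -> 'M[R[i]]_2,
  [/\ coef_bound nu rho c C, represents c f, forall x, \det (f x) = 1 & periodic1 f].

(** Satisfied by a rational frequency with [m] its denominator. Being valid for all [k], it lets the
    length tend to infinity with [m] fixed. *)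
Definition orbit_classes b N m := forall k : nat, exists2 k', (k' < m)%N &
  circ (k%:R * (N%:R * b)) = circ (k'%:R * (N%:R * b)) :> R[i].

Let lnC0 : 0 <= ln C. Proof. by rewrite ln_ge0. Qed.

Lemma ex_nat_ge (x : R) : exists j : nat, forall J, (j <= J)%N -> x <= J%:R.
Proof.
have /andP[_ h] := truncn_itv (normr_ge0 x).
exists (Num.truncn `|x|).+1 => J jJ; apply: le_trans (ler_norm x) _.
by apply: ltW; apply: lt_le_trans h _; rewrite ler_nat.
Qed.

Lemma class_ucont f : in_class f ->
  [/\ mucont f, (forall x, nrm (f x) <= C), (forall x, \det (f x) = 1) & periodic1 f].
Proof.
move=> [c [cC cf df pf]]; split => //.
  by apply: represents_mucont rho0 cC cf; apply: lt_trans nu2; rewrite invr_gt0.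
by move=> x; exact: (represents_le (ltW rho0) cC cf x).
Qed.

(** The error must be a small multiple of 1 / J to be summed along the chain; apart from the term in
    N / N', the avalanche errors are exponentially small in J. *)
Lemma scale_step (b1 : nat) (tau Ls : R) : 0 < tau -> 0 < Ls ->
  exists2 J0 : nat, (0 < J0)%N & forall J Q : nat, (J0 <= J)%N -> (Q <= 2 ^ J < 2 * Q)%N ->
    forall b f, in_class f -> separated b Q ->
    3 / 4 * Ls <= lpred b f (J ^ 2 * Q) ->
    forall N' m, (J ^ 2 * Q <= N')%N -> (m <= 2 ^ (b1 * J))%N ->
    (forall k, (k < N')%N -> exists2 k', (k' < m)%N &
     circ (k%:R * ((J ^ 2 * Q)%:R * b)) = circ (k'%:R * ((J ^ 2 * Q)%:R * b)) :> R[i]) ->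
    `|lrate b f N' - lpred b f (J ^ 2 * Q)| <=
      4 * (1 + ln C) * ((J ^ 2 * Q)%:R / N'%:R) + tau / J%:R.
Proof.
(* The deviations use up 3 kap = Ls / 4 of the slope 3 Ls / 4, leaving a gap of at least N Ls /
   2. *)
move=> tau0 Ls0; pose kap := Ls / 12.
have kap0 : 0 < kap by rewrite divr_gt0.
(* 2^(b1 J) translates of 2^(5 J) arcs of radius 2^(-(b1 + 6) J) have total measure of order
   2^-J. *)
have [J0 J00 ld] := large_deviation nu2 nu1 rho0 C1 (b1 + 6) kap0.
have r0 : 0 < expR (- Ls) by exact: expR_gt0.
have r1 : expR (- Ls) < 1 by rewrite expR_lt1; lra.
have hf : 0 < (2^-1 : R) by rewrite invr_gt0.
have h1 : (2^-1 : R) < 1 by rewrite invf_lt1// ltr1n.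
have tau2 : 0 < tau / 2 by rewrite divr_gt0.
have [j1 c1] := poly_geo 4 1 r0 r1 tau2.
have [j2 c2] := poly_geo (2 * (1 + 2 * ln C) * 8) 1 hf h1 tau2.
have [j3 c3] := ex_nat_ge (ln 4 / (Ls / 2)).
exists (J0 + j1 + j2 + j3)%N; first by rewrite -!addnA ltn_addr.
move=> J Q JJ QJ b f cls sep pred N' m NN' mb sh.
have [K1 [K2 [K3 K4]]] : (J0 <= J)%N /\ (j1 <= J)%N /\ (j2 <= J)%N /\ (j3 <= J)%N.
  by move: JJ; clear; lia.
have Jp : (0 < J)%N by apply: leq_trans K1.
have Jr : (0 : R) < J%:R by rewrite ltr0n.
have Q0 : (0 < Q)%N by case/andP: QJ; clear; case: Q => //; rewrite muln0.
set N := (J ^ 2 * Q)%N in pred NN' sh *.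
have N0 : (0 < N)%N by rewrite muln_gt0 expn_gt0 Jp.
have JN : (J <= N)%N by rewrite /N; move: Jp Q0; clear; nia.
have [uf fC df pf] := class_ucont cls.
have [c [cC cf _ _]] := cls.
have [up _] := ld J Q N K1 QJ ltac:(by rewrite leqnn leq_pmull) b c f cC cf df sep.
have [_ [ws [sw w1 low]]] := ld J Q (2 * N)%N K1 QJ ltac:(by rewrite leqnn leq_pmull) b c f cC cf df sep.
have NX : N%:R * lpred b f N = mlog b f (2 * N) - mlog b f N.
  by rewrite /lpred mulrC divfK// pnatr_eq0 -lt0n.
have JNr : J%:R <= N%:R :> R by rewrite ler_nat.
have Nr : 0 <= N%:R :> R by [].
have gapJ : J%:R * (Ls / 2) <= mlog b f (2 * N) - mlog b f N - 3 * (kap * N%:R).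
  rewrite -NX; apply: (@le_trans _ _ (N%:R * (Ls / 2))).
    by rewrite ler_wpM2r// divr_ge0// ltW.
  have -> : N%:R * lpred b f N - 3 * (kap * N%:R) = N%:R * (lpred b f N - Ls / 4).
    by rewrite /kap; field.
  by rewrite ler_wpM2l//; move: pred; move: (lpred _ _ _) => x; lra.
have ln4 : ln 4 <= J%:R * (Ls / 2) by rewrite -ler_pdivrMr ?divr_gt0// c3.
have eta0 : 0 <= (2^-1 : R) ^+ ((b1 + 6) * J) by rewrite exprn_ge0// ltW.
have := mlog_step uf fC C1 df pf N0 NN' eta0 w1 up _ sh (le_trans ln4 gapJ).
have low' t : (forall w, w \in ws -> 2^-1 ^+ ((b1 + 6) * J) <= normc (1 - w * circ t)) ->
    mlog b f (2 * N) - 2 * (kap * N%:R) <= lncoc b f (2 * N) t.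
  move=> /low; rewrite natrM -/(mlog _ _ _).
  by have -> : 2 * (kap * N%:R) = kap * (2 * N%:R) by ring.
move=> /(_ low') h; apply: le_trans h _; rewrite -addrA lerD2l.
have -> : tau / J%:R = tau / 2 / J%:R + tau / 2 / J%:R by rewrite -mulrDl -splitr.
apply: lerD; rewrite ler_pdivlMr//.
  apply: le_trans (c1 _ K2); rewrite expr1 mulrAC ler_wpM2l ?mulr_ge0 ?(ltW Jr)//.
  rewrite -[expR (- Ls) ^+ J]expRM_natl -expRM_natl -expRN ler_expR mulrN lerN2.
  have -> : J%:R * Ls = 2 * (J%:R * (Ls / 2)) by field.
  by rewrite ler_pM2l.
apply: le_trans (c2 _ K3); rewrite expr1 -!mulrA ler_pM2l// ler_wpM2l//.
  by apply: addr_ge0 => //; exact: mulr_ge0.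
have pw : (m * size ws)%:R * 2^-1 ^+ ((b1 + 6) * J) <= 2^-1 ^+ J :> R.
  apply: (@le_trans _ _ (2 ^+ (b1 * J) * 2 ^+ (5 * J) * 2^-1 ^+ ((b1 + 6) * J))).
    rewrite ler_wpM2r// natrM; apply: ler_pM => //.
    by rewrite -natrX ler_nat.
  have -> : ((b1 + 6) * J = (b1 * J + 5 * J) + J)%N by clear; lia.
  rewrite -exprD [2^-1 ^+ (_ + J)]exprD mulrA -exprMn divff ?pnatr_eq0// expr1n mul1r//.
move: pw; move: (_ * size ws)%:R (2^-1 ^+ ((b1 + 6) * J)) => x y pw.
have -> : x * (8 * (y * J%:R)) = x * y * (8 * J%:R) by ring.
have -> : 8 * (J%:R * 2^-1 ^+ J) = 2^-1 ^+ J * (8 * J%:R) :> R by ring.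
by rewrite ler_wpM2r// mulr_ge0// ltW.
Qed.

(** The induction carries the stronger bound Ls - eps + 8 / J_j on the predicted exponent. A link
    from i to j loses at most 3 / (2 J_j), while 2 J_i <= J_j + 1 gives 8 / J_i >= 19 / (2 J_j), so
    the margin covers the loss. *)
Lemma scale_chain (b1 : nat) (Ls eps : R) : (0 < b1)%N -> 0 < eps -> eps <= Ls / 4 ->
  exists J1 : nat, forall (J Q : nat -> nat) (j0 j1 n : nat) b f, in_class f ->
    let N j := (J j ^ 2 * Q j)%N in
    (forall j, (j0 <= j <= n)%N ->
       [/\ (J1 <= J j)%N, (Q j <= 2 ^ J j < 2 * Q j)%N & separated b (Q j)]) ->
    (forall j, (j0 <= j < j1)%N -> (j <= n)%N -> Ls - 3 / 4 * eps <= lpred b f (N j)) ->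
    (forall j, (j1 <= j <= n)%N ->
       exists i, [/\ (j0 <= i)%N, (i < j)%N, (2 * J i <= (J j).+1)%N & (J j <= b1 * J i)%N]) ->
    (j0 <= n)%N -> forall m, (m <= 2 ^ (b1 * J n))%N -> orbit_classes b (N n) m ->
    forall N', (N n <= N')%N ->
      Ls - eps <= lrate b f N' + 4 * (1 + ln C) * ((N n)%:R / N'%:R).
Proof.
move=> b10 eps0 epsL; have Ls0 : 0 < Ls by lra.
have b1r : (0 : R) < b1%:R by rewrite ltr0n.
(* Two errors tau / J_i add up to 1 / (2 b1 J_i), at most 1 / (2 J_j) since J_j <= b1 J_i. *)
pose tau : R := (4 * b1%:R)^-1.
have tau0 : 0 < tau by rewrite invr_gt0 mulr_gt0.
have tau1 : tau <= 1 by rewrite invf_le1 ?mulr_gt0// -natrM ler1n muln_gt0.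
have hf : 0 < (2^-1 : R) by rewrite invr_gt0.
have h1 : (2^-1 : R) < 1 by rewrite invf_lt1// ltr1n.
have [J0 J00 step] := scale_step (b1 + 1) tau0 Ls0.
have [k1 c1] := poly_geo (16 * (1 + ln C)) 1 hf h1 tau0.
have [k2 c2] := poly_geo (2 * b1%:R ^+ 2) 2 hf h1 ltr01.
have [k3 c3] := ex_nat_ge (32 / eps).
exists (J0 + k1 + k2 + k3 + 2)%N => J Q j0 j1 n b f cls N scales base links j0n m mb orb N' NN'.
have big j : (j0 <= j <= n)%N -> [/\ (J0 <= J j)%N, (k1 <= J j)%N, (k2 <= J j)%N, (k3 <= J j)%N & (2 <= J j)%N].
  by move=> /scales [h _ _]; split; move: h; clear; lia.
have a0 j : (j0 <= j <= n)%N -> (0 : R) < (J j)%:R.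
  by move=> /big[_ _ _ _ h]; rewrite ltr0n; apply: leq_trans h.
have claim j : (j0 <= j <= n)%N -> Ls - eps + 8 / (J j)%:R <= lpred b f (N j).
  elim/ltn_ind: j => j IH jn; have /andP[j0j jn'] := jn.
  have aj := a0 _ jn; have [_ _ _ B3 _] := big _ jn.
  have [jj1|jj1] := ltnP j j1.
    apply: le_trans (base j _ jn'); last by rewrite j0j.
    have : 8 / (J j)%:R <= eps / 4.
      rewrite ler_pdivrMr//; have := c3 _ B3; rewrite ler_pdivrMr//; lra.
    by move: (8 / _) => x; lra.
  have [i [j0i ij JJ Jb]] := links j ltac:(by rewrite jj1).
  have iN : (j0 <= i <= n)%N by rewrite j0i (leq_trans (ltnW ij)).
  have ai := a0 _ iN.
  have {IH} Xi := IH i ij iN.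
  have [_ Qi sepi] := scales _ iN; have [_ Qj sepj] := scales _ jn.
  have [Bi0 Bi1 Bi2 Bi3 Bi4] := big _ iN.
  have ai1 : 0 <= 8 / (J i)%:R :> R by rewrite divr_ge0// ltW.
  have pr : 3 / 4 * Ls <= lpred b f (N i) by move: Xi ai1; move: (lpred _ _ _) (8 / _) => x y *; lra.
  (* The doubling of J along a link makes N_i / N_j exponentially small in J_i, hence also the
     remainder term of the step. *)
  have NiNj : (N i * 2 ^ J i <= 4 * N j)%N.
    have e1 : (2 ^ J i * 2 ^ J i <= 2 * 2 ^ J j)%N.
      by rewrite -expnD -expnS leq_exp2l// addnn -mul2n.
    have JiJj : (J i <= J j)%N by move: JJ Bi4; clear; lia.
    have Qjl : (2 ^ J j <= 2 * Q j)%N by rewrite ltnW//; case/andP: Qj.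
    have Qil : (Q i <= 2 ^ J i)%N by case/andP: Qi.
    have -> : (4 * N j = J j ^ 2 * (2 * (2 * Q j)))%N by rewrite /N; ring.
    rewrite /N -mulnA; apply: leq_mul; first by rewrite leq_exp2r.
    apply: leq_trans (_ : 2 ^ J i * 2 ^ J i <= _)%N; first by rewrite leq_mul2r Qil orbT.
    by apply: leq_trans e1 _; rewrite leq_mul2l.
  have p4 : (4 <= 2 ^ J i)%N by apply: (@leq_trans (2 ^ 2)) => //; rewrite leq_exp2l.
  have NiNj' : (N i <= N j)%N by move: NiNj p4; clear; nia.
  have Nj0 : (0 < N j)%N.
    rewrite /N muln_gt0 expn_gt0; case/andP: Qj => _; case: (Q j) => [|q _]; first by rewrite muln0.
    by move: aj; rewrite ltr0n => ->.
  (* Lengths up to 2 N_j are few enough for each orbit point to be its own class in [scale_step];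
     this fixes the exponent b1 + 1. *)
  have Nb : (2 * N j <= 2 ^ ((b1 + 1) * J i))%N.
    rewrite -(ler_nat R) natrX mulnDl mul1n exprD.
    apply: (@le_trans _ _ ((2 * b1%:R ^+ 2) * (J i)%:R ^+ 2 * 2 ^+ (b1 * J i))).
      have -> : (2 * N j)%:R = 2 * ((J j)%:R ^+ 2 * (Q j)%:R) :> R.
        by rewrite /N (natrM _ 2) (natrM _ (_ ^ 2)) natrX.
      have -> : 2 * b1%:R ^+ 2 * (J i)%:R ^+ 2 * 2 ^+ (b1 * J i) =
        2 * ((b1%:R * (J i)%:R) ^+ 2 * 2 ^+ (b1 * J i)) :> R by rewrite exprMn; ring.
      rewrite ler_pM2l//; apply: ler_pM => //.
        by apply: lerXn2r; rewrite ?nnegrE// -natrM ler_nat.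
      rewrite -natrX ler_nat; case/andP: Qj => h _; apply: leq_trans h _.
      by rewrite leq_exp2l.
    rewrite [X in _ <= X]mulrC ler_wpM2r//.
    by have := c2 _ Bi2; rewrite exprVn ler_pdivrMr// mul1r.
  have err M : (N j <= M <= 2 * N j)%N -> `|lrate b f M - lpred b f (N i)| <= 2^-1 / (J j)%:R.
    move=> /andP[M1 M2].
    have Mr : (0 : R) < M%:R by rewrite ltr0n; apply: leq_trans M1.
    have h := step (J i) (Q i) Bi0 Qi b f cls sepi pr M M (leq_trans NiNj' M1) (leq_trans M2 Nb)
      (fun k kM => ex_intro2 _ _ k kM erefl).
    apply: le_trans h _; rewrite -/(N i).
    have t1 : 4 * (1 + ln C) * ((N i)%:R / M%:R) <= tau / (J i)%:R.
      rewrite ler_pdivlMr//; apply: le_trans (c1 _ Bi1).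
      have -> : 16 * (1 + ln C) * (J i)%:R ^+ 1 * 2^-1 ^+ J i =
        4 * (1 + ln C) * (4 * 2^-1 ^+ J i) * (J i)%:R by rewrite expr1; ring.
      rewrite ler_wpM2r// ler_wpM2l ?mulr_ge0 ?addr_ge0//.
      rewrite ler_pdivrMr// exprVn mulrAC ler_pdivlMr// -natrX -!natrM ler_nat.
      by apply: leq_trans NiNj _; rewrite leq_mul2l M1 orbT.
    apply: (@le_trans _ _ (tau / (J i)%:R + tau / (J i)%:R)); first by rewrite lerD2r.
    have -> : tau / (J i)%:R + tau / (J i)%:R = 2^-1 / (b1 * J i)%:R.
      by rewrite natrM /tau; field; rewrite !gt_eqF.
    rewrite ler_pM2l// lef_pV2 ?posrE// ?ler_nat// ltr0n muln_gt0 b10.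
    by move: ai; rewrite ltr0n.
  have e1 := err (N j) ltac:(by rewrite leqnn leq_pmull).
  have e2 := err (2 * N j)%N ltac:(by rewrite leqnn leq_pmull).
  have aa : 19 / 2 / (J j)%:R <= 8 / (J i)%:R :> R.
    rewrite ler_pdivrMr// mulrAC ler_pdivlMr//.
    have : 2 * (J i)%:R <= (J j)%:R + 1 :> R by rewrite -natrM natr1 ler_nat.
    have : 2 <= (J i)%:R :> R by rewrite ler_nat.
    by move: (J i)%:R (J j)%:R => x y; lra.
  rewrite lpredE//; move: e1 e2 aa Xi; rewrite !ler_norml.
  move: (lrate _ _ _) (lrate _ _ _) (lpred _ _ _) => x y z.
  by move: (J j)%:R^-1 (8 / (J i)%:R) => v w /andP[? ?] /andP[? ?] *; lra.
have nn : (j0 <= n <= n)%N by rewrite j0n leqnn.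
have [_ Qn sepn] := scales _ nn; have [B0 _ _ _ _] := big _ nn.
have Xn := claim n nn; have an := a0 _ nn.
have an1 : 0 <= 8 / (J n)%:R :> R by rewrite divr_ge0// ltW.
have pr : 3 / 4 * Ls <= lpred b f (N n) by move: Xn an1; move: (lpred _ _ _) (8 / _) => x y *; lra.
have mb' : (m <= 2 ^ ((b1 + 1) * J n))%N.
  by apply: leq_trans mb _; rewrite leq_exp2l// mulnDl leq_addr.
have := step (J n) (Q n) B0 Qn b f cls sepn pr N' m NN' mb' (fun k _ => orb k).
rewrite -/(N n) ler_norml => /andP[+ _].
have : tau / (J n)%:R <= 8 / (J n)%:R by rewrite ler_pM2r ?invr_gt0//; apply: le_trans tau1 _; rewrite ler1n.
move: Xn; move: (lrate _ _ _) (lpred _ _ _) (8 / _) (tau / _) (_ * (_ / _)) => *; lra.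
Qed.

End Chain.

(** * Continued fractions *)

Section ContinuedFraction.
Variables (R : realType) (alpha : R).
Hypothesis irr : irrational alpha.

Local Notation x_ := (cf_complete alpha).
Local Notation p_ n := (cf_num_pair alpha n).1.
Local Notation p' n := (cf_num_pair alpha n).2.
Local Notation q_ n := (cf_den_pair alpha n).1.
Local Notation q' n := (cf_den_pair alpha n).2.
Definition cfq n : nat := `|cf_den alpha n|%N.

Lemma cf_numS n : cf_num_pair alpha n.+1 = (cf_digit alpha n.+1 * p_ n + p' n, p_ n).
Proof. by rewrite /=; case: (cf_num_pair alpha n). Qed.

Lemma cf_denS n : cf_den_pair alpha n.+1 = (cf_digit alpha n.+1 * q_ n + q' n, q_ n).
Proof. by rewrite /=; case: (cf_den_pair alpha n). Qed.

Lemma cf_complete_irrational n : ~ exists r : rat, x_ n = ratr r.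
Proof.
elim: n => [|n IH] [r h]; first by apply: irr; exists r.
apply: IH; exists ((Num.floor (x_ n))%:~R + r^-1).
by rewrite rmorphD /= fmorphV /= ratr_int -h /= invrK addrC subrK.
Qed.

Lemma cf_frac n : 0 < x_ n - (Num.floor (x_ n))%:~R < 1.
Proof.
have /andP[h1 h2] := floor_itv (x_ n).
rewrite subr_gt0 lt_neqAle h1 andbT ltrBlDl; apply/andP; split; last by rewrite -intrD1.
by apply/eqP => h; apply: (@cf_complete_irrational n); exists (Num.floor (x_ n))%:~R; rewrite ratr_int.
Qed.

Lemma cf_digit_ge1 n : 1 <= cf_digit alpha n.+1.
Proof.
have /andP[h1 h2] := cf_frac n.
by rewrite /cf_digit /= floor_ge_int /= ltW// invf_gt1.
Qed.

(** The complete quotient is minus the ratio of the previous approximation error to the current one,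
    and consecutive convergents have determinant of modulus 1; both pass through the recursion. *)
Lemma cf_invariant n :
  [/\ x_ n.+1 * ((q_ n)%:~R * alpha - (p_ n)%:~R) = - ((q' n)%:~R * alpha - (p' n)%:~R),
      `|p_ n * q' n - p' n * q_ n| = 1, 1 <= q_ n & 0 <= q' n].
Proof.
elim: n => [|n [h1 h2 h3 h4]].
  split => //=; have /andP[g0 g1] := cf_frac 0.
  - by rewrite /cf_digit /= mul1r mul0r sub0r opprK mulVf// gt_eqF.
  - by rewrite mulr0 mulr1 sub0r normrN normr1.
rewrite cf_numS cf_denS [(_, _).1]/= [(_, _).2]/= [(_, _).1]/= [(_, _).2]/=.
have a1 := cf_digit_ge1 n.
split; last exact: le_trans h3.
- have /andP[g0 g1] := cf_frac n.+1.
  rewrite [cf_complete _ n.+2]/= -/(cf_complete _ n.+1) -/(cf_digit _ n.+1).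
  set y := x_ n.+1 - _ in g0.
  apply: (mulfI (lt0r_neq0 g0)); rewrite mulrA divff ?gt_eqF// mul1r.
  rewrite !intrD !intrM; move: h1; rewrite /y /cf_digit; move: (x_ n.+1) => X.
  move: (Num.floor X)%:~R (q_ n)%:~R (p_ n)%:~R (q' n)%:~R (p' n)%:~R => a q p qq pp h.
  have -> : (a * q + qq) * alpha - (a * p + pp) = a * (q * alpha - p) + (qq * alpha - pp) by ring.
  by rewrite -[qq * _ - _]opprK -h; ring.
- rewrite -h2 -normrN; congr `|_|; ring.
- by apply: (@le_trans _ _ (1 * 1)) => //; rewrite -[X in X <= _]addr0; apply: lerD => //; apply: ler_pM.
Qed.

Lemma cfqE n : cf_den alpha n = cfq n :> int.
Proof.
by have [_ _ h _] := cf_invariant n; rewrite /cfq gez0_abs//; apply: le_trans h.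
Qed.

Lemma cfq_gt0 n : (0 < cfq n)%N.
Proof. by have [_ _ h _] := cf_invariant n; rewrite -ltz_nat -cfqE; apply: lt_le_trans h. Qed.

Lemma cfq_mono n m : (n <= m)%N -> (cfq n <= cfq m)%N.
Proof.
elim: m => [|m IH]; first by rewrite leqn0 => /eqP ->.
rewrite leq_eqVlt => /orP[/eqP -> //|]; rewrite ltnS => /IH h; apply: leq_trans h _.
rewrite -lez_nat -!cfqE /cf_den cf_denS [(_, _).1]/=.
have [_ _ h3 h4] := cf_invariant m; have := cf_digit_ge1 m.
by move: (cf_digit _ _) (q_ m) (q' m) h3 h4 => *; nia.
Qed.

Lemma cfq_ge n : (n <= cfq n)%N.
Proof.
case: n => // n; elim: n => [|n IH]; first exact: cfq_gt0.
apply: leq_ltn_trans IH _.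
rewrite -ltz_nat -!cfqE /cf_den (cf_denS n.+1) [(_, _).1]/=.
have -> : q' n.+1 = q_ n by rewrite cf_denS.
have [_ _ h3 _] := cf_invariant n; have [_ _ h4 _] := cf_invariant n.+1.
have := cf_digit_ge1 n.+1.
by move: (cf_digit _ _) (q_ n) (q_ n.+1) h3 h4 => *; nia.
Qed.

(** The error times x_(n+1) q_n + q_(n-1) has modulus 1, and that factor is at least q_(n+1) because
    x_(n+1) is at least its integer part. *)
Lemma cf_approx n : `|(cfq n)%:R * alpha - (cf_num alpha n)%:~R| <= (cfq n.+1)%:R^-1.
Proof.
have [h1 h2 h3 h4] := cf_invariant n.
have qR k : (cfq k)%:R = (q_ k)%:~R :> R by rewrite -[q_ k]/(cf_den alpha k) cfqE.
rewrite !qR /cf_num; set e := _ * alpha - _.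
have q1 : 0 < (q_ n.+1)%:~R :> R by rewrite -qR ltr0n cfq_gt0.
have xq : e * (x_ n.+1 * (q_ n)%:~R + (q' n)%:~R) = - (p_ n * q' n - p' n * q_ n)%:~R.
  rewrite mulrDr mulrA [e * _]mulrC h1 /e !intrB !intrM; ring.
have D0 : (q_ n.+1)%:~R <= x_ n.+1 * (q_ n)%:~R + (q' n)%:~R :> R.
  rewrite cf_denS [(_, _).1]/= intrD intrM lerD2r ler_wpM2r ?floor_le// ler0z.
  exact: le_trans h3.
rewrite -[X in _ <= X]mul1r ler_pdivlMr//.
apply: (@le_trans _ _ (`|e| * (x_ n.+1 * (q_ n)%:~R + (q' n)%:~R))); first by rewrite ler_wpM2l.
by rewrite -[X in _ * X]ger0_norm ?(le_trans (ltW q1))// -normrM xq normrN -intr_norm h2.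
Qed.

Lemma cf_coprime n : coprime `|cf_num alpha n| (cfq n).
Proof.
have [_ h2 _ _] := cf_invariant n.
have : (gcdz (cf_num alpha n) (cf_den alpha n) %| 1)%Z.
  have -> : (gcdz (cf_num alpha n) (cf_den alpha n) %| 1)%Z =
    (gcdz (cf_num alpha n) (cf_den alpha n) %| p_ n * q' n - p' n * q_ n)%Z.
    by rewrite !dvdzE -(abszE _) in h2 *; case: h2 => ->.
  rewrite rpredB//.
    by rewrite dvdz_mulr// dvdz_gcdl.
  by rewrite dvdz_mull// dvdz_gcdr.
by rewrite dvdz1 /gcdz absz_nat.
Qed.

Lemma cf_dist n m : (m <= n)%N ->
  `|(cf_num alpha n)%:~R / (cfq n)%:R - alpha| <= ((cfq m)%:R ^+ 2)^-1.
Proof.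
move=> mn; have q0 k : (0 : R) < (cfq k)%:R by rewrite ltr0n cfq_gt0.
have qm k : (m <= k)%N -> (cfq m)%:R <= (cfq k)%:R :> R by move=> mk; rewrite ler_nat cfq_mono.
have -> : (cf_num alpha n)%:~R / (cfq n)%:R - alpha =
    - ((cfq n)%:R * alpha - (cf_num alpha n)%:~R) / (cfq n)%:R.
  by field; rewrite gt_eqF.
rewrite normrM normrN normfV (gtr0_norm (q0 n)) expr2 invfM.
apply: ler_pM => //.
  by apply: le_trans (cf_approx n) _; rewrite lef_pV2 ?posrE ?qm// leqW.
by rewrite lef_pV2 ?posrE ?qm.
Qed.

(** For 0 < k < q_m, k p_m / q_m is at distance at least 1 / q_m from the integers. Passing to p_n /
    q_n moves it by at most 2 k / q_m^2 <= 1 / (2 q_m), as k <= Q <= q_m / 4; so every earlier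
    denominator is a separating scale. *)
Lemma cf_separated n m Q : (m <= n)%N -> (4 * Q <= cfq m)%N -> (cfq m <= 8 * Q)%N ->
  separated ((cf_num alpha n)%:~R / (cfq n)%:R : R) Q.
Proof.
move=> mn Q4 Q8 k j /andP[k0 kQ].
have q0 : (0 : R) < (cfq m)%:R by rewrite ltr0n cfq_gt0.
have Q0 : (0 : R) < Q%:R by rewrite ltr0n; apply: leq_trans kQ.
set b := _ / _; set b' := (cf_num alpha m)%:~R / (cfq m)%:R : R.
have bb : `|b - b'| <= 2 * ((cfq m)%:R ^+ 2)^-1.
  have := cf_dist mn; have := cf_dist (leqnn m); rewrite -/b -/b'.
  move=> h1 h2; have -> : b - b' = (b - alpha) - (b' - alpha) by ring.
  by apply: le_trans (ler_normB _ _) _; move: h1 h2; move: (_^-1) => *; lra.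
have kb : (cfq m)%:R^-1 <= `|k%:R * b' - j%:~R|.
  have -> : k%:R * b' - j%:~R = (k%:Z * cf_num alpha m - j * cfq m)%:~R / (cfq m)%:R.
    by rewrite /b' intrB !intrM; field; rewrite gt_eqF.
  rewrite normrM normfV (gtr0_norm q0) ler_peMl ?invr_ge0 ?(ltW q0)//.
  rewrite -intr_norm ler1z -gtz0_ge1 normr_gt0 subr_eq0.
  apply/eqP => h; have : (cfq m %| k)%N.
    have : (cfq m %| absz (k%:Z * cf_num alpha m)%R)%N by rewrite h abszM dvdn_mull.
    by rewrite abszM Gauss_dvdl// coprime_sym cf_coprime.
  move=> /dvdn_leq => /(_ k0) h2; move: h2 Q4 kQ k0; clear; lia.
have kd : `|k%:R * b' - j%:~R| <= `|k%:R * b - j%:~R| + k%:R * (2 * ((cfq m)%:R ^+ 2)^-1).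
  have -> : k%:R * b' - j%:~R = (k%:R * b - j%:~R) - k%:R * (b - b') by ring.
  apply: le_trans (ler_normB _ _) _; rewrite lerD2l normrM normr_nat ler_wpM2l//.
have t1 : k%:R * (2 * ((cfq m)%:R ^+ 2)^-1) <= (2 * (cfq m)%:R)^-1 :> R.
  rewrite mulrA ler_pdivrMr ?exprn_gt0// expr2 invfM -mulrA mulKf ?gt_eqF//.
  rewrite ler_pdivlMl// -!natrM ler_nat; move: kQ Q4; clear; lia.
have t2 : (16 * Q%:R)^-1 <= (2 * (cfq m)%:R)^-1 :> R.
  rewrite lef_pV2 ?posrE ?mulr_gt0// -!natrM ler_nat; move: Q8; clear; lia.
have t3 : (cfq m)%:R^-1 = (2 * (cfq m)%:R)^-1 + (2 * (cfq m)%:R)^-1 :> R.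
  by field; rewrite gt_eqF.
by move: t1 t2 t3 kd kb; move: (_^-1) (_^-1) (_^-1) (k%:R * _) => *; lra.
Qed.

Lemma cf_orbit_classes n N : 
  orbit_classes ((cf_num alpha n)%:~R / (cfq n)%:R : R) N (cfq n).
Proof.
move=> k; exists (k %% cfq n)%N; first by rewrite ltn_mod cfq_gt0.
have q0 : (0 : R) < (cfq n)%:R by rewrite ltr0n cfq_gt0.
rewrite {1}(divn_eq k (cfq n)) addnC natrD natrM.
set c := (k %/ _)%N; set r := (k %% _)%N.
have -> : (r%:R + c%:R * (cfq n)%:R) * (N%:R * ((cf_num alpha n)%:~R / (cfq n)%:R)) =
  r%:R * (N%:R * ((cf_num alpha n)%:~R / (cfq n)%:R)) + (c%:Z * N%:Z * cf_num alpha n)%:~R :> R.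
  by rewrite !intrM; field; rewrite gt_eqF.
exact: circDint.
Qed.

Hypothesis dioph : diophantine alpha.

(** From v q_n^(-tau) < |q_n alpha - p_n| <= 1 / q_(n+1); since q_n >= n, one more power of q_n
    absorbs 1 / v for large n. *)
Lemma cfq_growth : exists T n0 : nat, forall n, (n0 <= n)%N -> (cfq n.+1 <= cfq n ^ T)%N.
Proof.
have [v [tau [v0 tau1 h]]] := dioph.
have [T hT] := ex_nat_ge tau; have [V hV] := ex_nat_ge v^-1.
exists T.+1, V => n Vn.
have q0 k : (0 : R) < (cfq k)%:R by rewrite ltr0n cfq_gt0.
have nz : Posz (cfq n) != 0 by rewrite -lt0n cfq_gt0.
have := h _ nz => hi.
have : v * (cfq n)%:R `^ (- tau) <= (cfq n.+1)%:R^-1.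
  apply: ltW; apply: lt_le_trans (cf_approx n).
  rewrite (_ : (cfq n)%:R `^ _ = `|(cfq n)%:Z%:~R| `^ (- tau)); last by rewrite ger0_norm ?ler0z.
  apply: lt_le_trans hi _; apply: ge_inf; last by exists (cf_num alpha n).
  by exists 0 => _ [j _ <-].
rewrite powRN ler_pdivrMr ?powR_gt0// ler_pdivlMl// => g.
rewrite -(ler_nat R) natrX exprS.
have qV : v^-1 <= (cfq n)%:R by apply: hV; apply: leq_trans Vn (cfq_ge n).
have qT : (cfq n)%:R `^ tau <= (cfq n)%:R ^+ T :> R.
  by rewrite -powR_mulrn//; apply: ler_powR; [rewrite ler1n cfq_gt0|exact: hT].
apply: (@le_trans _ _ (v^-1 * (cfq n)%:R `^ tau)); first by rewrite ler_pdivlMl// mulrC.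
by apply: ler_pM => //; rewrite ?powR_ge0// invr_ge0 ltW.
Qed.

(** A quarter of the denominator, rounded down, satisfies 4 Q <= q <= 8 Q once q >= 4, as
    [cf_separated] requires. *)
Definition cfQ n : nat := (cfq n %/ 4)%N.
Definition cfJ n : nat := up_log 2 (cfQ n).

Lemma cfQ_bounds n : (4 <= cfq n)%N -> [/\ (4 * cfQ n <= cfq n)%N, (cfq n <= 8 * cfQ n)%N &
  (cfQ n <= 2 ^ cfJ n < 2 * cfQ n)%N].
Proof.
move=> q4; have e := divn_eq (cfq n) 4; have r4 := ltn_pmod (cfq n) (isT : (0 < 4)%N).
rewrite -/(cfQ n) in e; have Q1 : (0 < cfQ n)%N by move: e r4 q4; clear; lia.
split; [by move: e; clear; lia|by move: e r4 Q1; clear; lia|].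
rewrite /cfJ; move: Q1; rewrite leq_eqVlt => /orP[/eqP <- //|Q2].
have /andP[h1 h2] := up_log_bounds (isT : (1 < 2)%N) Q2; rewrite h2 /=.
have : (0 < up_log 2 (cfQ n))%N by rewrite up_log_gt0.
by case: (up_log 2 (cfQ n)) h1 => // k; rewrite /= expnS ltn_pmul2l.
Qed.

Lemma cfJ_large J1 : exists n0 : nat, forall n, (n0 <= n)%N -> (4 <= cfq n)%N /\ (J1 <= cfJ n)%N.
Proof.
exists (8 * 2 ^ J1)%N => n nn.
have qn : (8 * 2 ^ J1 <= cfq n)%N by apply: leq_trans nn (cfq_ge n).
have p0 : (0 < 2 ^ J1)%N by rewrite expn_gt0.
have q4 : (4 <= cfq n)%N by move: qn p0; clear; lia.
split => //; have [_ h2 /andP[h3 _]] := cfQ_bounds q4.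
by rewrite -(@leq_exp2l 2)//; move: h2 h3 qn; clear; lia.
Qed.

(** For a given j, the index i is the largest one, at least j0, with q_i^2 <= q_j. Maximality gives
    q_j < q_(i+1)^2, at most a power of q_i by the Diophantine growth; the two bounds are then read
    on binary logarithms. *)
Lemma cf_links : exists b1 n1 : nat, [/\ (0 < b1)%N,
  forall n, (n1 <= n)%N -> (cfq n <= 2 ^ (b1 * cfJ n))%N &
  forall j0, (n1 <= j0)%N -> exists j1, forall j, (j1 <= j)%N -> exists i,
    [/\ (j0 <= i)%N, (i < j)%N, (2 * cfJ i <= (cfJ j).+1)%N & (cfJ j <= b1 * cfJ i)%N]].
Proof.
have [T [n0 growth]] := cfq_growth; have [n2 large] := cfJ_large 1.
have qJ n : (n2 <= n)%N -> (cfq n <= 2 ^ (cfJ n + 3))%N.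
  move=> /large[q4 _]; have [_ h /andP[h2 _]] := cfQ_bounds q4.
  by rewrite expnD; move: h h2; clear; lia.
have Jq n : (n2 <= n)%N -> (2 * 2 ^ cfJ n < cfq n)%N.
  by move=> /large[q4 _]; have [h _ /andP[_ h2]] := cfQ_bounds q4; move: h h2; clear; lia.
exists (8 * T.+1)%N, (n0 + n2)%N; split => //.
  move=> n nn; have n2n : (n2 <= n)%N by apply: leq_trans nn; rewrite leq_addl.
  apply: leq_trans (qJ n n2n) _; rewrite leq_exp2l//.
  by have [_] := large n n2n; move: (cfJ n); clear; nia.
move=> j0 j0n; exists (cfq j0 ^ 2)%N => j jj.
have Pj0 : exists i, (cfq i ^ 2 <= cfq j)%N && (j0 <= i)%N.
  by exists j0; rewrite leqnn andbT; apply: leq_trans jj (cfq_ge j).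
have bound i : (cfq i ^ 2 <= cfq j)%N && (j0 <= i)%N -> (i < j)%N.
  move=> /andP[h1 h2]; rewrite ltnNge; apply/negP => ji.
  have h3 := cfq_mono ji.
  have [q4 _] := large i ltac:(by apply: leq_trans h2; apply: leq_trans j0n; rewrite leq_addl).
  by move: h1 h3 q4; clear; nia.
case: (ex_maxnP Pj0 (fun i h => ltnW (bound i h))) => i /[dup] /bound ij /andP[h1 h2] maxi.
have i2 : (n2 <= i)%N by apply: leq_trans h2; apply: leq_trans j0n; rewrite leq_addl.
have i0 : (n0 <= i)%N by apply: leq_trans h2; apply: leq_trans j0n; rewrite leq_addr.
have j2 : (n2 <= j)%N by apply: leq_trans i2 (ltnW ij).
exists i; split => //.
  rewrite -ltnS -(@ltn_exp2l 2)//.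
  apply: (@leq_trans (2 ^ (cfJ j + 3) %/ 2)%N).
    rewrite leq_divRL//; apply: leq_trans _ (qJ j j2); apply: leq_trans _ h1.
    have -> : (2 ^ (2 * cfJ i) = 2 ^ cfJ i * 2 ^ cfJ i)%N by rewrite mul2n -addnn expnD.
    have x0 : (0 < 2 ^ cfJ i)%N by rewrite expn_gt0.
    have := Jq i i2; rewrite -mulnn; move: (2 ^ cfJ i)%N (cfq i) x0; clear => x y; nia.
  by rewrite addn3 expnS mulKn.
have qij : (cfq j < cfq i.+1 ^ 2)%N.
  rewrite ltnNge; apply/negP => h; have := maxi i.+1.
  by rewrite h leqW// ltnn => /(_ isT).
have : (2 ^ cfJ j <= 2 ^ ((cfJ i + 3) * T * 2))%N.
  apply: leq_trans (_ : cfq j <= _)%N; first by move: (Jq j j2); clear; lia.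
  apply: leq_trans (ltnW qij) _; rewrite expnM leq_exp2r//.
  apply: leq_trans (growth i i0) _; rewrite expnM.
  by case: (T) => // t; rewrite leq_exp2r// qJ.
rewrite leq_exp2l//; have [_] := large i i2; move: (cfJ i) (cfJ j); clear => x y; nia.
Qed.

End ContinuedFraction.

(** * The Lyapunov exponent *)

Section Lyapunov.
Variable R : realType.

Section Fekete.
Variables (f : R -> 'M[R]_2) (b C : R).
Hypotheses (uf : mucont f) (fC : forall x, nrm (f x) <= C) (C1 : 1 <= C)
  (det1f : forall x, \det (f x) = 1) (pf : periodic1 f).

Let lnC0 : 0 <= ln C. Proof. by rewrite ln_ge0. Qed.
Notation E := (mlog b f).
Notation L := (lrate b f).

Lemma lrate_ge0 N : 0 <= L N.
Proof. by rewrite /lrate divr_ge0// (mlog_ge0 b uf fC C1 det1f). Qed.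

Lemma mlogMD M k r : E (k * M + r) <= k%:R * E M + E r.
Proof.
elim: k => [|k IH]; first by rewrite mul0n add0n mul0r add0r.
rewrite mulSn -addnA; apply: le_trans (mlogD b uf fC C1 det1f pf _ _) _.
by rewrite -natr1; move: IH; move: (E _) (E _) (E _) => *; lra.
Qed.

Lemma lrate_le M N : (0 < M)%N -> (0 < N)%N ->
  L N <= L M + (1 + M%:R * ln C) / N%:R.
Proof.
move=> M0 N0; have Nr : (0 : R) < N%:R by rewrite ltr0n.
have Mr : (0 : R) < M%:R by rewrite ltr0n.
rewrite {1}/lrate ler_pdivrMr// mulrDl divfK ?gt_eqF//.
rewrite {1}(divn_eq N M); apply: le_trans (mlogMD _ _ _) _; apply: lerD.
  have -> : E M = L M * M%:R by rewrite /lrate divfK// gt_eqF.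
  rewrite mulrCA ler_wpM2l ?lrate_ge0// -natrM ler_nat.
  exact: leq_trunc_div.
apply: le_trans (mlog_le b uf fC C1 det1f _) _.
by rewrite lerD2l ler_wpM2r// ler_nat ltnW// ltn_mod.
Qed.

(** The index starts at 1 because division by zero makes the rate at 0 equal to 0. *)
Let lset := [set L N.+1 | N in [set: nat]].

Lemma lrate_inf_le N : (0 < N)%N -> inf lset <= L N.
Proof.
case: N => // N _; apply: ge_inf; last by exists N.
by exists 0 => _ [k _ <-]; exact: lrate_ge0.
Qed.

Lemma lrate_inf_adherent (e : R) : 0 < e -> exists N0 : nat, forall N, (N0 <= N)%N ->
  L N <= inf lset + e.
Proof.
move=> e0; have e2 : 0 < e / 2 by rewrite divr_gt0.
have hi : has_inf lset.
  split; first by exists (L 1); exists 0%N.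
  by exists 0 => _ [k _ <-]; exact: lrate_ge0.
have [_ [M _ <-] hM] := inf_adherent e2 hi.
have [j hj] := ex_nat_ge ((1 + M.+1%:R * ln C) / (e / 2)).
exists j.+1 => N jN; have N0 : (0 < N)%N by apply: leq_trans jN.
apply: le_trans (lrate_le (ltn0Sn M) N0) _.
have : (1 + M.+1%:R * ln C) / N%:R <= e / 2.
  by rewrite ler_pdivrMr ?ltr0n// [_ * N%:R]mulrC -ler_pdivrMr// hj// ltnW.
by move: hM; move: (L _) (inf _) (_ / N%:R) => *; lra.
Qed.

(** Fekete's argument: the rates approach their infimum. Passing from the operator norm to the
    entrywise one changes the rate at N by at most ln 4 / N. *)
Lemma lyapunovE : lyapunov b f = inf lset.
Proof.
rewrite /lyapunov; apply: cvg_lim => //.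
have a0 : (Num.norm : R -> R) 0 = 0 by exact: normr0.
have a1 : (Num.norm : R -> R) 1 = 1 by exact: normr1.
have a2 (x : R) : 0 <= `|x| by exact: normr_ge0.
have a3 (x y : R) : `|x + y| <= `|x| + `|y| by exact: ler_normD.
have a4 (x y : R) : `|x * y| = `|x| * `|y| by exact: normrM.
pose op N t := op_norm (Num.norm : R -> R) (cocycle b f N t).
have op4 N t : nrm (cocycle b f N t) <= 4 * op N t.
  by apply: le_trans (l1norm_le_op _ _ _ _ _ _) _.
have opl N t : op N t <= nrm (cocycle b f N t) by exact: op_norm_le_l1.
have ge2 := nrm_cocycle_ge2 b det1f.
have op2 N t : 2^-1 <= op N t by have := op4 N t; have := ge2 N t; lra.
have uop N : ucont (op N).
  move=> e e0; have [d d0 h] := mucont_cocycle b N uf fC C1 e0; exists d => // x y xy.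
  have := h _ _ xy; have := op_norm_near a0 a2 a3 a4 (cocycle b f N x) (cocycle b f N y).
  have := op_norm_near a0 a2 a3 a4 (cocycle b f N y) (cocycle b f N x).
  rewrite -/(op N x) -/(op N y) -!/(nrm _) -[cocycle b f N y - _]opprB nrmN.
  by move: (op _ _) (op _ _) (nrm _) => *; rewrite ler_norml; apply/andP; split; lra.
have ulnop N : ucont (fun t => ln (op N t)) by apply: (@ucont_ln _ _ 2^-1); rewrite ?invr_gt0.
have near N : `|mean (fun t => ln (op N t)) - E N| <= ln 4.
  apply: mean_near => //; first exact: ucont_lncoc uf fC C1 det1f N.
  move=> t; rewrite /lncoc; have := op4 N t; have := opl N t; have := op2 N t; have := ge2 N t.
  move: (op _ _) (nrm _) => x y y2 x2 xy yx.
  have x0 : 0 < x by lra. have y0 : 0 < y by lra.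
  have l1 : ln x <= ln y by rewrite ler_ln ?posrE.
  have l2 : ln y <= ln 4 + ln x by rewrite -lnM ?posrE// ler_ln ?posrE ?mulr_gt0.
  by rewrite ler_norml; move: l1 l2; move: (ln x) (ln y) (ln 4) => *; apply/andP; split; lra.
apply/cvgrPdist_le => e e0; have e2 : 0 < e / 2 by rewrite divr_gt0.
have [N0 h0] := lrate_inf_adherent e2; have [N1 h1] := ex_nat_ge (ln 4 / (e / 2)).
exists (N0 + N1).+1 => // N /= NN.
have Np : (0 < N)%N by apply: leq_trans NN.
have Nr : (0 : R) < N%:R by rewrite ltr0n.
have hN := h0 N ltac:(by apply: leq_trans (ltnW NN); rewrite leq_addr).
have hN1 := h1 N ltac:(by apply: leq_trans (ltnW NN); rewrite leq_addl).
have hI := lrate_inf_le Np.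
have : `|N%:R^-1 * mean (fun t => ln (op N t)) - L N| <= e / 2.
  have -> : N%:R^-1 * mean (fun t => ln (op N t)) - L N =
    (mean (fun t => ln (op N t)) - E N) / N%:R by rewrite /lrate; field; rewrite gt_eqF.
  rewrite normrM normfV (gtr0_norm Nr) ler_pdivrMr//; apply: le_trans (near N) _.
  by rewrite mulrC -ler_pdivrMr.
rewrite -/(mean _) -/(op _ _); set Z := N%:R^-1 * _; rewrite -/Z.
move: hN hI; move: Z (inf lset) (L N) => Z i l; rewrite !ler_norml => h2 h3 /andP[*].
by apply/andP; split; lra.
Qed.

Lemma lyapunov_le N : (0 < N)%N -> lyapunov b f <= L N.
Proof. by rewrite lyapunovE; exact: lrate_inf_le. Qed.

Lemma lyapunov_adherent (e : R) : 0 < e -> exists N0 : nat, forall N, (N0 <= N)%N ->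
  L N <= lyapunov b f + e.
Proof. by rewrite lyapunovE; exact: lrate_inf_adherent. Qed.

Lemma lyapunov_ge0 : 0 <= lyapunov b f.
Proof.
apply/ler_addgt0Pr => e /lyapunov_adherent[N /(_ N (leqnn N))].
by apply: le_trans; exact: lrate_ge0.
Qed.

(** The change of the shorter product, the change of the matrix function, and the displacement N (b'
    - b) of the base point each receive a third of [e]. *)
Lemma cocycle_near N (e : R) : 0 < e -> exists2 d : R, 0 < d & forall (b' : R) (f' : R -> 'M[R]_2),
  `|b' - b| <= d -> (forall x, nrm (f' x - f x) <= d) -> (forall x, nrm (f' x) <= C) ->
  forall t, nrm (cocycle b' f' N t - cocycle b f N t) <= e.
Proof.
have C0 : 0 < C by apply: lt_le_trans C1.
elim: N e => [|N IH] e e0.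
  by exists 1 => // b' f' _ _ _ t; rewrite subrr nrm2 !mxE normr0 !addr0 ltW.
have k0 : 0 < 2 * C ^+ N by rewrite mulr_gt0// exprn_gt0.
have e3 : 0 < e / 3 by rewrite divr_gt0.
have e4 : 0 < e / 3 / (2 * C ^+ N) by rewrite divr_gt0.
have [d1 d10 h1] := uf e4.
have [d2 d20 h2] := IH (e / 3 / C) ltac:(by rewrite divr_gt0).
exists (Num.min (Num.min d2 (e / 3 / (2 * C ^+ N))) (d1 / N.+1%:R)).
  by rewrite !lt_min d20 e4 divr_gt0.
move=> b' f'; rewrite !le_min => /andP[/andP[b2 _] b1] ff f'C t.
have ff2 x : nrm (f' x - f x) <= d2 by apply: le_trans (ff x) _; rewrite !ge_min lexx.
have {h2} T2 := h2 b' f' b2 ff2 f'C t.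
have fe x : nrm (f' x - f x) <= e / 3 / (2 * C ^+ N).
  by apply: le_trans (ff x) _; rewrite !ge_min lexx orbT.
rewrite /=; set T' := cocycle b' f' N t in T2 *; set T := cocycle b f N t in T2 *.
set s' := t + N%:R * b'; set s := t + N%:R * b.
have ss : `|s' - s| <= d1.
  have -> : s' - s = N%:R * (b' - b) by rewrite /s' /s; ring.
  rewrite normrM normr_nat; apply: (@le_trans _ _ (N.+1%:R * (d1 / N.+1%:R))).
    by apply: ler_pM => //; rewrite ler_nat.
  by rewrite mulrC divfK// pnatr_eq0.
have -> : f' s' *m T' - f s *m T = f' s' *m (T' - T) + ((f' s' - f s') *m T + (f s' - f s) *m T).
  by rewrite -mulmxDl [f' s' - _ + _]addrA subrK mulmxBr mulmxBl addrA subrK.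
have TC : nrm T <= 2 * C ^+ N by exact: nrm_cocycle_le.
have third A : nrm A <= e / 3 / (2 * C ^+ N) -> nrm (A *m T) <= e / 3.
  move=> h; apply: le_trans (nrmM _ _) _.
  apply: (@le_trans _ _ (e / 3 / (2 * C ^+ N) * (2 * C ^+ N))); last by rewrite divfK ?gt_eqF.
  by apply: ler_pM; rewrite ?nrm_ge0.
apply: le_trans (nrmD _ _) _; have -> : e = e / 3 + (e / 3 + e / 3) by field.
apply: lerD.
  apply: le_trans (nrmM _ _) _.
  apply: (@le_trans _ _ (C * (e / 3 / C))); last by rewrite mulrC divfK ?gt_eqF.
  by apply: ler_pM; rewrite ?nrm_ge0.
apply: le_trans (nrmD _ _) _; apply: lerD; apply: third => //.
exact: h1.
Qed.

Lemma lrate_near N (e : R) : (0 < N)%N -> 0 < e -> exists2 d : R, 0 < d & forall (b' : R) (f' : R -> 'M[R]_2),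
  `|b' - b| <= d -> (forall x, nrm (f' x - f x) <= d) -> (forall x, nrm (f' x) <= C) ->
  mucont f' -> (forall x, \det (f' x) = 1) -> `|lrate b' f' N - L N| <= e.
Proof.
move=> N0 e0; have Nr : (1 : R) <= N%:R by rewrite ler1n.
have [d d0 h] := cocycle_near N e0; exists d => // b' f' bb ff f'C uf' df'.
have : `|mlog b' f' N - E N| <= e.
  apply: mean_near; [exact: ucont_lncoc uf' f'C C1 df' N|exact: ucont_lncoc uf fC C1 det1f N|].
  move=> t; have := h b' f' bb ff f'C t.
  have g1 := nrm_cocycle_ge2 b' df' N t; have g2 := nrm_cocycle_ge2 b det1f N t => h'.
  apply: le_trans (ln_lip (ltr0n R 2) g1 g2) _; rewrite ler_pdivrMr//.
  have : `|nrm (cocycle b' f' N t) - nrm (cocycle b f N t)| <= e.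
    apply: le_trans h'; rewrite ler_norml nrmBl andbT lerNl opprB.
    by apply: le_trans (nrmBl _ _) _; rewrite -opprB nrmN.
  by move: (`|_|) => *; lra.
rewrite /lrate -mulrBl normrM normfV [`|N%:R|]ger0_norm// ler_pdivrMr; last exact: lt_le_trans Nr.
by move=> h2; apply: le_trans h2 _; rewrite ler_peMr// ltW.
Qed.

End Fekete.

(** One constant for the limit and all but finitely many A_n makes the later estimates uniform in n.
    It exists because the coefficients of A_n are those of A plus a difference with bound 1 for
    large n. *)
Lemma gevrey_class (nu rho : R) (A : R -> 'M[R]_2) (A_ : nat -> R -> 'M[R]_2) :
  0 < nu -> 0 < rho -> gevrey_SL2 nu rho A -> (forall n, gevrey_SL2 nu rho (A_ n)) ->
  (fun n => gevrey_norm nu rho (fun t => A_ n t - A t)) @ \oo --> (0 : \bar R)%E ->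
  exists2 C, 1 <= C & [/\ in_class nu rho C A,
    (exists n0 : nat, forall n, (n0 <= n)%N -> in_class nu rho C (A_ n)) &
    forall e : R, 0 < e -> exists n0 : nat, forall n, (n0 <= n)%N -> forall x, nrm (A_ n x - A x) <= e].
Proof.
move=> nu0 rho0 gA gAn cv.
have bnd f : gevrey_SL2 nu rho f -> exists C, coef_bound nu rho (fourier_coef f) C.
  move=> [[_ lt _] _]; have [C hC] : exists C : R, (gevrey_norm nu rho f <= C%:E)%E.
    case: (gevrey_norm nu rho f) lt => [r| |] // _; first by exists r.
    by exists 0; exact: leNye.
  by exists (4 * C); exact: gevrey_coef_bound.
have uc f : gevrey_SL2 nu rho f -> mucont f.
  move=> gf; have [C cC] := bnd f gf.
  exact: represents_mucont nu0 rho0 cC (gevrey_represents gf.1).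
have unif (e : R) : 0 < e -> exists n0 : nat, forall n, (n0 <= n)%N ->
    coef_bound nu rho (fun k => fourier_coef (A_ n) k - fourier_coef A k) e.
  move=> e0; have e4 : 0 < e / 4 by rewrite divr_gt0.
  move/fine_cvgP: cv => [fin /cvgrPdist_le/(_ _ e4) dist].
  have [n0 _ h] := filterI fin dist; exists n0 => n /h[/= fn].
  rewrite sub0r normrN => d.
  have := @gevrey_coef_bound R nu rho (fun t => A_ n t - A t) (e / 4).
  rewrite -(fineK fn) lee_fin => /(_ (le_trans (ler_norm _) d)).
  have -> : 4 * (e / 4) = e by field.
  rewrite (_ : fourier_coef _ = fun k => fourier_coef (A_ n) k - fourier_coef A k)//.
  by apply/funext => k; rewrite (fourier_coefB _ (uc _ (gAn n)) (uc _ gA)).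
have [C0 hC0] := bnd A gA.
exists (Num.max 1 (C0 + 1)); first by rewrite le_max lexx.
have mono c C C' : C <= C' -> coef_bound nu rho c C -> coef_bound nu rho c C'.
  by move=> CC h N; apply: le_trans (h N) CC.
have rep n := representsB (gevrey_represents (gAn n).1) (gevrey_represents gA.1).
split.
- exists (fourier_coef A); split; [|exact: gevrey_represents gA.1|exact: gA.2|by case: gA.1].
  by apply: mono hC0; rewrite le_max; apply/orP; right; rewrite lerDl.
- have [n0 h] := unif _ ltr01; exists n0 => n /h {}h.
  exists (fourier_coef (A_ n)); split; [|exact: gevrey_represents (gAn n).1|exact: (gAn n).2|by case: (gAn n).1].
  have := coef_boundD (ltW rho0) hC0 h.
  rewrite [X in coef_bound _ _ X](_ : _ = fourier_coef (A_ n)); last by apply/funext => k; rewrite addrC subrK.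
  by apply: mono; rewrite le_max lexx orbT.
move=> e /unif[n0 h]; exists n0 => n /h {}h x.
exact: (represents_le (ltW rho0) h (rep n) x).
Qed.

End Lyapunov.

(** * Passage to the limit along the convergents *)

Section Limit.
Variable R : realType.

Lemma eventually_lt (P : nat -> nat -> Prop) :
  (forall j, exists n0, forall n, (n0 <= n)%N -> P j n) ->
  forall k, exists n0, forall n, (n0 <= n)%N -> forall j, (j < k)%N -> P j n.
Proof.
move=> h; elim=> [|k [n0 IH]]; first by exists 0%N.
have [n1 h1] := h k; exists (n0 + n1)%N => n nn j.
rewrite ltnS leq_eqVlt => /orP[/eqP ->|jk].
  by apply: h1; apply: leq_trans nn; rewrite leq_addl.
by apply: IH => //; apply: leq_trans nn; rewrite leq_addr.
Qed.

Variables (nu rho C alpha : R) (A : R -> 'M[R]_2) (A_ : nat -> R -> 'M[R]_2).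
Hypotheses (nu2 : 2^-1 < nu) (nu1 : nu < 1) (rho0 : 0 < rho) (C1 : 1 <= C).
Hypotheses (irr : irrational alpha) (dioph : diophantine alpha).
Hypothesis clsA : in_class nu rho C A.
Variable n0 : nat.
Hypothesis clsAn : forall n, (n0 <= n)%N -> in_class nu rho C (A_ n).
Hypothesis unif : forall e : R, 0 < e ->
  exists m : nat, forall n, (m <= n)%N -> forall x, nrm (A_ n x - A x) <= e.

Let beta n : R := (cf_num alpha n)%:~R / (cfq alpha n)%:R.

Lemma convergents_cvg (d : R) : 0 < d -> exists m : nat, forall n, (m <= n)%N ->
  `|beta n - alpha| <= d.
Proof.
move=> d0; have [m hm] := ex_nat_ge d^-1; exists m => n mn.
have q0 : (1 : R) <= (cfq alpha n)%:R by rewrite ler1n cfq_gt0.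
apply: le_trans (cf_dist irr (leqnn n)) _.
rewrite -[X in _ <= X]invrK lef_pV2 ?posrE ?invr_gt0//; last first.
  by rewrite exprn_gt0//; apply: lt_le_trans q0.
apply: le_trans (hm n mn) _; apply: (@le_trans _ _ (cfq alpha n)%:R).
  by rewrite ler_nat cfq_ge.
by rewrite expr2 ler_peMl//; apply: le_trans q0.
Qed.

Lemma lrate_cvg N (e : R) : (0 < N)%N -> 0 < e -> exists m : nat, forall n, (m <= n)%N ->
  `|lrate (beta n) (A_ n) N - lrate alpha A N| <= e.
Proof.
move=> N0 e0; have [uf fC df pf] := class_ucont nu2 rho0 clsA.
have [d d0 h] := lrate_near alpha uf fC C1 df N0 e0.
have [m1 h1] := convergents_cvg d0; have [m2 h2] := unif d0.
exists (n0 + m1 + m2)%N => n nn.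
have [k0 [k1 k2]] : (n0 <= n)%N /\ (m1 <= n)%N /\ (m2 <= n)%N by move: nn; clear; lia.
have [ufn fCn dfn pfn] := class_ucont nu2 rho0 (clsAn k0).
by apply: h => //; [exact: h1|exact: h2].
Qed.

Lemma lpred_cvg N (e : R) : (0 < N)%N -> 0 < e -> exists m : nat, forall n, (m <= n)%N ->
  lpred alpha A N - e <= lpred (beta n) (A_ n) N.
Proof.
move=> N0 e0; have e3 : 0 < e / 3 by rewrite divr_gt0.
have [m1 h1] := lrate_cvg N0 e3.
have [m2 h2] := @lrate_cvg (2 * N) _ ltac:(by rewrite muln_gt0) e3.
exists (m1 + m2)%N => n nn.
have := h1 n ltac:(by apply: leq_trans nn; rewrite leq_addr).
have := h2 n ltac:(by apply: leq_trans nn; rewrite leq_addl).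
rewrite !lpredE// !ler_norml.
by move: (lrate _ _ _) (lrate _ _ _) (lrate _ _ _) (lrate _ _ _) => ? ? ? ? /andP[? ?] /andP[? ?]; lra.
Qed.

(** One scale at which the rate of A is close to its exponent suffices, since the rate at a fixed
    scale converges. *)
Lemma lyapunov_upper (e : R) : 0 < e -> exists m : nat, forall n, (m <= n)%N ->
  lyapunov (beta n) (A_ n) <= lyapunov alpha A + e.
Proof.
move=> e0; have e2 : 0 < e / 2 by rewrite divr_gt0.
have [uf fC df pf] := class_ucont nu2 rho0 clsA.
have [N0 hN] := lyapunov_adherent alpha uf fC C1 df pf e2.
have [m h] := lrate_cvg (ltn0Sn N0) e2.
exists (n0 + m)%N => n nn.
have [ufn fCn dfn pfn] := class_ucont nu2 rho0 (clsAn (leq_trans (leq_addr m n0) nn)).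
have := lyapunov_le (beta n) ufn fCn C1 dfn pfn (ltn0Sn N0).
have := h n (leq_trans (leq_addl n0 m) nn); have := hN _ (leqnSn N0).
rewrite ler_norml; move: (lyapunov _ _) (lyapunov _ _) (lrate _ _ _) (lrate _ _ _) => ? ? ? ? ? /andP[? ?].
by lra.
Qed.

Lemma lyapunov_lower (e : R) : 0 < e -> exists m : nat, forall n, (m <= n)%N ->
  lyapunov alpha A - e <= lyapunov (beta n) (A_ n).
Proof.
move=> e0; have [uf fC df pf] := class_ucont nu2 rho0 clsA.
(* The avalanche principle needs growth, hence a positive exponent; otherwise the nonnegativity of
   exponents concludes. *)
have [L0|Lneg] := ltP 0 (lyapunov alpha A); last first.
  exists n0 => n nn; have [ufn fCn dfn pfn] := class_ucont nu2 rho0 (clsAn nn).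
  have := lyapunov_ge0 (beta n) ufn fCn C1 dfn pfn.
  by move: Lneg; move: (lyapunov _ _) (lyapunov _ _) => *; lra.
set Ls := lyapunov alpha A in L0 *.
pose eps := Num.min e (Ls / 4).
have eps0 : 0 < eps by rewrite lt_min e0 divr_gt0.
have epsL : eps <= Ls / 4 by rewrite ge_min lexx orbT.
have epse : eps <= e by rewrite ge_min lexx.
have [b1 [n1 [b10 qb links]]] := cf_links irr dioph.
have [J1 chain] := scale_chain nu2 nu1 rho0 C1 b10 eps0 epsL.
have eps2 : 0 < eps / 2 by rewrite divr_gt0.
have eps4 : 0 < eps / 4 by rewrite divr_gt0.
have [N0 hN0] := lyapunov_adherent alpha uf fC C1 df pf eps2.
have [n2 large] := cfJ_large irr (J1 + N0 + 1).
pose j0 := (n1 + n2)%N; have [j1 link] := links j0 (leq_addr _ _).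
pose J := cfJ alpha; pose Q := cfQ alpha; pose N j := (J j ^ 2 * Q j)%N.
have scale j : (j0 <= j)%N -> [/\ (J1 <= J j)%N, (N0 < N j)%N, (4 * Q j <= cfq alpha j)%N,
    (cfq alpha j <= 8 * Q j)%N & (Q j <= 2 ^ J j < 2 * Q j)%N].
  move=> jj; have [q4 Jl] := large j (leq_trans (leq_addl _ _) jj).
  have [h1 h2 h3] := cfQ_bounds q4; split => //; first by move: Jl; rewrite /J; clear; lia.
  have Q0 : (0 < Q j)%N by move: h2 q4; rewrite /Q; clear; lia.
  rewrite /N; apply: leq_trans (leq_pmulr _ Q0); move: Jl; rewrite /J -mulnn; clear; nia.
(* All rates are at least Ls, and those at large scales at most Ls + eps / 2, so 2 L_(2N) - L_N >= 2
   Ls - (Ls + eps / 2). *)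
have base j : (j0 <= j)%N -> Ls - eps / 2 <= lpred alpha A (N j).
  move=> /scale[_ Nj _ _ _]; have Np : (0 < N j)%N by apply: leq_trans Nj.
  have := hN0 _ (ltnW Nj).
  have := lyapunov_le alpha uf fC C1 df pf (_ : 0 < 2 * N j)%N.
  rewrite muln_gt0 Np lpredE// => /(_ isT); rewrite -/Ls.
  by move: (lrate _ _ _) (lrate _ _ _) => *; lra.
(* Continuity transfers only the finitely many scales j0 <= j < j1 below the range of the links, at
   a further cost eps / 4; the chain reaches the others. *)
have [m1 near] : exists m, forall n, (m <= n)%N -> forall j, (j < j1)%N -> (j0 <= j)%N ->
    Ls - 3 / 4 * eps <= lpred (beta n) (A_ n) (N j).
  apply: eventually_lt => j; have [jj|jj] := leqP j0 j; last by exists 0%N.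
  have [_ Nj _ _ _] := scale j jj.
  have [m hm] := lpred_cvg (leq_trans (ltn0Sn _) Nj) eps4; exists m => n /hm h _.
  by have := base j jj; move: h; move: (lpred _ _ _) (lpred _ _ _) => *; lra.
exists (n0 + m1 + j0)%N => n nn.
have [k0 [k1 k2]] : (n0 <= n)%N /\ (m1 <= n)%N /\ (j0 <= n)%N by move: nn; clear; lia.
have clsn := clsAn k0; have [ufn fCn dfn pfn] := class_ucont nu2 rho0 clsn.
have key N' : (N n <= N')%N ->
    Ls - eps <= lrate (beta n) (A_ n) N' + 4 * (1 + ln C) * ((N n)%:R / N'%:R).
  apply: (chain J Q j0 j1 n (beta n) (A_ n) clsn _ _ _ k2 (cfq alpha n)).
  - move=> j /andP[jj jn]; have [s1 _ s3 s4 s5] := scale j jj; split => //.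
    exact: (cf_separated irr jn s3 s4).
  - by move=> j /andP[jj jj1] _; apply: near.
  - by move=> j /andP[/link].
  - by apply: qb; apply: leq_trans k2; rewrite leq_addr.
  exact: (cf_orbit_classes irr n (N n)).
apply: (@le_trans _ _ (Ls - eps)); first by rewrite lerD2l lerN2.
apply/ler_addgt0Pr => d d0; have d2 : 0 < d / 2 by rewrite divr_gt0.
have [M hM] := lyapunov_adherent (beta n) ufn fCn C1 dfn pfn d2.
have [M' hM'] := ex_nat_ge (4 * (1 + ln C) * (N n)%:R / (d / 2)).
(* With n fixed, N' is so large that both the term in N_n / N' and the distance from the rate to the
   exponent are at most d / 2. *)
pose N' := (N n + M + M').+1.
have N'0 : (0 : R) < N'%:R by rewrite ltr0n.
have := key N' ltac:(by rewrite /N'; clear; lia).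
have := hM N' ltac:(by rewrite /N'; clear; lia).
have := hM' N' ltac:(by rewrite /N'; clear; lia).
rewrite ler_pdivrMr// [N'%:R * _]mulrC -ler_pdivrMr// -[_ * (N n)%:R / _]mulrA.
by move: (lyapunov _ _) (lrate _ _ _) (_ * (_ / _)) => *; lra.
Qed.

End Limit.

Theorem theorem6p3 (R : realType) (rho nu alpha : R)
    (A : R -> 'M[R]_2) (A_ : nat -> R -> 'M[R]_2)
    (rho_gt0 : 0 < rho) (nu_gt : 2^-1 < nu) (nu_lt1 : nu < 1)
    (alpha_gt0 : 0 < alpha) (alpha_lt1 : alpha < 1)
    (alpha_irr : irrational alpha)
    (alpha_dioph : diophantine alpha)
    (A_gevrey : gevrey_SL2 nu rho A)
    (An_gevrey : forall n, gevrey_SL2 nu rho (A_ n))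
    (An_cvg : (fun n => gevrey_norm nu rho (fun t => A_ n t - A t)) @ \oo
                --> (0 : \bar R)%E) :
  (fun n => lyapunov ((cf_num alpha n)%:~R / (cf_den alpha n)%:~R) (A_ n)) @ \oo
    --> lyapunov alpha A.
Proof.
have nu_gt0 : 0 < nu by apply: lt_trans nu_gt; rewrite invr_gt0.
have [C C1 [clsA [n0 clsAn] unif]] := gevrey_class nu_gt0 rho_gt0 A_gevrey An_gevrey An_cvg.
apply/cvgrPdist_le => e e0.
have [m1 up] := lyapunov_upper nu_gt rho_gt0 C1 alpha_irr clsA clsAn unif e0.
have [m2 low] := lyapunov_lower nu_gt nu_lt1 rho_gt0 C1 alpha_irr alpha_dioph clsA clsAn unif e0.
exists (m1 + m2)%N => // n /= nn.
have := up n (leq_trans (leq_addr _ _) nn); have := low n (leq_trans (leq_addl _ _) nn).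
rewrite (cfqE alpha_irr); move: (lyapunov _ _) (lyapunov _ _) => *.
by rewrite ler_norml; apply/andP; split; lra.
Qed.
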